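(* Let $\Gamma:\mathbb{R}^3\to\mathbb{R}$ be bounded, radially symmetric and continuously differentiable, and let $\omega>m>0$. Let $w_0\in X_1$, $w_0\not\equiv 0$, be a solution of $$-\Delta w_0+m^2w_0=\Gamma(x)\,w_0^3\quad\text{on }\mathbb{R}^3,$$ so that $U^0(t,x)=w_0(x)$ is a stationary solution of the cubic Klein-Gordon equation $$\partial_t^2U-\Delta U+m^2U=\Gamma(x)\,U^3\quad\text{on }\mathbb{R}\times\mathbb{R}^3.\qquad(\mathrm{KG})$$ Assume that $w_0$ is nondegenerate in the following sense: whenever $q_0\in X_1$ satisfies $-\Delta q_0+m^2q_0=3\,\Gamma(x)\,w_0^2\,q_0$ on $\mathbb{R}^3$, then $q_0\equiv 0$. Then for every $s\in\mathbb{N}$ there exist an open interval $J_s\subseteq\mathbb{R}$ with $0\in J_s$ and a family $(U^\alpha)_{\alpha\in J_s}\subseteq C^2(\mathbb{R},X_1)$, whose member at $\alpha=0$ is the stationary solution $U^0=w_0$, with the following properties. (i) Every $U^\alpha$ is a time-periodic, twice continuously differentiable classical solution of (KG) of the polychromatic form $$U^\alpha(t,x)=u_0^\alpha(x)+\sum_{k=1}^\infty 2\cos(\omega kt)\,u_k^\alpha(x),\qquad u_k^\alpha\in X_1 .$$ (ii) The map $\alpha\mapsto(u_k^\alpha)_{k\in\mathbb{N}_0}$ is smooth from $J_s$ into $\ell^1(\mathbb{N}_0,X_1)$, and for $k\in\mathbb{N}_0$ $$\frac{\mathrm{d}}{\mathrm{d}\alpha}\Big|_{\alpha=0}u_k^\alpha\not\equiv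 0\quad\text{if and only if}\quad k=s .$$ In particular, for all sufficiently small $\alpha\neq 0$ the solution $U^\alpha$ is non-stationary (not constant in $t$). Moreover, for different values of $s$ the families mutually differ close to $U^0$: denoting by $(U^{\alpha,s})_{\alpha\in J_s}$ the family belonging to $s$, for $s\neq s'$ there is $\varepsilon>0$ such that $U^{\alpha,s}\neq U^{\beta,s'}$ whenever $0<|\alpha|<\varepsilon$ and $0<|\beta|<\varepsilon$. (iii) If additionally $\Gamma(x)\neq 0$ for almost all $x\in\mathbb{R}^3$, then for every non-stationary $U^\alpha$ there are infinitely many $k$ with $u_k^\alpha\not\equiv 0$.
   Context: $\mathbb{N}=\{1,2,3,\dots\}$, $\mathbb{N}_0=\mathbb{N}\cup\{0\}$. $\Delta$ acts on the space variable $x\in\mathbb{R}^3$ only. $X_1$ is the Banach space of all radially symmetric continuous functions $u:\mathbb{R}^3\to\mathbb{R}$ with $$\|u\|_{X_1}:=\sup_{x\in\mathbb{R}^3}(1+|x|^2)^{1/2}|u(x)|<\infty .$$ $\ell^1(\mathbb{N}_0,X_1)$ is the Banach space of sequences $(u_k)_{k\in\mathbb{N}_0}$ in $X_1$ with $\sum_k\|u_k\|_{X_1}<\infty$. $C^2(\mathbb{R},X_1)$ denotes the twice continuously differentiable maps $t\mapsto U(t,\cdot)$ from $\mathbb{R}$ to $X_1$. The stationary equations for $w_0$ and $q_0$ are understood in the distributional sense (all such solutions in $X_1$ are twice differentiable by elliptic regularity). *)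

(* Defs.v *)
From HB Require Import structures.
From mathcomp Require Import all_boot all_order all_algebra.
From mathcomp Require Import all_classical all_reals all_analysis.

Set Implicit Arguments.
Unset Strict Implicit.
Unset Printing Implicit Defensive.

Import Order.TTheory GRing.Theory Num.Theory.
Import numFieldNormedType.Exports.

Local Open Scope classical_set_scope.
Local Open Scope ring_scope.

(** [R * R * R] is a normed module whose library norm is the max norm, hence
    the separate Euclidean norm [enorm]; the topologies coincide. *)
Notation R3 R := (R * R * R)%type.

Section Euclidean_space.
Context {R : realType}.
Implicit Types (x y : R3 R) (f : R3 R -> R).

Definition enorm x : R := Num.sqrt (x.1.1 ^+ 2 + x.1.2 ^+ 2 + x.2 ^+ 2).

Definition radial f := forall x y, enorm x = enorm y -> f x = f y.

Definition laplacian f : R3 R -> R :=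
  let e1 : R3 R := (1, 0, 0) in
  let e2 : R3 R := (0, 1, 0) in
  let e3 : R3 R := (0, 0, 1) in
  fun x => 'D_e1 ('D_e1 f) x + 'D_e2 ('D_e2 f) x + 'D_e3 ('D_e3 f) x.

Definition lebesgue3 : set (measurableTypeR R * measurableTypeR R
    * measurableTypeR R)%type -> \bar R :=
  ((@lebesgue_measure R \x @lebesgue_measure R) \x @lebesgue_measure R)%E.
HB.instance Definition _ := Measure.on lebesgue3.

End Euclidean_space.

(** [Ck D n f]: [f] is n times continuously differentiable on the open set [D].
    All iterated directional derivatives of order at most n exist and are
    continuous, which is the usual notion when the source [V] is finite
    dimensional; it is only used for [V] equal to [R], [R3] and [R * R3],
    with arbitrary normed target [W]. *)
Fixpoint Ck {R : realType} {V W : normedModType R}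
    (D : set V) (n : nat) (f : V -> W) : Prop :=
  (forall x, D x -> {for x, continuous f}) /\
  (if n is n'.+1 then
     forall v : V, (forall x, D x -> derivable f x v) /\ Ck D n' ('D_v f)
   else True).

Definition smooth {R : realType} {V W : normedModType R}
    (D : set V) (f : V -> W) : Prop := forall n, Ck D n f.

Section space_X1.
Context {R : realType}.

Definition X1_weight (x : R3 R) : R := Num.sqrt (1 + enorm x ^+ 2).

Definition X1_set : set (R3 R -> R) :=
  [set u | [/\ radial u, continuous u &
             has_ubound (range (fun x => X1_weight x * `|u x|))]].

Definition X1_pred : {pred R3 R -> R} := mem X1_set.

End space_X1.

Record X1 (R : realType) := MkX1 {
  X1_fun :> R3 R -> R ;
  X1_funP : X1_fun \in (@X1_pred R) }.

Section X1_normed.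
Context {R : realType}.

HB.instance Definition _ := [isSub for @X1_fun R].
HB.instance Definition _ := [Choice of X1 R by <:].

Lemma X1_submod_closed : submod_closed (@X1_pred R).
Proof.
split.
  rewrite inE; split => //; first exact: cst_continuous.
  by exists 0 => _ [x _ <-] /=; rewrite normr0 mulr0.
move=> a u v; rewrite !inE => -[ru cu [M uM]] [rv cv [N vN]]; split.
- by move=> x y xy; rewrite /GRing.add/= /GRing.scale/= (ru x y)// (rv x y).
- move=> x; apply: (@continuousD _ _ _ (a *: u) v); last exact: cv.
  by apply: continuousZr; exact: cu.
- exists (`|a| * M + N) => _ [x _ <-].
  have -> : (a *: u + v) x = a * u x + v x by [].
  have w0 : 0 <= X1_weight x by exact: sqrtr_ge0.
  apply: (@le_trans _ _ (X1_weight x * (`|a| * `|u x| + `|v x|))).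
    by rewrite ler_wpM2l// -normrM ler_normD.
  rewrite mulrDr lerD//; last by apply: vN; exists x.
  by rewrite mulrCA ler_wpM2l//; apply: uM; exists x.
Qed.

HB.instance Definition _ :=
  GRing.isSubmodClosed.Build _ _ (@X1_pred R) X1_submod_closed.
HB.instance Definition _ := [SubChoice_isSubLmodule of X1 R by <:].

Definition X1_norm (u : X1 R) : R :=
  sup (range (fun x => X1_weight x * `|u x|)).

Let X1_has_sup (u : X1 R) : has_sup (range (fun x => X1_weight x * `|u x|)).
Proof.
split; first by exists (X1_weight 0 * `|u 0|); exists 0.
by have := X1_funP u; rewrite inE => -[].
Qed.

Let X1_norm_ub (u : X1 R) x : X1_weight x * `|u x| <= X1_norm u.
Proof. by apply: sup_upper_bound; [exact: X1_has_sup | exists x]. Qed.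

Let X1_norm_le (u : X1 R) M :
  (forall x, X1_weight x * `|u x| <= M) -> X1_norm u <= M.
Proof.
move=> uM; apply: ge_sup; first by case: (X1_has_sup u).
by move=> _ [x _ <-].
Qed.

Let X1_weight_gt0 (x : R3 R) : 0 < X1_weight x.
Proof. by rewrite sqrtr_gt0 ltr_wpDr// sqr_ge0. Qed.

Let X1_normD (u v : X1 R) : X1_norm (u + v) <= X1_norm u + X1_norm v.
Proof.
apply: X1_norm_le => x; have -> : (u + v) x = u x + v x by [].
apply: le_trans (lerD (X1_norm_ub u x) (X1_norm_ub v x)).
by rewrite -mulrDr ler_wpM2l ?ler_normD// ltW.
Qed.

Let X1_normZ_le (l : R) (u : X1 R) : X1_norm (l *: u) <= `|l| * X1_norm u.
Proof.
apply: X1_norm_le => x; have -> : (l *: u) x = l * u x by [].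
by rewrite normrM mulrCA ler_wpM2l.
Qed.

Let X1_normZ (l : R) (u : X1 R) : X1_norm (l *: u) = `|l| * X1_norm u.
Proof.
apply/eqP; rewrite eq_le X1_normZ_le/=.
have [->|l0] := eqVneq l 0.
  rewrite normr0 mul0r; apply: le_trans (X1_norm_ub _ 0).
  by rewrite mulr_ge0// ltW.
rewrite -ler_pdivlMl ?normr_gt0// -normfV.
by rewrite -[in leLHS](scalerK l0 u) X1_normZ_le.
Qed.

Let X1_norm0_eq0 (u : X1 R) : X1_norm u = 0 -> u = 0.
Proof.
move=> u0; apply/val_inj/funext => x; have -> : val (0 : X1 R) x = 0 by [].
apply/eqP; rewrite -normr_eq0 eq_le normr_ge0 andbT.
by rewrite -(ler_pM2l (X1_weight_gt0 x)) mulr0 -u0 X1_norm_ub.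
Qed.

HB.instance Definition _ :=
  @Lmodule_isNormed.Build R (X1 R) X1_norm X1_normD X1_normZ X1_norm0_eq0.

End X1_normed.

Definition ell1_set {R : realType} (V : normedModType R) : set (nat -> V) :=
  [set u : nat -> V | cvgn (series (Num.norm \o u))].
Arguments ell1_set {R} V.

Definition ell1_pred {R : realType} (V : normedModType R) : {pred nat -> V} :=
  mem (ell1_set V).
Arguments ell1_pred {R} V.

Record ell1 (R : realType) (V : normedModType R) := MkEll1 {
  ell1_seq :> nat -> V ;
  ell1_seqP : ell1_seq \in ell1_pred V }.

Section ell1_normed.
Context {R : realType} {V : normedModType R}.

HB.instance Definition _ := [isSub for @ell1_seq R V].
HB.instance Definition _ := [Choice of ell1 V by <:].

Lemma ell1_submod_closed : submod_closed (ell1_pred V).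
Proof.
split.
  rewrite inE /ell1_set/=.
  have -> : series (Num.norm \o (0 : nat -> V)) = cst 0.
    apply/funext => n; rewrite /series/= big1// => i _; exact: normr0.
  exact: is_cvg_cst.
move=> a u v; rewrite !inE /ell1_set/= => cu cv.
apply: (@series_le_cvg _ _ (fun k => `|a| * `|u k| + `|v k|)).
- by move=> n; exact: normr_ge0.
- by move=> n; rewrite addr_ge0// mulr_ge0.
- by move=> n /=; rewrite -normrZ; exact: ler_normD.
- have -> : series (fun k => `|a| * `|u k| + `|v k|) =
      `|a| *: series (Num.norm \o u) + series (Num.norm \o v).
    apply/funext => n.
    by rewrite /series/= big_split/= -mulr_sumr.
  by apply: is_cvgD => //; exact: is_cvgZr.
Qed.

HB.instance Definition _ :=
  GRing.isSubmodClosed.Build _ _ (ell1_pred V) ell1_submod_closed.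
HB.instance Definition _ := [SubChoice_isSubLmodule of ell1 V by <:].

Definition ell1_norm (u : ell1 V) : R := limn (series (Num.norm \o u)).

Let ell1_cvg (u : ell1 V) : cvgn (series (Num.norm \o u)).
Proof. by have := ell1_seqP u; rewrite inE. Qed.

Let ell1_normD (u v : ell1 V) : ell1_norm (u + v) <= ell1_norm u + ell1_norm v.
Proof.
rewrite /ell1_norm -limD; [|exact: ell1_cvg..].
apply: ler_lim; [exact: ell1_cvg|by apply: is_cvgD; exact: ell1_cvg|].
apply: nearW => n.
have -> : (series (Num.norm \o u) + series (Num.norm \o v)) n =
  \sum_(0 <= k < n) (`|u k| + `|v k|) by rewrite big_split.
by apply: ler_sum => k _; exact: ler_normD.
Qed.

Let ell1_normZ (l : R) (u : ell1 V) : ell1_norm (l *: u) = `|l| * ell1_norm u.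
Proof.
apply/cvg_lim => //.
have -> : series (Num.norm \o (l *: u)) =
    (fun n => `|l| *: series (Num.norm \o u) n).
  apply/funext => n; rewrite /series/= scaler_sumr.
  by apply: eq_bigr => k _; exact: normrZ.
by apply: cvgZr; exact: ell1_cvg.
Qed.

Let ell1_norm0_eq0 (u : ell1 V) : ell1_norm u = 0 -> u = 0.
Proof.
move=> u0; apply/val_inj/funext => k; have -> : val (0 : ell1 V) k = 0 by [].
apply/eqP; rewrite -normr_le0 -u0.
apply: (@le_trans _ _ (series (Num.norm \o u) k.+1)).
  rewrite /series/= big_nat_recr//= ler_wpDl//.
  by apply: sumr_ge0 => i _; exact: normr_ge0.
apply: nondecreasing_cvgn_le; last exact: ell1_cvg.
by apply: nondecreasing_series => i _ _; exact: normr_ge0.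
Qed.

HB.instance Definition _ := @Lmodule_isNormed.Build R (ell1 V)
  ell1_norm ell1_normD ell1_normZ ell1_norm0_eq0.

End ell1_normed.

Section Klein_Gordon.
Context {R : realType}.

Definition test_function (phi : R3 R -> R) : Prop :=
  smooth setT phi /\ compact (closure [set x | phi x != 0]).

(** [- laplacian w + m^2 w = f] in the sense of distributions on [R3]. *)
Definition distributional_solution (m : R) (w f : R3 R -> R) : Prop :=
  forall phi, test_function phi ->
    \int[lebesgue3]_x (w x * (- laplacian phi x + m ^+ 2 * phi x)) =
    \int[lebesgue3]_x (f x * phi x).

Definition KG_classical_solution (m : R) (Gamma : R3 R -> R)
    (U : R -> R3 R -> R) : Prop :=
  Ck setT 2 (fun p : R * R3 R => U p.1 p.2) /\
  forall t x, derive1n 2 (fun t' => U t' x) t - laplacian (U t) x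
              + m ^+ 2 * U t x = Gamma x * U t x ^+ 3.

Definition time_periodic {T : Type} (U : R -> T) : Prop :=
  exists2 p : R, 0 < p & forall t, U (t + p) = U t.

Definition stationary {T : Type} (U : R -> T) : Prop :=
  forall t t', U t = U t'.

Definition polychromatic (omega : R) (u : nat -> X1 R) (U : R -> X1 R) : Prop :=
  forall t x,
    (fun n => u 0%N x
      + \sum_(1 <= k < n) 2 * cos (omega * k%:R * t) * u k x) @ \oo --> U t x.

End Klein_Gordon.

(* Main.v *)
Require Import Defs.
From HB Require Import structures.
From mathcomp Require Import all_boot all_order all_algebra.
From mathcomp Require Import all_classical all_reals all_analysis measurable_realfun.
From mathcomp Require Import ring lra zify.
Import Order.TTheory GRing.Theory Num.Theory.
Import numFieldNormedType.Exports.
Set Implicit Arguments.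
Unset Strict Implicit.
Unset Printing Implicit Defensive.
Local Open Scope classical_set_scope.
Local Open Scope ring_scope.

(** The solutions are constructed as Lindstedt series
      [U = w0 + a * cos (omega s t) * phi + a^2 * p_2 + a^3 * p_3 + ...]
    in which the amplitude [a] of the critical mode is the parameter of the family.
    Comparing powers of [a] in the cubic equation gives at order [n] a linear equation
    for [p_n], whose source is a cubic expression in the lower orders. A source that is
    a finite sum of standing waves [cos (omega k t) f x] is treated separately for each
    [k], by inverting the radial operator
      [- laplacian + m^2 - (omega k)^2 - 3 Gamma w0^2].

    No solvability condition appears, because each of these operators has a bounded
    right inverse on radial functions, for sources that decay like [|x|^-3], with a
    bound that does not depend on [k] ([right_inverse]). For [k >= 1] the operator lies
    above the threshold [(omega k)^2 > m^2]: all solutions of the reduced equation for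
    [y = r v] are bounded by an energy estimate ([oscillatory_bound]), so that [v]
    decays like [1 / r], and one solves the initial value problem from the origin. The
    homogeneous solution with value 1 at the origin is the mode [phi]. For [k = 0] the
    bounded solutions on a half line, found by shooting ([shooting]), form an affine
    line, and nondegeneracy of [w0] says that the homogeneous ones do not vanish at the
    origin; hence some bounded solution satisfies the condition [y 0 = 0]
    ([zero_modes]).

    Since the bounds are uniform, the sizes of the [p_n] obey a cubic recursion of
    convolution type, which is dominated by a geometric sequence ([majorant]); the
    series therefore has a positive radius of convergence in [X1], and so does its
    sequence of cosine coefficients in [ell1]. A power series is smooth in [a]
    ([psum_smooth]). As only wave numbers up to [s n] occur in [p_n], derivatives in
    time and space cost powers of [n], and the series may be differentiated term by
    term ([lindstedt_KG]). The equation in its classical form requires that [w0] be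
    twice differentiable; this comes from uniqueness of bounded weak solutions of
    [- laplacian h + m^2 h = 0], proved by a maximum principle for mollifications
    ([weak_solution_le0], [stationary_regularity]).

    The linear term of the series gives the derivative of the coefficients at [a = 0].
    Evaluating [U = w0 + a * cos (omega s t) * phi + O(a^2)] at the origin and at two
    times shows that the members are not stationary and that different [s] give
    different members ([nonstationary_first_order], [separated_first_order]). Finally,
    if [U] had finitely many frequencies, the largest being [K >= 1], then [Gamma U^3]
    would contain the frequency [3 K] with coefficient a multiple of [Gamma u_K^3],
    while the linear part of the equation contains no frequency above [K]; a discrete
    Fourier functional in time separates the two, so that [u_K = 0] wherever [Gamma]
    is nonzero ([infinitely_many_frequencies]). *)

(** * Series of functions *)

Section summable_series.
Context {R : realType}.

(** Completeness through absolutely convergent series, the form in which it passes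
    from [V] to [ell1 V]. *)
Definition summable_complete (W : normedModType R) :=
  forall u : nat -> W, cvgn (series (Num.norm \o u)) -> cvgn (series u).

Lemma summable_complete_real : summable_complete R.
Proof. by move=> u cu; exact: (@normed_cvg R R^o). Qed.

Variables (W : normedModType R) (cW : summable_complete W).
Implicit Types (u : nat -> W) (M : nat -> R).

Lemma dominated_summable u M : (forall n, `|u n| <= M n) ->
  cvgn (series M) -> cvgn (series (Num.norm \o u)).
Proof.
move=> uM cM; apply: series_le_cvg cM => n //=.
by rewrite (le_trans _ (uM n)).
Qed.

Lemma cvg_dominated_series u M : (forall n, `|u n| <= M n) ->
  cvgn (series M) -> cvgn (series u).
Proof. by move=> uM cM; apply: cW; exact: dominated_summable cM. Qed.

Lemma series_partial_le M m n : (forall n, 0 <= M n) -> (m <= n)%N ->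
  series M m <= series M n.
Proof.
by move=> M0; apply: nondecreasing_series => i _ _.
Qed.

Lemma series_tail u M N : (forall n, `|u n| <= M n) -> cvgn (series M) ->
  `|limn (series u) - series u N| <= limn (series M) - series M N.
Proof.
move=> uM cM; have cu := cvg_dominated_series uM cM.
have M0 n : 0 <= M n by rewrite (le_trans _ (uM n)).
have c1 : (fun n => `|series u n - series u N|) @ \oo -->
    `|limn (series u) - series u N|.
  by apply: cvg_norm; apply: cvgB => //; exact: cvg_cst.
rewrite -(cvg_lim _ c1)//.
apply: limr_le; first by apply/cvg_ex; eexists; exact: c1.
exists N => // n /= Nn.
rewrite /series/= (big_cat_nat (leq0n N) Nn)//= addrAC subrr add0r.
apply: (le_trans (ler_norm_sum _ _ _)).
apply: (@le_trans _ _ (series M n - series M N)).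
  rewrite /series/= (big_cat_nat (F := M) (leq0n N) Nn)//= addrAC subrr add0r.
  exact: ler_sum.
rewrite lerD2r; apply: nondecreasing_cvgn_le => //.
by move=> a b; exact: series_partial_le.
Qed.

Lemma norm_limn_series u M : (forall n, `|u n| <= M n) -> cvgn (series M) ->
  `|limn (series u)| <= limn (series M).
Proof.
move=> uM cM; have := series_tail 0 uM cM.
by rewrite /series/= !big_geq// !subr0.
Qed.

Lemma partial_le_limn M n : (forall n, 0 <= M n) -> cvgn (series M) ->
  series M n <= limn (series M).
Proof.
move=> M0 cM; apply: nondecreasing_cvgn_le => //.
by move=> a b; exact: series_partial_le.
Qed.

(** Tannery's theorem: this is what allows every later limit, derivative and
    continuity statement to be taken term by term. *)
Lemma tannery (T : Type) (F : set_system T) {FF : ProperFilter F}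
    (f : nat -> T -> W) (g : nat -> W) M :
  (forall n, f n @ F --> g n) ->
  (\forall h \near F, forall n, `|f n h| <= M n) -> cvgn (series M) ->
  (fun h => limn (series (f^~ h))) @ F --> limn (series g).
Proof.
move=> fg fM cM.
have gM n : `|g n| <= M n.
  have c1 : (fun h => `|f n h|) @ F --> `|g n| by apply: cvg_norm; exact: fg.
  rewrite -(cvg_lim _ c1)//.
  apply: limr_le; first by apply/cvg_ex; eexists; exact: c1.
  by apply: filterS fM => h /(_ n).
apply/cvgrPdist_lt => e e0.
have e3 : 0 < e / 3 by rewrite divr_gt0.
have /cvgrPdist_lt/(_ _ e3)[N _ HN] := cM.
have {}HN := HN N (leqnn N).
have sN : (fun h => series (f^~ h) N) @ F --> series g N.
  elim: N {HN} => [|N IH].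
    by rewrite /series/= big_geq//; under eq_fun do rewrite big_geq//;
      exact: cvg_cst.
  rewrite seriesSr; under eq_fun do rewrite seriesSr.
  exact: cvgD.
move/cvgrPdist_lt : sN => /(_ _ e3); move: fM; apply: filterS2 => h fM hN.
have t1 := series_tail N gM cM; have t2 := series_tail N fM cM.
have tN : limn (series M) - series M N < e / 3.
  by apply: le_lt_trans HN; exact: ler_norm.
have -> : limn (series g) - limn (series (f^~ h)) =
  (limn (series g) - series g N) + (series g N - series (f^~ h) N)
  - (limn (series (f^~ h)) - series (f^~ h) N).
  by rewrite addrA subrK opprB addrA subrK.
apply: (le_lt_trans (ler_normB _ _)).
apply: (@lt_le_trans _ _ (e / 3 + e / 3 + e / 3)); last by rewrite -!mulrDl; lra.
apply: ltrD; last by apply: le_lt_trans t2 _.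
apply: (le_lt_trans (ler_normD _ _)); apply: ltrD => //.
exact: le_lt_trans t1 _.
Unshelve. all: by end_near.
Qed.

Lemma continuous_series (T : topologicalType) (f : nat -> T -> W) x M :
  (forall n, {for x, continuous (f n)}) ->
  (\forall y \near x, forall n, `|f n y| <= M n) -> cvgn (series M) ->
  {for x, continuous (fun y => limn (series (f^~ y)))}.
Proof. move=> cf fM cM.
have h := tannery (f := f) (g := f^~ x) cf fM cM.
exact: h. Qed.

Lemma is_derive_series (V : normedModType R) (f : nat -> V -> W)
    (g : nat -> W) (x v : V) M (d : R) : 0 < d ->
  (forall n, is_derive x v (f n) (g n)) ->
  (forall n h, `|h| < d -> `|f n (h *: v + x) - f n x| <= `|h| * M n) ->
  cvgn (series M) ->
  (forall h, `|h| < d -> cvgn (series (f^~ (h *: v + x)))) ->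
  is_derive x v (fun y => limn (series (f^~ y))) (limn (series g)).
Proof.
move=> d0 fg fM cM cf.
have key : h^-1 *: (limn (series (f^~ (h *: v + x))) - limn (series (f^~ x)))
    @[h --> 0^'] --> limn (series g).
  have cf0 : cvgn (series (f^~ x)).
    by have := cf 0; rewrite normr0 scale0r add0r; exact.
  have E h : `|h| < d ->
      h^-1 *: (limn (series (f^~ (h *: v + x))) - limn (series (f^~ x)))
    = limn (series (fun n => h^-1 *: (f n (h *: v + x) - f n x))).
    move=> hd.
    have -> : series (fun n => h^-1 *: (f n (h *: v + x) - f n x)) =
        (fun N => h^-1 *: (series (f^~ (h *: v + x)) N - series (f^~ x) N)).
      apply/funext => N; rewrite /series/= -scaler_sumr; congr (_ *: _).
      by rewrite sumrB.
    by apply/esym/cvg_lim => //; apply: cvgZr; apply: cvgB => //; exact: cf.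
  apply: (@cvg_trans _ ((fun h => limn (series (fun n =>
      h^-1 *: (f n (h *: v + x) - f n x)))) @ 0^')).
    apply: near_eq_cvg; near=> h; apply/esym/E.
    by near: h; apply: dnbhs0_lt.
  apply: (@tannery _ _ _ (fun n h => h^-1 *: (f n (h *: v + x) - f n x)) _ M) => //.
    by move=> n; have [] := fg n => /cvg_ex[l fl] <-; rewrite /derive (cvg_lim _ fl).
  near=> h => n; have h0 : h != 0 by near: h; exact: nbhs_dnbhs_neq.
  rewrite normrZ normfV ler_pdivrMl ?normr_gt0//; apply: fM.
  by near: h; apply: dnbhs0_lt.
by apply: DeriveDef; [apply/cvg_ex; exists (limn (series g))|exact/cvg_lim].
Unshelve. all: by end_near. Qed.

End summable_series.

(** * Calculus on the line *)

Section calculus.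
Context {R : realType}.
Implicit Types (f g : R -> R).

Lemma is_derive_continuous f (df : R -> R) :
  (forall x : R, is_derive x (1:R) f (df x)) -> continuous f.
Proof.
move=> fdf x; apply: differentiable_continuous.
by apply/derivable1_diffP; exact: ex_derive.
Qed.

Lemma mean_value f (df : R -> R) (a b : R) :
  (forall x : R, is_derive x (1:R) f (df x)) -> a <= b ->
  exists2 c, a <= c <= b & f b - f a = df c * (b - a).
Proof.
move=> fdf ab.
have [|c] := @MVT_segment R f df a b ab (fun x _ => fdf x).
  exact/continuous_subspaceT/(is_derive_continuous fdf).
by rewrite in_itv/= => cab E; exists c.
Qed.

Lemma derive_ge0_le f (df : R -> R) (a b : R) :
  (forall x : R, is_derive x (1:R) f (df x)) -> a <= b ->
  (forall x, a <= x <= b -> 0 <= df x) -> f a <= f b.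
Proof.
move=> fdf ab df0; have [c cab E] := mean_value fdf ab.
by rewrite -subr_ge0 E mulr_ge0 ?df0// subr_ge0.
Qed.

Lemma derive_bound f (df : R -> R) (a b K : R) :
  (forall x : R, is_derive x (1:R) f (df x)) -> a <= b ->
  (forall x, a <= x <= b -> `|df x| <= K) -> `|f b - f a| <= K * (b - a).
Proof.
move=> fdf ab dfK; have [c cab ->] := mean_value fdf ab.
rewrite normrM [`|b - a|]ger0_norm ?subr_ge0//.
by rewrite ler_wpM2r ?subr_ge0// dfK.
Qed.

Lemma derive_dominated f g (df dg : R -> R) (a b : R) :
  (forall x : R, is_derive x (1:R) f (df x)) ->
  (forall x : R, is_derive x (1:R) g (dg x)) -> a <= b ->
  (forall x, a <= x <= b -> `|df x| <= dg x) -> `|f b - f a| <= g b - g a.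
Proof.
move=> fdf gdg ab dfg; rewrite ler_norml; apply/andP; split.
  have : f a + g a <= f b + g b.
    apply: (derive_ge0_le (f := fun x => f x + g x)
      (df := fun x => df x + dg x)) => // x xab.
    by have := dfg _ xab; rewrite ler_norml => /andP[]; lra.
  lra.
have : g a - f a <= g b - f b.
  apply: (derive_ge0_le (f := fun x => g x - f x)
    (df := fun x => dg x - df x)) => // x xab.
  by have := dfg _ xab; rewrite ler_norml => /andP[]; lra.
lra.
Qed.

Lemma bounded_on_segment f (a b : R) : continuous f ->
  exists2 M : R, 0 <= M & forall x, a <= x <= b -> `|f x| <= M.
Proof.
move=> cf; have [ba|ab] := ltP b a.
  by exists 0 => // x /andP[ax xb]; move: (le_trans ax xb); rewrite leNgt ba.
have [|c _ H] := @EVT_max R (fun x => `|f x|) a b ab.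
  apply: continuous_subspaceT => x.
  by apply: cvg_norm; exact: cf.
by exists `|f c| => // x xab; apply: H; rewrite in_itv.
Qed.

Lemma continuous_integrable_itv f (a b : R) : continuous f ->
  (@lebesgue_measure R).-integrable `[a, b] (EFin \o f).
Proof.
move=> cf; apply: continuous_compact_integrable; first exact: segment_compact.
exact: continuous_subspaceT.
Qed.

(** Integration starts from a point to the left of both [0] and [x], which may move
    with [x] since it cancels in the difference of the two integrals. *)
Lemma antiderivative f : continuous f ->
  exists2 F : R -> R, F 0 = 0 & forall x : R, is_derive x (1:R) F (f x).
Proof.
move=> cf.
pose G a x : R := \int[lebesgue_measure]_(t in `[a, x]) f t.
have GE a b x : a <= b -> b <= x -> G a x = G a b + G b x.
  move=> ab bx; rewrite /G.
  have := @Rintegral_itvB R f (BLeft a) (BRight x) b.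
  move=> /(_ (continuous_integrable_itv a x cf)); rewrite !bnd_simp => /(_ ab bx).
  rewrite Rintegral_itv_obnd_cbnd; first by move=> <-; rewrite addrC subrK.
  apply: integrableS (continuous_integrable_itv b x cf) => //.
  exact: subset_itv_oc_cc.
pose N (x : R) : R := `|x| + 1.
pose F x := G (- N x) x - G (- N x) 0.
have FE (M x : R) : N x <= M -> F x = G (- M) x - G (- M) 0.
  move=> xM; rewrite /F (GE (- M) (- N x) x); last 2 first.
  - by rewrite lerN2.
  - by rewrite lerNl /N (le_trans (ler_norm _))// normrN lerDl.
  rewrite (GE (- M) (- N x) 0) ?lerN2//; last first.
    by rewrite lerNl oppr0 addr_ge0.
  lra.
exists F; first by rewrite /F subrr.
move=> x.
apply: (@near_eq_is_derive _ _ _ (fun y => G (- (N x + 1)) y - G (- (N x + 1)) 0)).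
  near=> y; apply/esym/FE; rewrite /N lerD2r.
  rewrite -[y in leLHS](subrK x) (le_trans (ler_normD _ _))// addrC lerD2l.
  rewrite distrC.
  near: y; apply/nbhs_ballP; exists 1 => //= z.
  by rewrite -ball_normE/= => /ltW.
rewrite -[f x]subr0; apply: is_deriveB.
have xN : - (N x + 1) < x.
  by rewrite ltrNl (le_lt_trans (ler_norm _))// normrN /N -addrA ltrDl.
have [] := @continuous_FTC1_closed R f (- (N x + 1)) x (x + 1) _ _ xN (cf x).
- by rewrite ltrDl.
- exact: continuous_integrable_itv.
move=> d1 d2; rewrite /G; apply: DeriveDef; first exact: d1.
by rewrite -derive1E; exact: d2.
Unshelve. all: by end_near. Qed.

End calculus.

(** * Linear equations of second order *)

Section linear_ode.
Context {R : realType}.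
Implicit Types (f g Q h y : R -> R).

Lemma cvg_geometric_half (C : R) : cvgn (series (geometric C 2^-1)).
Proof. by apply: is_cvg_geometric_series; rewrite gtr0_norm//; lra. Qed.

(** Locally uniform summability of values and derivatives, in the form used for
    all scalar series of functions of one variable. *)
Lemma is_derive_series_real (f g : nat -> R -> R) :
  (forall n (x : R), is_derive x (1:R) (f n) (g n x)) ->
  (forall X : R, exists2 M : nat -> R, cvgn (series M) &
     forall n (x : R), `|x| <= X -> `|f n x| <= M n /\ `|g n x| <= M n) ->
  forall x : R, is_derive x (1:R) (fun y : R => limn (series (f^~ y)))
    (limn (series (g^~ x))).
Proof.
move=> fg fM x; have [M cM HM] := fM (`|x| + 1).
apply: (@is_derive_series _ _ summable_complete_real R _ _ x 1 M 1) => //.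
- move=> n h h1; have -> : h *: (1:R) + x = h + x by rewrite -[_ *: _]/(_ * _) mulr1.
  have [h0|h0] := leP 0 h.
    rewrite [`|h|]ger0_norm// mulrC.
    apply: le_trans (derive_bound (K := M n) (a := x) (b := h + x) (fg n) _ _) _.
    - by rewrite lerDr.
    - move=> y /andP[xy yh]; apply: (HM n y _).2.
      rewrite -(subrK x y) (le_trans (ler_normD _ _))// addrC lerD2l.
      rewrite ger0_norm ?subr_ge0// lerBlDr (le_trans yh)// lerD2r.
      exact: le_trans (ler_norm _) (ltW h1).
    - by rewrite addrK.
  rewrite [`|h|]ltr0_norm// mulrC distrC.
  apply: le_trans (derive_bound (K := M n) (a := h + x) (b := x) (fg n) _ _) _.
  - by rewrite gerDr ltW.
  - move=> y /andP[xy yh]; apply: (HM n y _).2.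
    rewrite -(subrK x y) (le_trans (ler_normD _ _))// addrC lerD2l.
    rewrite ler0_norm ?subr_le0// opprB lerBlDr.
    rewrite ltr0_norm// in h1; lra.
  - by rewrite opprD addrA addrAC subrr add0r.
- move=> h _; move: (h *: (1:R) + x) => y; have [M' cM' HM'] := fM `|y|.
  apply: (@cvg_dominated_series _ _ summable_complete_real _ M') => //.
  by move=> n; exact: (HM' n y (lexx _)).1.
Qed.

Lemma limn_series_affine (c q : R) (u g : nat -> R) : g 0%N = c ->
  (forall n, g n.+1 = q * u n) -> cvgn (series u) ->
  limn (series g) = c + q * limn (series u).
Proof.
move=> g0 gS cu; apply/cvg_lim => //.
rewrite -(cvg_shiftS (series g)).
have -> : (fun n => series g n.+1) = (fun n => c + q * series u n).
  apply/funext => n; rewrite /series/= big_nat_recl// g0 mulr_sumr.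
  by congr (_ + _); apply: eq_bigr => i _; exact: gS.
by apply: cvgD; [exact: cvg_cst|apply: cvgMr].
Qed.

(** Each integration gains the factor [1 / l]: with [l] large, Picard iteration
    contracts in the norm weighted by [expR (- l * |x|)]. *)
Lemma primitive_exp_bound f F (K l X x : R) : 0 < l -> 0 <= K -> F 0 = 0 ->
  (forall x : R, is_derive x (1:R) F (f x)) ->
  (forall x, `|x| <= X -> `|f x| <= K * expR (l * `|x|)) ->
  `|x| <= X -> `|F x| <= K / l * expR (l * `|x|).
Proof.
move=> l0 K0 F0 Ff fK.
wlog x0 : f F x F0 Ff fK / 0 <= x.
  move=> wl xX; have [x0|x0] := leP 0 x; first exact: (wl f).
  have := wl (fun t => - f (- t)) (fun t => F (- t)) (- x).
  rewrite opprK normrN; apply => //.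
  - by rewrite oppr0.
  - move=> t.
    have /is_derive_eq : is_derive t (1:R) (F \o -%R) (f (- t) * - 1).
      by apply: is_derive1_comp; exact: is_deriveNid.
    by apply; rewrite mulrN1.
  - by move=> t tX; rewrite normrN -(normrN t); apply: fK; rewrite normrN.
  - by rewrite oppr_ge0 ltW.
move=> xX; rewrite -[F x]subr0 -F0.
pose G t := K / l * expR (l * t).
have dG (t : R) : is_derive t (1:R) G (K * expR (l * t)).
  rewrite /G; apply: is_derive_eq; rewrite -![_ *: _]/(_ * _); field.
  by rewrite gt_eqF.
have H := derive_dominated Ff dG x0.
apply: le_trans (H _) _.
  move=> t /andP[t0 tx]; rewrite -{2}(ger0_norm t0); apply: fK.
  by rewrite ger0_norm// (le_trans tx)// (le_trans (ler_norm _)).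
rewrite /G mulr0 expR0 mulr1 (ger0_norm x0) gerBl divr_ge0// ltW//.
Qed.

(** Picard iteration: the solution is the sum of the corrections [Y n] with
    derivatives [P n], and this sum may be differentiated term by term. *)
Lemma linear_ivp0 Q h (a b : R) : continuous Q -> continuous h ->
  exists y y' : R -> R, [/\ y 0 = a, y' 0 = b,
    forall x : R, is_derive x (1:R) y (y' x) &
    forall x : R, is_derive x (1:R) y' (Q x * y x + h x)].
Proof.
move=> cQ ch.
pose is_prim (f F : R -> R) := continuous f ->
  F 0 = 0 /\ forall x : R, is_derive x (1:R) F (f x).
have [|I IP] := @choice _ _ is_prim.
  move=> f; have [cf|ncf] := pselect (continuous f); last by exists f.
  by have [F F0 FP] := antiderivative cf; exists F.
pose p0 x := b + I h x.
pose y0 x := a + I p0 x.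
pose Y n := iter n (fun y => I (I (fun x => Q x * y x))) y0.
pose P n := if n is n'.+1 then I (fun x => Q x * Y n' x) else p0.
have dp0 (x : R) : is_derive x (1:R) p0 (h x).
  rewrite -[h x]add0r; apply: is_deriveD; exact: (IP h ch).2.
have cp0 : continuous p0 by exact: is_derive_continuous dp0.
have dy0 (x : R) : is_derive x (1:R) y0 (p0 x).
  rewrite -[p0 x]add0r; apply: is_deriveD; exact: (IP p0 cp0).2.
have cQM f : continuous f -> continuous (fun x => Q x * f x).
  by move=> cf x; apply: cvgM; [exact: cQ|exact: cf].
have cY n : continuous (Y n).
  elim: n => [|n IH]; first exact: is_derive_continuous dy0.
  apply: is_derive_continuous (IP _ _).2.
  exact: is_derive_continuous (IP _ (cQM _ IH)).2.
have cP n : continuous (P n).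
  case: n => [//|n]; exact: is_derive_continuous (IP _ (cQM _ (cY n))).2.
have dY n (x : R) : is_derive x (1:R) (Y n) (P n x).
  by case: n => [//|n]; exact: (IP _ (cP n.+1)).2.
have dP n (x : R) : is_derive x (1:R) (P n)
    (if n is n'.+1 then Q x * Y n' x else h x).
  by case: n => [//|n]; exact: (IP _ (cQM _ (cY n))).2.
have Y0 n : Y n 0 = if n is 0%N then a else 0.
  by case: n => [|n]; [rewrite /Y/= /y0 (IP _ cp0).1 addr0|exact: (IP _ (cP n.+1)).1].
have P0 n : P n 0 = if n is 0%N then b else 0.
  by case: n => [|n]; [rewrite /P /p0 (IP _ ch).1 addr0|exact: (IP _ (cQM _ (cY n))).1].
have bnd (X : R) : exists C : R, forall n (x : R), `|x| <= X ->
    [/\ `|Y n x| <= geometric C 2^-1 n, `|P n x| <= geometric C 2^-1 n &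
    `|if n is n'.+1 then Q x * Y n' x else h x| <= geometric C 2^-1 n].
  have [q q0 Hq] := bounded_on_segment (- X) X cQ.
  have [A A0 HA] := bounded_on_segment (- X) X (cY 0%N).
  have [B B0 HB] := bounded_on_segment (- X) X cp0.
  have [D D0 HD] := bounded_on_segment (- X) X ch.
  pose l := 2 * q + 1.
  have l1 : 1 <= l by rewrite /l; lra.
  have l0 : 0 < l by exact: lt_le_trans l1.
  have lq : q / l <= l / 2.
    rewrite ler_pdivrMr// /l; nra.
  have PY n (x : R) : `|x| <= X -> `|Y n x| <= A * 2^-1 ^+ n * expR (l * `|x|) /\
      `|P n.+1 x| <= l * A * 2^-1 ^+ n.+1 * expR (l * `|x|).
    elim: n x => [|n IH] x xX.
      have Y1 t : `|t| <= X -> `|Y 0 t| <= A * 2^-1 ^+ 0 * expR (l * `|t|).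
        move=> tX; rewrite expr0 mulr1 (le_trans (HA t _))//.
          by rewrite -ler_norml.
        rewrite ler_peMr// -expR0 ler_expR mulr_ge0// ltW//.
      split; first exact: Y1.
      apply: le_trans (primitive_exp_bound (K := q * A) l0 _ (P0 1%N) (dP 1%N) _ xX) _.
      - by rewrite mulr_ge0.
      - move=> t tX; rewrite normrM -mulrA ler_pM//.
          by apply: Hq; rewrite -ler_norml.
        by have := Y1 t tX; rewrite expr0 mulr1.
      rewrite ler_wpM2r ?expR_ge0// expr1; nra.
    have Y1 t : `|t| <= X ->
        `|Y n.+1 t| <= A * 2^-1 ^+ n.+1 * expR (l * `|t|).
      move=> tX.
      apply: le_trans (primitive_exp_bound (K := l * A * 2^-1 ^+ n.+1) l0 _
        (Y0 n.+1) (dY n.+1) _ tX) _.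
      - by rewrite mulr_ge0// ?mulr_ge0// ?ltW// exprn_ge0// invr_ge0.
      - by move=> s sX; exact: (IH s sX).2.
      rewrite ler_wpM2r ?expR_ge0//.
      have -> : l * A * 2^-1 ^+ n.+1 / l = A * 2^-1 ^+ n.+1; last by [].
      by field; rewrite gt_eqF.
    split; first exact: Y1.
    apply: le_trans (primitive_exp_bound (K := q * (A * 2^-1 ^+ n.+1)) l0 _
      (P0 n.+2) (dP n.+2) _ xX) _.
    - by rewrite mulr_ge0// mulr_ge0// exprn_ge0// invr_ge0.
    - move=> t tX; rewrite normrM -mulrA ler_pM//.
        by apply: Hq; rewrite -ler_norml.
      exact: Y1.
    rewrite ler_wpM2r ?expR_ge0// [_ ^+ n.+2]exprS.
    have g0 : 0 <= A * 2^-1 ^+ n.+1 by rewrite mulr_ge0// exprn_ge0// invr_ge0.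
    have -> : l * A * (2^-1 * 2^-1 ^+ n.+1) = l / 2 * (A * 2^-1 ^+ n.+1) by ring.
    by rewrite mulrAC ler_wpM2r.
  pose E := expR (l * X).
  have E0 : 0 <= E by exact: expR_ge0.
  exists (A * E + l * A * E + B + D + 2 * (q * (A * E))) => n x xX.
  have [H1 _] := PY n x xX.
  have eE : expR (l * `|x|) <= E by rewrite ler_expR ler_wpM2l// ltW.
  have h0 k : 0 <= 2^-1 ^+ k :> R by rewrite exprn_ge0// invr_ge0.
  have AE : 0 <= A * E by rewrite mulr_ge0.
  have lAE : 0 <= l * A * E by rewrite -mulrA mulr_ge0// ltW.
  have qAE : 0 <= q * (A * E) by rewrite mulr_ge0.
  have HY m : `|Y m x| <= A * E * 2^-1 ^+ m.
    apply: le_trans (PY m x xX).1 _.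
    by rewrite mulrAC ler_wpM2r// ler_wpM2l.
  have xX' : - X <= x <= X by rewrite -ler_norml.
  split; rewrite /geometric/=.
  - apply: le_trans (HY n) _; rewrite ler_wpM2r//; lra.
  - case: n {H1} => [|n].
      rewrite expr0 mulr1; apply: le_trans (HB x xX') _; lra.
    apply: le_trans (PY n x xX).2 _.
    apply: (@le_trans _ _ (l * A * E * 2^-1 ^+ n.+1)).
      by rewrite mulrAC ler_wpM2r// ler_wpM2l// mulr_ge0// ltW.
    rewrite ler_wpM2r//; lra.
  - case: n {H1} => [|n].
      rewrite expr0 mulr1; apply: le_trans (HD x xX') _; lra.
    rewrite normrM; apply: (@le_trans _ _ (q * (A * E * 2^-1 ^+ n))).
      by rewrite ler_pM// Hq.
    have -> : q * (A * E * 2^-1 ^+ n) = 2 * (q * (A * E)) * 2^-1 ^+ n.+1.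
      by rewrite exprS; field.
    by rewrite ler_wpM2r//; lra.
have HM (X : R) : exists2 M : nat -> R, cvgn (series M) & forall n (x : R), `|x| <= X ->
    `|Y n x| <= M n /\ `|P n x| <= M n.
  have [C HC] := bnd X; exists (geometric C 2^-1).
    exact: cvg_geometric_half.
  by move=> n x /(HC n)[].
have HM2 (X : R) : exists2 M : nat -> R, cvgn (series M) & forall n (x : R), `|x| <= X ->
    `|P n x| <= M n /\ `|if n is n'.+1 then Q x * Y n' x else h x| <= M n.
  have [C HC] := bnd X; exists (geometric C 2^-1).
    exact: cvg_geometric_half.
  by move=> n x /(HC n)[].
exists (fun x => limn (series (Y^~ x))), (fun x => limn (series (P^~ x))).
have at0 (u : nat -> R) c : u 0%N = c -> (forall n, u n.+1 = 0) ->
    limn (series u) = c.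
  move=> u0 uS; rewrite (limn_series_affine (q := 0) (u := fun=> 0) u0)//.
  - by rewrite mul0r addr0.
  - by move=> n; rewrite uS mul0r.
  - have -> : series (fun=> 0 : R) = cst 0.
      by apply/funext => n; rewrite /series/= big1.
    exact: is_cvg_cst.
split.
- by apply: at0 => [|n]; rewrite Y0.
- by apply: at0 => [|n]; rewrite P0.
- exact: is_derive_series_real.
- move=> x.
  have /is_derive_eq := is_derive_series_real dP HM2 x; apply.
  rewrite addrC; apply: limn_series_affine => //.
  have [M cM HM'] := HM `|x|.
  apply: (@cvg_dominated_series _ _ summable_complete_real _ M) => //.
  by move=> n; exact: (HM' n x _).1.
Qed.

Lemma is_derive_translate f (d c x : R) :
  is_derive (x + c) (1:R) f d -> is_derive x (1:R) (fun t => f (t + c)) d.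
Proof.
move=> df.
have /is_derive_eq : is_derive x (1:R) (f \o (fun t => t + c)) (d * (1 + 0)).
  by apply: is_derive1_comp; exact: is_deriveD.
by apply; rewrite addr0 mulr1.
Qed.

Lemma linear_ivp Q h (r a b : R) : continuous Q -> continuous h ->
  exists y y' : R -> R, [/\ y r = a, y' r = b,
    forall x : R, is_derive x (1:R) y (y' x) &
    forall x : R, is_derive x (1:R) y' (Q x * y x + h x)].
Proof.
move=> cQ ch.
have ct f : continuous f -> continuous (fun x => f (x + r)).
  move=> cf x; apply: continuous_comp; last exact: cf.
  by apply: cvgD => //; exact: cvg_cst.
have [y [y' [y0 y'0 dy dy']]] := linear_ivp0 a b (ct _ cQ) (ct _ ch).
exists (fun x => y (x - r)), (fun x => y' (x - r)); split.
- by rewrite subrr.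
- by rewrite subrr.
- by move=> x; apply: is_derive_translate; exact: dy.
- by move=> x; apply: is_derive_translate; have := dy' (x - r); rewrite subrK.
Qed.

End linear_ode.

(** * Bounded solutions of the radial equations *)

Section ode_bounds.
Context {R : realType}.
Implicit Types (Q V g y dy : R -> R).

Lemma real_induction (P : R -> Prop) (a : R) : P a ->
  (forall c : R, a <= c -> (forall s : R, a <= s <= c -> P s) ->
     exists2 d : R, 0 < d & forall s : R, c <= s <= c + d -> P s) ->
  (forall c : R, a < c -> (forall s : R, a <= s < c -> P s) -> P c) ->
  forall r : R, a <= r -> P r.
Proof.
move=> Pa Pstep Plim r ar; apply: contrapT => nPr.
pose S := [set s | a <= s /\ ~ P s].
have Sinf : has_inf S by split; [exists r|exists a => s []].
have ac : a <= inf S by apply: lb_le_inf; [exists r|move=> s []].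
have below s : a <= s < inf S -> P s.
  move=> /andP[as_ si]; apply: contrapT => nPs.
  by move: si; rewrite ltNge => /negP; apply; apply: ge_inf => //; exists a => ? [].
have Pc : P (inf S).
  by move: ac; rewrite le_eqVlt => /predU1P[<-//|ac]; exact: Plim.
have [|d d0 Pd] := Pstep _ ac.
  move=> s /andP[as_]; rewrite le_eqVlt => /predU1P[->//|si].
  by apply: below; rewrite as_.
have [s [as_ nPs] sd] := inf_adherent d0 Sinf.
apply: nPs; have [si|si] := ltP s (inf S); first by apply: below; rewrite as_.
by apply: Pd; rewrite si ltW.
Qed.

Lemma continuous_gt_near y (c M : R) : continuous y -> M < y c ->
  exists2 d : R, 0 < d & forall s : R, `|c - s| <= d -> M < y s.
Proof.
move=> cy Mc.
have /cvgrPdist_lt/(_ (y c - M))[] := cy c; first by rewrite subr_gt0.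
move=> e /= e0 He; exists (e / 2); first by rewrite divr_gt0.
move=> s cs; have := He s; rewrite /ball_/= => /(_ _)/ltr_normlP[].
  by rewrite (le_lt_trans cs)// ltr_pdivrMr// mulr_natr mulr2n ltrDl.
lra.
Qed.

(** Above the level [M] the solution is convex, so once it rises there it rises
    forever, at least linearly. *)
Lemma convex_escape y dy (ddy : R -> R) (r1 M : R) :
  (forall x : R, is_derive x (1:R) y (dy x)) ->
  (forall x : R, is_derive x (1:R) dy (ddy x)) ->
  (forall r : R, r1 <= r -> M <= y r -> 0 <= ddy r) ->
  M <= y r1 -> 0 < dy r1 ->
  forall r : R, r1 <= r -> dy r1 <= dy r.
Proof.
move=> ydy dyddy conv M1 d1.
have cdy : continuous dy by exact: is_derive_continuous dyddy.
have key c : r1 <= c -> (forall s : R, r1 <= s < c -> 0 < dy s) -> dy r1 <= dy c.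
  move=> r1c pos; apply: (derive_ge0_le dyddy) => // s /andP[r1s sc].
  apply: conv => //; apply: (le_trans M1).
  move: r1s; rewrite le_eqVlt => /predU1P[->//|r1s].
  have [x|x] := @MVT R y dy r1 s r1s (fun x _ => ydy x).
    exact/continuous_subspaceT/(is_derive_continuous ydy).
  rewrite in_itv/= => /andP[rx xs] E; rewrite -subr_ge0 E mulr_ge0//.
    by apply/ltW/pos; rewrite ltW//= (lt_le_trans xs).
  by rewrite subr_ge0 ltW.
have dpos r : r1 <= r -> 0 < dy r.
  move: r; apply: (real_induction (P := fun r => 0 < dy r)) => //.
    move=> c r1c /(_ c); rewrite lexx r1c => /(_ isT) dc.
    have [d d0 Hd] := continuous_gt_near cdy dc.
    exists d => // s /andP[cs sd]; apply: Hd.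
    by rewrite distrC ger0_norm ?subr_ge0// lerBlDl.
  by move=> c r1c H; apply: (lt_le_trans d1); apply: key => //; exact: ltW.
by move=> r r1r; apply: key => // s /andP[r1s _]; exact: dpos.
Qed.

(** The mean value theorem on the interval from the last point below the level
    to [r1]. *)
Lemma crossing_up y dy (r0 r1 M : R) :
  (forall x : R, is_derive x (1:R) y (dy x)) ->
  r0 <= r1 -> y r0 <= M -> M < y r1 ->
  exists r, [/\ r0 <= r, M < y r & 0 < dy r].
Proof.
move=> ydy r01 y0 y1.
have cy : continuous y by exact: is_derive_continuous ydy.
pose S := [set s | r0 <= s <= r1 /\ y s <= M].
have Ssup : has_sup S.
  by split; [exists r0; rewrite /S/= lexx|exists r1 => s [/andP[]]].
have S0 : S r0 by rewrite /S/= lexx.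
have r0c : r0 <= sup S by exact: sup_upper_bound.
have cr1 : sup S <= r1 by apply: ge_sup; [exists r0|move=> s [/andP[]]].
have yc : y (sup S) <= M.
  rewrite leNgt; apply/negP => yc.
  have [d d0 Hd] := continuous_gt_near cy yc.
  have [s Ss sd] := sup_adherent d0 Ssup.
  have sS : s <= sup S by exact: sup_upper_bound.
  case: Ss => _; rewrite leNgt => /negP; apply; apply: Hd.
  by rewrite ger0_norm ?subr_ge0//; lra.
have cr : sup S < r1.
  rewrite lt_neqAle cr1 andbT; apply/eqP => E.
  by move: y1; rewrite -E ltNge yc.
have [x|x] := @MVT R y dy _ _ cr (fun x _ => ydy x).
  exact/continuous_subspaceT.
rewrite in_itv/= => /andP[cx xr] E.
exists x; split; first by rewrite (le_trans r0c)// ltW.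
  rewrite ltNge; apply/negP => yx.
  suff : x <= sup S by rewrite leNgt cx.
  apply: sup_upper_bound => //; split => //.
  by rewrite (ltW xr) andbT (le_trans r0c)// ltW.
have : 0 < dy x * (r1 - sup S) by rewrite -E subr_gt0 (le_lt_trans yc).
by rewrite pmulr_lgt0// subr_gt0.
Qed.

(** For each wave number above the threshold the energy [dy^2 + mu^2 y^2] of
    the reduced radial equation changes by an integrable relative rate, so all
    solutions stay bounded, uniformly in [mu >= mu1]; [atan] is the primitive
    of the rate. *)
Lemma oscillatory_bound (mu1 CV : R) : 0 < mu1 -> 0 <= CV ->
  exists2 K : R, 0 <= K & forall (mu p B : R) V g y dy,
  mu1 <= mu -> 0 <= B ->
  (forall r : R, 0 <= r -> `|V r| <= CV / (1 + r ^+ 2)) ->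
  (forall r : R, 0 <= r -> `|g r| <= B / (1 + r ^+ 2)) ->
  y 0 = 0 -> dy 0 = p ->
  (forall x : R, is_derive x (1:R) y (dy x)) ->
  (forall x : R, is_derive x (1:R) dy (- (mu ^+ 2 + V x) * y x + - g x)) ->
  forall r : R, 0 <= r -> mu * `|y r| <= K * (B + `|p|) /\ `|dy r| <= K * (B + `|p|).
Proof.
move=> mu10 CV0; pose ka := CV / mu1 + 1.
have ka0 : 0 <= ka by rewrite addr_ge0// divr_ge0// ltW.
exists (2 * expR (ka * (pi / 2))); first by rewrite mulr_ge0// expR_ge0.
move=> mu p B V g y dy mu1mu B0 VC gB y0 dy0 ydy dyddy r r0.
have mu0 : 0 < mu by exact: lt_le_trans mu1mu.
pose D := B + `|p|.
have D0 : 0 <= D by rewrite addr_ge0.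
pose E x := dy x ^+ 2 + mu ^+ 2 * y x ^+ 2 + D ^+ 2.
pose G x := - (E x * expR (- ka * atan x)).
pose dE x := - (2 * dy x * (V x * y x + g x)).
have dG (x : R) : is_derive x (1:R) G
    ((ka * (1 + x ^+ 2)^-1 * E x - dE x) * expR (- ka * atan x)).
  rewrite /G /E /dE; have H1 := dyddy x; have H2 := ydy x.
  apply: is_derive_eq; rewrite -![_ *: _]/(_ * _) ?mulr2n; ring.
have E0 (x : R) : 0 <= E x.
  by rewrite /E !addr_ge0 ?sqr_ge0// mulr_ge0 ?sqr_ge0.
have Hr : G 0 <= G r.
  apply: (derive_ge0_le dG) => // x /andP[x0 _].
  rewrite mulr_ge0 ?expR_ge0// subr_ge0.
  have w0 : 0 < 1 + x ^+ 2 by rewrite ltr_wpDr// sqr_ge0.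
  have iw0 : 0 <= (1 + x ^+ 2)^-1 by rewrite invr_ge0 ltW.
  have := VC x x0; have := gB x x0; rewrite /dE.
  set i := _^-1 in iw0 * => gBx VCx.
  have a1 : `|2 * dy x * (V x * y x)| <= i * (CV / mu1 * E x).
    have -> : 2 * dy x * (V x * y x) = V x * (2 * (dy x * y x)) by ring.
    rewrite normrM; apply: (@le_trans _ _ (CV * i * `|2 * (dy x * y x)|)).
      by rewrite ler_wpM2r.
    rewrite [CV * i]mulrC -!mulrA ler_wpM2l// ler_wpM2l// ler_pdivlMl//.
    apply: (@le_trans _ _ (mu * `|2 * (dy x * y x)|)); first by rewrite ler_wpM2r.
    rewrite normrM (normr_nat _ 2) normrM /E.
    rewrite -(real_normK (num_real (dy x))) -(real_normK (num_real (y x))).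
    have := sqr_ge0 (`|dy x| - mu * `|y x|); have := sqr_ge0 D; nra.
  have a2 : `|2 * dy x * g x| <= i * E x.
    rewrite normrM; apply: (@le_trans _ _ (`|2 * dy x| * (B * i))).
      by rewrite ler_wpM2l.
    rewrite [B * i]mulrC mulrCA ler_wpM2l// normrM (normr_nat _ 2) /E.
    rewrite -(real_normK (num_real (dy x))).
    have h1 : 0 <= mu ^+ 2 * y x ^+ 2 by rewrite mulr_ge0// sqr_ge0.
    have h2 : B ^+ 2 <= D ^+ 2 by rewrite ler_sqr ?nnegrE// /D lerDl.
    have := sqr_ge0 (`|dy x| - B); nra.
  have -> : ka * i * E x = i * (CV / mu1 * E x) + i * E x by rewrite /ka; ring.
  rewrite (le_trans (ler_norm _))// normrN mulrDr.
  by apply: (le_trans (ler_normD _ _)); exact: lerD.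
have Er : E r <= 2 * expR (ka * (pi / 2)) * D ^+ 2.
  move: Hr; rewrite /G lerN2 atan0 mulr0 expR0 mulr1 => Hr.
  have EE : E r <= E 0 * expR (ka * atan r).
    by rewrite -ler_pdivrMr ?expR_gt0// -expRN -mulNr.
  apply: (le_trans EE); rewrite /E dy0 y0 expr0n/= mulr0 addr0.
  rewrite mulrAC ler_pM ?expR_ge0// ?addr_ge0 ?sqr_ge0//.
    have : p ^+ 2 <= D ^+ 2.
      by rewrite -(real_normK (num_real p)) ler_sqr ?nnegrE// /D lerDr.
    lra.
  by rewrite ler_expR ler_wpM2l// ltW// atan_ltpi2.
have K1 : 1 <= 2 * expR (ka * (pi / 2)).
  have : 1 <= expR (ka * (pi / 2)).
    by rewrite -expR0 ler_expR mulr_ge0// divr_ge0// pi_ge0.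
  lra.
set K := 2 * _ in Er K1 *.
have Er2 : E r <= (K * D) ^+ 2.
  apply: (le_trans Er); rewrite exprMn ler_wpM2r ?sqr_ge0//.
  by rewrite expr2 ler_peMr// (le_trans _ K1).
have KD : 0 <= K * D by rewrite mulr_ge0// (le_trans _ K1).
have h1 : 0 <= mu ^+ 2 * y r ^+ 2 by rewrite mulr_ge0// sqr_ge0.
have h2 := sqr_ge0 D; have h3 := sqr_ge0 (dy r).
rewrite -/D; move: Er2; rewrite /E => Er2; split.
  rewrite -ler_sqr ?nnegrE// ?mulr_ge0// ?(ltW mu0)//.
  rewrite (exprMn 2 mu) real_normK ?num_real//; lra.
rewrite -ler_sqr ?nnegrE//.
rewrite real_normK ?num_real//; lra.
Qed.

(** Shooting: the initial slopes whose solutions escape upwards and those whose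
    solutions escape downwards form two disjoint open half-lines, so some slope
    in between gives a bounded solution. *)
Lemma shooting Q g (r0 q B a : R) : continuous Q -> continuous g ->
  0 < q -> 0 <= B ->
  (forall r : R, r0 <= r -> q <= Q r) -> (forall r : R, r0 <= r -> `|g r| <= B) ->
  exists y dy, [/\ y r0 = a,
    forall x : R, is_derive x (1:R) y (dy x),
    forall x : R, is_derive x (1:R) dy (Q x * y x + - g x) &
    forall r : R, r0 <= r -> `|y r| <= `|a| + B / q].
Proof.
move=> cQ cg q0 B0 qQ gB; set M : R := `|a| + B / q.
have Bq0 : 0 <= B / q by rewrite divr_ge0// ltW.
have M0 : 0 <= M by rewrite addr_ge0.
have qM : B <= q * M by rewrite /M mulrDr mulrCA mulfV ?gt_eqF// mulr1 lerDr mulr_ge0// ltW.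
have cNg : continuous (fun x => - g x) by move=> x; apply: cvgN; exact: cg.
have c0 : continuous (fun _ : R => (0 : R)) by exact: cst_continuous.
have [z [dz [za dz0 zdz dzddz]]] := linear_ivp r0 a 0 cQ cNg.
have [h [dh [h0 dh0 hdh dhddh]]] := linear_ivp r0 0 1 cQ c0.
have dh1 r : r0 <= r -> 1 <= dh r.
  rewrite -dh0; apply: (convex_escape (M := 0) hdh dhddh); rewrite ?h0 ?dh0//.
  move=> s r0s hs; rewrite addr0 mulr_ge0//.
  by rewrite (le_trans (ltW q0))// qQ.
have hge r : r0 <= r -> r - r0 <= h r.
  move=> r0r; have : h r0 - r0 <= h r - r.
    apply: (derive_ge0_le (f := fun x => h x - x) (df := fun x => dh x - 1)) => //.
    by move=> x /andP[r0x _]; rewrite subr_ge0 dh1.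
  by rewrite h0; lra.
have hge0 r : r0 <= r -> 0 <= h r.
  by move=> r0r; apply: le_trans (hge r r0r); rewrite subr_ge0.
pose y p x := z x + p * h x.
pose dy p x := dz x + p * dh x.
have ydy p (x : R) : is_derive x (1:R) (y p) (dy p x).
  by rewrite /y /dy; apply: is_derive_eq; rewrite -![_ *: _]/(_ * _); ring.
have dyddy p (x : R) : is_derive x (1:R) (dy p) (Q x * y p x + - g x).
  rewrite /y /dy; have := dzddz x; have := dhddh x => H1 H2.
  by apply: is_derive_eq; rewrite -![_ *: _]/(_ * _); ring.
have ya p : y p r0 = a by rewrite /y za h0 mulr0 addr0.
have Nydy p (x : R) : is_derive x (1:R) (fun t => - y p t) (- dy p x).
  by apply: is_deriveN; exact: ydy.
have Ndyddy p (x : R) : is_derive x (1:R) (fun t => - dy p t) (- (Q x * y p x + - g x)).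
  by apply: is_deriveN; exact: dyddy.
have convup p r : r0 <= r -> M <= y p r -> 0 <= Q r * y p r + - g r.
  move=> r0r Myr; have := gB r r0r; have := qQ r r0r.
  move=> qQr /ler_normlP[_ gBr].
  have : q * M <= Q r * y p r by rewrite ler_pM// ltW.
  lra.
have convdn p r : r0 <= r -> M <= - y p r -> 0 <= - (Q r * y p r + - g r).
  move=> r0r Myr; have := gB r r0r; have := qQ r r0r.
  move=> qQr /ler_normlP[gBr _].
  have : q * M <= Q r * - y p r by rewrite ler_pM// ltW.
  lra.
pose up p := exists r, [/\ r0 <= r, M < y p r & 0 < dy p r].
pose dn p := exists r, [/\ r0 <= r, M < - y p r & 0 < - dy p r].
have mono (f df : R -> R) (r : R) : (forall x : R, is_derive x (1:R) f (df x)) ->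
    0 < df r -> (forall s : R, r <= s -> df r <= df s) -> forall s : R, r <= s -> f r <= f s.
  move=> fdf pos H s rs; apply: (derive_ge0_le fdf) => // x /andP[rx _].
  by rewrite (le_trans (ltW pos))// H.
have upinf p : up p -> exists r1, forall r : R, r1 <= r -> M < y p r.
  move=> [r [r0r My dpos]]; exists r => s rs; apply: (lt_le_trans My).
  apply: (mono _ _ _ (ydy p)) => // t; apply: (convex_escape (M := M) (ydy p) (dyddy p)) => //.
    by move=> u ru; apply: convup; exact: le_trans ru.
  exact: ltW.
have dninf p : dn p -> exists r1, forall r : R, r1 <= r -> M < - y p r.
  move=> [r [r0r My dpos]]; exists r => s rs; apply: (lt_le_trans My).
  apply: (mono _ _ _ (Nydy p)) => // t.
  apply: (convex_escape (M := M) (Nydy p) (Ndyddy p)) => //.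
    by move=> u ru; apply: convdn; exact: le_trans ru.
  exact: ltW.
have updn p p' : up p -> dn p' -> p' < p.
  move=> /upinf[r1 H1] /dninf[r2 H2]; rewrite ltNge; apply/negP => pp'.
  pose r := Num.max (Num.max r1 r2) r0.
  have h1 := H1 r; have h2 := H2 r.
  have r0r : r0 <= r by rewrite /r le_max lexx orbT.
  have : y p r <= y p' r by rewrite /y lerD2l ler_wpM2r// hge0.
  have := h1 _; have := h2 _; rewrite !le_max !lexx !orbT => /(_ isT) ? /(_ isT).
  lra.
pose r1 := r0 + 1.
have r01 : r0 <= r1 by rewrite /r1 lerDl.
have h1 : 1 <= h r1 by rewrite (le_trans _ (hge _ r01))// /r1 addrAC subrr add0r.
have dh11 := dh1 _ r01.
have big (A B' v : R) : 0 <= B' -> 1 <= v -> M < A + (`|A| + B' + M + 1) * v.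
  move=> B'0 v1; have A1 := ler_norm (- A); rewrite normrN in A1.
  have P0 : 0 <= `|A| + B' + M + 1 by rewrite !addr_ge0.
  by have := ler_peMr P0 v1; lra.
have ez1 : exists p, up p.
  exists (`|z r1| + `|dz r1| + M + 1), r1; rewrite /y /dy; split => //.
    exact: big.
  by rewrite [`|z r1| + _]addrC (le_lt_trans M0)// big.
have ez2 : exists p, dn p.
  exists (- (`|z r1| + `|dz r1| + M + 1)), r1; rewrite /y /dy; split => //.
    by rewrite mulNr opprB addrC -(normrN (z r1)) big.
  rewrite mulNr opprB addrC -(normrN (dz r1)) [`|z r1| + _]addrC.
  by rewrite (le_lt_trans M0)// big.
have small (u v A : R) : A < u -> exists2 e : R, 0 < e & e * v + A < u /\ A < u.
  move=> Au; exists ((u - A) / (2 * (`|v| + 1))).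
    by rewrite divr_gt0 ?subr_gt0// mulr_gt0// ltr_wpDl.
  split => //; have v1 : 0 < `|v| + 1 by rewrite ltr_wpDl.
  have : (u - A) / (2 * (`|v| + 1)) * v <= (u - A) / 2.
    rewrite invfM mulrA -mulrA ler_piMr//; first by rewrite divr_ge0// subr_ge0 ltW.
    by rewrite ler_pdivrMl// mulr1 (le_trans (ler_norm _))// lerDl.
  lra.
have upopen p : up p -> exists2 e : R, 0 < e & up (p - e).
  move=> [r [r0r My dpos]].
  have [e1 e10 [H1 _]] := small _ (h r) _ My.
  have [e2 e20 [H2 _]] := small _ (dh r) _ dpos.
  have hr := hge0 _ r0r; have dhr := dh1 _ r0r.
  exists (Num.min e1 e2); first by rewrite lt_min e10.
  exists r; split => //.
    have : Num.min e1 e2 * h r <= e1 * h r by rewrite ler_wpM2r// ge_min lexx.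
    by move: H1; rewrite /y mulrBl; lra.
  have : Num.min e1 e2 * dh r <= e2 * dh r.
    by rewrite ler_wpM2r ?ge_min ?lexx ?orbT// (le_trans _ dhr).
  by move: H2; rewrite /dy mulrBl; lra.
have dnopen p : dn p -> exists2 e : R, 0 < e & dn (p + e).
  move=> [r [r0r My dpos]].
  have [e1 e10 [H1 _]] := small _ (h r) _ My.
  have [e2 e20 [H2 _]] := small _ (dh r) _ dpos.
  have hr := hge0 _ r0r; have dhr := dh1 _ r0r.
  exists (Num.min e1 e2); first by rewrite lt_min e10.
  exists r; split => //.
    have : Num.min e1 e2 * h r <= e1 * h r by rewrite ler_wpM2r// ge_min lexx.
    by move: H1; rewrite /y mulrDl; lra.
  have : Num.min e1 e2 * dh r <= e2 * dh r.
    by rewrite ler_wpM2r ?ge_min ?lexx ?orbT// (le_trans _ dhr).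
  by move: H2; rewrite /dy mulrDl; lra.
pose S := [set p | up p].
have [pd dnpd] := ez2.
have Sinf : has_inf S.
  by split; [exact: ez1|exists pd => p upp; exact/ltW/updn].
have nup : ~ up (inf S).
  move=> /upopen[e e0 ue].
  have : inf S <= inf S - e by apply: ge_inf => //; exact: Sinf.2.
  lra.
have ndn : ~ dn (inf S).
  move=> /dnopen[e e0 de]; have [p upp pe] := inf_adherent e0 Sinf.
  by have := updn _ _ upp de; lra.
have aM : `|a| <= M by rewrite /M lerDl.
exists (y (inf S)), (dy (inf S)); split => // r r0r.
rewrite ler_norml; apply/andP; split; rewrite leNgt; apply/negP => yM.
  apply: ndn; apply: (crossing_up (Nydy _) r0r).
    by rewrite ya (le_trans (ler_norm _))// normrN.
  lra.
apply: nup; apply: (crossing_up (ydy _) r0r) => //.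
by rewrite ya (le_trans (ler_norm _)).
Qed.

(** On [r0, oo[ this is [shooting], which bounds [y] and hence, by the equation,
    [dy]; the compact interval [0, r0] is crossed backwards with a Gronwall
    estimate for [y^2 + dy^2 + D^2]. *)
Lemma bounded_solution Q (r0 q qq : R) : continuous Q ->
  0 <= r0 -> 0 < q -> 0 <= qq ->
  (forall r : R, r0 <= r -> q <= Q r) -> (forall r : R, 0 <= r -> `|Q r| <= qq) ->
  exists2 K : R, 0 <= K & forall g (a B : R), continuous g -> 0 <= B ->
    (forall r : R, 0 <= r -> `|g r| <= B) ->
    exists y dy, [/\ y r0 = a,
      forall x : R, is_derive x (1:R) y (dy x),
      forall x : R, is_derive x (1:R) dy (Q x * y x + - g x) &
      forall r : R, 0 <= r -> `|y r| <= K * (`|a| + B) /\ `|dy r| <= K * (`|a| + B)].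
Proof.
move=> cQ r00 q0 qq0 qQ Qqq.
pose k := 1 + q^-1.
have k1 : 1 <= k by rewrite /k lerDl invr_ge0 ltW.
pose K1 := (2 + qq) * k + 1.
have kK1 : k <= K1 by rewrite /K1; nra.
pose ka := 2 + qq.
pose K2 := 3 * expR (ka * r0).
have K2_1 : 1 <= K2.
  have : 1 <= expR (ka * r0) by rewrite -expR0 ler_expR mulr_ge0// /ka addr_ge0.
  by rewrite /K2; lra.
have K1_1 : 1 <= K1 by exact: le_trans kK1.
exists (K2 * K1); first by rewrite mulr_ge0// (le_trans ler01).
move=> g a B cg B0 gB; set D : R := `|a| + B.
have D0 : 0 <= D by rewrite addr_ge0.
have [|y [dy [ya ydy dyddy yM]]] := shooting a cQ cg q0 B0 qQ (B := B).
  by move=> r r0r; apply: gB; exact: le_trans r0r.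
have {}yM r : r0 <= r -> `|y r| <= k * D.
  move=> /yM H; apply: (le_trans H); rewrite /k /D mulrDl mul1r mulrDr.
  have : 0 <= q^-1 * `|a| by rewrite mulr_ge0// invr_ge0 ltW.
  by rewrite [q^-1 * B]mulrC; lra.
have dyM r : r0 <= r -> `|dy r| <= K1 * D.
  move=> r0r; have r1 : r <= r + 1 by rewrite lerDl.
  have [c /andP[rc cr1] E] := mean_value ydy r1.
  have dc : `|dy c| <= 2 * (k * D).
    have -> : dy c = y (r + 1) - y r by rewrite E [r + 1]addrC addrK mulr1.
    rewrite (le_trans (ler_normB _ _))// mulr_natl mulr2n lerD// yM//.
    exact: le_trans r1.
  have : `|dy c - dy r| <= (qq * (k * D) + B) * (c - r).
    apply: (derive_bound dyddy) => // x /andP[rx xc].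
    have r0x := le_trans r0r rx; have x0 := le_trans r00 r0x.
    rewrite (le_trans (ler_normD _ _))// normrN lerD ?gB// normrM.
    by rewrite ler_pM// ?Qqq// yM.
  have kD : 0 <= k * D by rewrite mulr_ge0// (le_trans ler01).
  have : (qq * (k * D) + B) * (c - r) <= qq * (k * D) + B.
    by rewrite ler_piMr ?addr_ge0 ?mulr_ge0//; lra.
  have : `|dy r| <= `|dy c| + `|dy c - dy r|.
    by rewrite -[X in `|X| <= _](subKr (dy c)) ler_normB.
  have BD : B <= D by rewrite /D lerDr.
  have -> : K1 * D = 2 * (k * D) + qq * (k * D) + D by rewrite /K1; ring.
  lra.
exists y, dy; split => // r r0'.
have K1D : 0 <= K1 * D by rewrite mulr_ge0// (le_trans ler01).
have [r0r|rr0] := leP r0 r.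
  have h : K1 * D <= K2 * K1 * D by rewrite -mulrA ler_peMl.
  split; apply: le_trans h; last exact: dyM.
  by apply: (le_trans (yM _ r0r)); rewrite ler_wpM2r.
pose E x := y x ^+ 2 + dy x ^+ 2 + D ^+ 2.
pose dE x := 2 * y x * dy x + 2 * dy x * (Q x * y x + - g x).
pose G x := E x * expR (ka * x).
have dG (x : R) : is_derive x (1:R) G ((ka * E x + dE x) * expR (ka * x)).
  rewrite /G /E /dE; have H1 := dyddy x; have H2 := ydy x.
  by apply: is_derive_eq; rewrite -![_ *: _]/(_ * _) ?mulr2n; ring.
have BD2 : B ^+ 2 <= D ^+ 2 by rewrite ler_sqr ?nnegrE// /D lerDr.
have Hr : G r <= G r0.
  apply: (derive_ge0_le dG); first exact: ltW.
  move=> x /andP[rx xr0]; have x0 := le_trans r0' rx.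
  rewrite mulr_ge0 ?expR_ge0// -lerBlDr sub0r.
  rewrite (le_trans (ler_norm _))// normrN.
  have a1 : `|2 * y x * dy x| <= y x ^+ 2 + dy x ^+ 2.
    rewrite ler_norml; apply/andP; split.
      by have := sqr_ge0 (y x + dy x); rewrite sqrrD; lra.
    by have := sqr_ge0 (y x - dy x); rewrite sqrrB; lra.
  have a2 : `|2 * dy x * (Q x * y x)| <= qq * (y x ^+ 2 + dy x ^+ 2).
    have -> : 2 * dy x * (Q x * y x) = Q x * (2 * y x * dy x) by ring.
    by rewrite normrM ler_pM// Qqq.
  have a3 : `|2 * dy x * g x| <= dy x ^+ 2 + B ^+ 2.
    rewrite !normrM (normr_nat _ 2) -(real_normK (num_real (dy x))).
    have gx := gB x x0; have n0 := normr_ge0 (dy x).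
    have : `|dy x| * `|g x| <= `|dy x| * B by rewrite ler_wpM2l.
    by have := sqr_ge0 (`|dy x| - B); rewrite sqrrB; lra.
  have -> : dE x = 2 * y x * dy x + 2 * dy x * (Q x * y x) - 2 * dy x * g x.
    by rewrite /dE; ring.
  apply: (le_trans (ler_normB _ _)); apply: (le_trans (lerD (ler_normD _ _) (lexx _))).
  have : 0 <= qq * D ^+ 2 by rewrite mulr_ge0// sqr_ge0.
  have := sqr_ge0 (y x); have := sqr_ge0 (dy x); have := sqr_ge0 D.
  rewrite /ka /E; lra.
have Er : E r <= K2 * (K1 * D) ^+ 2.
  have e1 : E r <= G r.
    rewrite /G ler_peMr//; first by rewrite /E !addr_ge0 ?sqr_ge0.
    by rewrite -expR0 ler_expR mulr_ge0// /ka addr_ge0.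
  apply: (le_trans e1); apply: (le_trans Hr); rewrite /G /K2.
  rewrite mulrAC ler_wpM2r ?expR_ge0// /E.
  have t1 : y r0 ^+ 2 <= (K1 * D) ^+ 2.
    rewrite -(real_normK (num_real (y r0))) ler_sqr ?nnegrE//.
    by apply: (le_trans (yM _ (lexx _))); rewrite ler_wpM2r.
  have t2 : dy r0 ^+ 2 <= (K1 * D) ^+ 2.
    by rewrite -(real_normK (num_real (dy r0))) ler_sqr ?nnegrE// dyM.
  have t3 : D ^+ 2 <= (K1 * D) ^+ 2 by rewrite ler_sqr ?nnegrE// ler_peMl.
  lra.
have Er2 : E r <= (K2 * K1 * D) ^+ 2.
  apply: (le_trans Er); rewrite -mulrA [in leRHS]exprMn ler_wpM2r ?sqr_ge0//.
  by rewrite expr2 ler_peMr// (le_trans ler01).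
have KD : 0 <= K2 * K1 * D by rewrite -mulrA mulr_ge0// (le_trans ler01).
have h2 := sqr_ge0 D; have h3 := sqr_ge0 (dy r); have h1 := sqr_ge0 (y r).
by split; rewrite -ler_sqr ?nnegrE// real_normK ?num_real//;
  move: Er2; rewrite /E; lra.
Qed.

End ode_bounds.

(** * Twice differentiable functions and their series *)

Section twice_differentiable.
Context {R : realType}.

Lemma is_derive_line {V W : normedModType R} (f : V -> W) (x v : V) (t : R) (d : W) :
  is_derive (t *: v + x) v f d <->
  is_derive t (1:R) (fun h : R => f (h *: v + x)) d.
Proof.
have E : (fun h : R => h^-1 *: ((f \o shift (t *: v + x)) (h *: v) - f (t *: v + x))) =
  (fun h : R => h^-1 *: (((fun k : R => f (k *: v + x)) \o shift t) (h *: (1:R)) -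
    f (t *: v + x))).
  apply/funext => h /=; rewrite addrA -scalerDl -[h *: (1:R)]/(h * 1) mulr1//.
split=> -[dv dE]; apply: DeriveDef.
- by move: dv; rewrite /derivable E.
- by move: dE; rewrite /derive E.
- by move: dv; rewrite /derivable -E.
- by move: dE; rewrite /derive -E.
Qed.

Lemma is_derive_line0 {V W : normedModType R} (f : V -> W) (x v : V) (d : W) :
  is_derive x v f d <-> is_derive (0:R) (1:R) (fun h : R => f (h *: v + x)) d.
Proof. by have := is_derive_line f x v 0 d; rewrite scale0r add0r. Qed.

Lemma mean_value_line {V : normedModType R} (f : V -> R) (df : V -> R) (x v : V)
    (h K : R) :
  (forall y, is_derive y v f (df y)) ->
  (forall t : R, `|t| <= `|h| -> `|df (t *: v + x)| <= K) ->
  `|f (h *: v + x) - f x| <= `|h| * K.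
Proof.
move=> fdf dK.
have D (t : R) : is_derive t (1:R) (fun t => f (t *: v + x)) (df (t *: v + x)).
  exact: (is_derive_line f x v t _).1 (fdf _).
have E : f x = f (0 *: v + x) by rewrite scale0r add0r.
rewrite E mulrC; have [h0|h0] := leP 0 h.
  rewrite [`|h|]ger0_norm// -[X in K * X]subr0; apply: (derive_bound D) => //.
  by move=> t /andP[t0 th]; apply: dK; rewrite !ger0_norm//.
rewrite distrC [`|h|]ltr0_norm// -[X in K * X]add0r.
apply: (derive_bound D); first exact: ltW.
by move=> t /andP[ht t0]; apply: dK; rewrite !ler0_norm ?lerN2// ltW.
Qed.

(** The derivatives are carried as data, so that those of a series can be named as
    the series of the derivatives. *)
Definition is_C2 {V : normedModType R} (f : V -> R) (d1 : V -> V -> R)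
    (d2 : V -> V -> V -> R) :=
  [/\ forall x v, is_derive x v f (d1 v x),
      forall x v w, is_derive x w (d1 v) (d2 v w x),
      continuous f, (forall v, continuous (d1 v)) &
      forall v w, continuous (d2 v w)].

Lemma is_C2_Ck {V : normedModType R} (f : V -> R) d1 d2 :
  is_C2 f d1 d2 -> Ck setT 2 f.
Proof.
move=> [h1 h2 c0 c1 c2]; split => [x _|v]; first exact: c0.
have -> : 'D_v f = d1 v by apply/funext => x; have [_ ->] := h1 x v.
split => [x _|]; first by have [] := h1 x v.
split => [x _|w]; first exact: c1.
have -> : 'D_w (d1 v) = d2 v w by apply/funext => x; have [_ ->] := h2 x v w.
split => [x _|]; first by have [] := h2 x v w.
by split => // x _; exact: c2.
Qed.

Lemma is_C2_derive {V : normedModType R} (f : V -> R) d1 d2 v w x :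
  is_C2 f d1 d2 -> 'D_w ('D_v f) x = d2 v w x.
Proof.
move=> [h1 h2 _ _ _].
have -> : 'D_v f = d1 v by apply/funext => y; have [_ ->] := h1 y v.
by have [_ ->] := h2 x v w.
Qed.

Definition C2_bound {V : normedModType R} (f : V -> R) (d1 : V -> V -> R)
    (d2 : V -> V -> V -> R) (X B : R) :=
  forall x, `|x| <= X -> [/\ `|f x| <= B,
    forall v, `|d1 v x| <= B * `|v| &
    forall v w, `|d2 v w x| <= B * (`|v| * `|w|)].

Lemma is_C2D {V : normedModType R} (f g : V -> R) d1 d2 e1 e2 :
  is_C2 f d1 d2 -> is_C2 g e1 e2 ->
  is_C2 (fun x => f x + g x) (fun v x => d1 v x + e1 v x)
    (fun v w x => d2 v w x + e2 v w x).
Proof.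
move=> [h1 h2 c0 c1 c2] [k1 k2 b0 b1 b2]; split.
- by move=> x v; apply: is_deriveD.
- by move=> x v w; apply: is_deriveD.
- by move=> x; apply: cvgD; [exact: c0|exact: b0].
- by move=> v x; apply: cvgD; [exact: c1|exact: b1].
- by move=> v w x; apply: cvgD; [exact: c2|exact: b2].
Qed.

Lemma is_C2_0 {V : normedModType R} :
  is_C2 (fun _ : V => 0 : R) (fun _ _ => 0) (fun _ _ _ => 0).
Proof.
by split=> *; first [exact: is_derive_cst|exact: cst_continuous].
Qed.

Lemma is_C2Z {V : normedModType R} (c : R) (f : V -> R) d1 d2 :
  is_C2 f d1 d2 ->
  is_C2 (fun x => c * f x) (fun v x => c * d1 v x) (fun v w x => c * d2 v w x).
Proof.
move=> [h1 h2 c0 c1 c2]; split.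
- by move=> x v; apply: (@is_deriveZ _ _ R^o).
- by move=> x v w; apply: (@is_deriveZ _ _ R^o).
- by move=> x; apply: cvgM; [exact: cvg_cst|exact: c0].
- by move=> v x; apply: cvgM; [exact: cvg_cst|exact: c1].
- by move=> v w x; apply: cvgM; [exact: cvg_cst|exact: c2].
Qed.

Lemma is_C2_series {V : normedModType R} (f : nat -> V -> R) d1 d2 :
  (forall n, is_C2 (f n) (d1 n) (d2 n)) ->
  (forall X : R, exists2 M : nat -> R, cvgn (series M) &
     forall n, C2_bound (f n) (d1 n) (d2 n) X (M n)) ->
  is_C2 (fun x => limn (series (f^~ x)))
    (fun v x => limn (series (fun n => d1 n v x)))
    (fun v w x => limn (series (fun n => d2 n v w x))).
Proof.
move=> fC fM.
have cvM (M : nat -> R) c : cvgn (series M) -> cvgn (series (fun n => M n * c)).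
  move=> cM; have -> : series (fun n => M n * c) = (fun n => series M n * c).
    by apply/funext => n; rewrite /series/= mulr_suml.
  exact: is_cvgMl.
have near_ball (x : V) : \forall y \near x, `|y| <= `|x| + 1.
  near=> y; rewrite -[y](subrK x) addrC (le_trans (ler_normD _ _))// lerD2l distrC.
  near: y; apply/nbhs_ballP; exists 1 => //= z.
  by rewrite -ball_normE/= => /ltW.
have line (x v : V) (t h : R) : `|h| < 1 -> `|t| <= `|h| ->
    `|t *: v + x| <= `|x| + `|v|.
  move=> h1 th; rewrite (le_trans (ler_normD _ _))// addrC lerD2l normrZ.
  by rewrite ler_piMl// (le_trans th)// ltW.
split.
- move=> x v; have [M cM HM] := fM (`|x| + `|v|).
  apply: (@is_derive_series _ _ summable_complete_real V _ _ x v
    (fun n => M n * `|v|) 1); first exact: ltr01.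
  + by move=> n; have [h1 _ _ _ _] := fC n; exact: h1.
  + move=> n h h1; have [H1 _ _ _ _] := fC n.
    apply: (mean_value_line (df := d1 n v)) => // t th.
    by have [_ + _] := HM n _ (line x v t h h1 th); exact.
  + exact: cvM.
  + move=> h _; move: (h *: v + x) => y; have [N cN HN] := fM `|y|.
    apply: (@cvg_dominated_series _ _ summable_complete_real _ N) => // n.
    by have [] := HN n y (lexx _).
- move=> x v w; have [M cM HM] := fM (`|x| + `|w|).
  apply: (@is_derive_series _ _ summable_complete_real V _ _ x w
    (fun n => M n * (`|v| * `|w|)) 1); first exact: ltr01.
  + by move=> n; have [_ h1 _ _ _] := fC n; exact: h1.
  + move=> n h h1; have [_ H1 _ _ _] := fC n.
    apply: (mean_value_line (df := d2 n v w)) => // t th.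
    by have [_ _ +] := HM n _ (line x w t h h1 th); exact.
  + exact: cvM.
  + move=> h _; move: (h *: w + x) => y; have [N cN HN] := fM `|y|.
    apply: (@cvg_dominated_series _ _ summable_complete_real _ (fun n => N n * `|v|)).
      by move=> n; have [_ + _] := HN n y (lexx _); exact.
    exact: cvM.
- move=> x; have [M cM HM] := fM (`|x| + 1).
  apply: (@continuous_series _ _ summable_complete_real _ _ x M) => //.
    by move=> n; have [_ _ h _ _] := fC n; exact: h.
  by apply: filterS (near_ball x) => y yx n; have [] := HM n y yx.
- move=> v x; have [M cM HM] := fM (`|x| + 1).
  apply: (@continuous_series _ _ summable_complete_real _ _ x (fun n => M n * `|v|)).
  + by move=> n; have [_ _ _ h _] := fC n; exact: h.
  + by apply: filterS (near_ball x) => y yx n; have [_ + _] := HM n y yx; exact.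
  + exact: cvM.
- move=> v w x; have [M cM HM] := fM (`|x| + 1).
  apply: (@continuous_series _ _ summable_complete_real _ _ x
    (fun n => M n * (`|v| * `|w|))).
  + by move=> n; have [_ _ _ _ h] := fC n; exact: h.
  + by apply: filterS (near_ball x) => y yx n; have [_ _ +] := HM n y yx; exact.
  + exact: cvM.
Unshelve. all: by end_near. Qed.

End twice_differentiable.

(** * Radial functions *)

Section radial_functions.
Context {R : realType}.
Implicit Types (x v w : R3 R).

Definition dot x w : R := x.1.1 * w.1.1 + x.1.2 * w.1.2 + x.2 * w.2.

Lemma dotDl x v w : dot (x + v) w = dot x w + dot v w.
Proof. by rewrite /dot /=; ring. Qed.

Lemma dotZl (c : R) x w : dot (c *: x) w = c * dot x w.
Proof. by rewrite /dot /= -![_ *: _]/(_ * _); ring. Qed.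

Lemma dot0l w : dot 0 w = 0.
Proof. by rewrite /dot/= !mul0r !addr0. Qed.

Lemma dotC x w : dot x w = dot w x.
Proof. by rewrite /dot; ring. Qed.

Lemma enormE x : enorm x = Num.sqrt (dot x x).
Proof. by rewrite /enorm /dot !expr2. Qed.

Lemma enorm_ge0 x : 0 <= enorm x.
Proof. exact: sqrtr_ge0. Qed.

Lemma dot_ge0 x : 0 <= dot x x.
Proof. by rewrite /dot -!expr2 !addr_ge0 ?sqr_ge0. Qed.

Lemma enorm_sqr x : enorm x ^+ 2 = dot x x.
Proof. by rewrite enormE sqr_sqrtr// dot_ge0. Qed.

Lemma dot_le x w : `|dot x w| <= enorm x * enorm w.
Proof.
rewrite -ler_sqr ?nnegrE ?mulr_ge0 ?enorm_ge0// exprMn !enorm_sqr.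
rewrite real_normK ?num_real// /dot.
move: x w => [[a b] c] [[d e] f] /=; rewrite -subr_ge0.
have -> : (a * a + b * b + c * c) * (d * d + e * e + f * f) -
  (a * d + b * e + c * f) ^+ 2 =
  (a * e - b * d) ^+ 2 + (a * f - c * d) ^+ 2 + (b * f - c * e) ^+ 2 by ring.
by rewrite !addr_ge0 ?sqr_ge0.
Qed.

Lemma enorm_eq0 x : (enorm x == 0) = (x == 0).
Proof.
apply/eqP/eqP => [x0|->]; last by rewrite enormE /dot !mulr0 !addr0 sqrtr0.
have : dot x x = 0 by rewrite -enorm_sqr x0 expr0n.
move: x {x0} => [[a b] c]; rewrite /dot/= -!expr2 => /eqP.
rewrite paddr_eq0 ?addr_ge0 ?sqr_ge0// paddr_eq0 ?sqr_ge0// !sqrf_eq0.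
by move=> /andP[/andP[/eqP -> /eqP ->] /eqP ->].
Qed.

Lemma enormZ (c : R) x : enorm (c *: x) = `|c| * enorm x.
Proof.
by rewrite !enormE dotZl dotC dotZl mulrA -expr2 sqrtrM ?sqr_ge0// sqrtr_sqr.
Qed.

Lemma enorm_axis (r : R) : enorm (r, 0, 0) = `|r|.
Proof. by rewrite enormE /dot/= !mulr0 !addr0 -expr2 sqrtr_sqr. Qed.

Lemma coord_le_norm x : [/\ `|x.1.1| <= `|x|, `|x.1.2| <= `|x| & `|x.2| <= `|x|].
Proof. by rewrite !prod_normE !le_max !lexx !orbT. Qed.

Lemma enorm_le_norm x : enorm x <= 2 * `|x|.
Proof.
rewrite -ler_sqr ?nnegrE ?enorm_ge0 ?mulr_ge0// enorm_sqr /dot.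
have [h1 h2 h3] := coord_le_norm x; have n0 := normr_ge0 x.
have sq (a : R) : `|a| <= `|x| -> a * a <= `|x| ^+ 2.
  by move=> ax; rewrite -expr2 -(real_normK (num_real a)) ler_sqr ?nnegrE.
have := sq _ h1; have := sq _ h2; have := sq _ h3.
by rewrite exprMn; have := sqr_ge0 `|x|; lra.
Qed.

Lemma continuous_coord1 : continuous (fun x : R3 R => x.1.1).
Proof.
move=> x; apply: (@continuous_comp _ _ _ fst fst); exact: cvg_fst.
Qed.

Lemma continuous_coord2 : continuous (fun x : R3 R => x.1.2).
Proof.
by move=> x; apply: (@continuous_comp _ _ _ fst snd); [exact: cvg_fst|exact: cvg_snd].
Qed.

Lemma continuous_coord3 : continuous (fun x : R3 R => x.2).
Proof. by move=> x; exact: cvg_snd. Qed.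

Lemma continuous_dot w : continuous (dot^~ w).
Proof.
move=> x; rewrite /dot; apply: cvgD; first apply: cvgD.
- by apply: cvgM; [exact: continuous_coord1|exact: cvg_cst].
- by apply: cvgM; [exact: continuous_coord2|exact: cvg_cst].
- by apply: cvgM; [exact: continuous_coord3|exact: cvg_cst].
Qed.

Lemma continuous_enorm : continuous (@enorm R).
Proof.
have -> : @enorm R =
    Num.sqrt \o (fun x : R3 R => x.1.1 * x.1.1 + x.1.2 * x.1.2 + x.2 * x.2).
  by apply/funext => x /=; rewrite enormE.
move=> x; apply: continuous_comp; last exact: sqrt_continuous.
apply: cvgD; first apply: cvgD.
- by apply: cvgM; exact: continuous_coord1.
- by apply: cvgM; exact: continuous_coord2.
- by apply: cvgM; exact: continuous_coord3.
Qed.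

Lemma is_derive_dot x v w : is_derive x v (dot^~ w) (dot v w).
Proof.
apply: (is_derive_line0 _ _ _ _).2; under eq_fun do rewrite dotDl dotZl.
by apply: is_derive_eq; rewrite -![_ *: _]/(_ * _); ring.
Qed.

Lemma is_derive_enorm x v : x != 0 -> is_derive x v (@enorm R) (dot x v / enorm x).
Proof.
move=> x0; apply: (is_derive_line0 _ _ _ _).2.
have -> : (fun h : R => enorm (h *: v + x)) =
    Num.sqrt \o (fun h : R => h ^+ 2 * dot v v + 2 * h * dot x v + dot x x).
  apply/funext => h /=; rewrite enormE; congr Num.sqrt.
  by rewrite /dot /= -![_ *: _]/(_ * _); ring.
have nx0 : enorm x != 0 by rewrite enorm_eq0.
have xx0 : 0 < dot x x by rewrite -enorm_sqr exprn_gt0// lt0r nx0 enorm_ge0.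
have E0 : 0 ^+ 2 * dot v v + 2 * 0 * dot x v + dot x x = dot x x by ring.
have D : is_derive (0:R) (1:R)
    (fun h : R => h ^+ 2 * dot v v + 2 * h * dot x v + dot x x) (2 * dot x v).
  by apply: is_derive_eq; rewrite -![_ *: _]/(_ * _) ?mulr2n; ring.
have /is_derive_eq : is_derive (0:R) (1:R) (Num.sqrt \o
    (fun h : R => h ^+ 2 * dot v v + 2 * h * dot x v + dot x x))
    ((2 * enorm x)^-1 * (2 * dot x v)).
  apply: is_derive1_comp; rewrite enormE E0; exact: is_derive1_sqrt.
by apply; field.
Qed.

Lemma laplacian_C2 (f : R3 R -> R) d1 d2 x : is_C2 f d1 d2 ->
  laplacian f x = d2 (1, 0, 0) (1, 0, 0) x + d2 (0, 1, 0) (0, 1, 0) x +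
    d2 (0, 0, 1) (0, 0, 1) x.
Proof.
move=> H; rewrite /laplacian.
congr (_ + _ + _); exact: (is_C2_derive _ _ x H).
Qed.

(** The reduced function [y] with [y'' = r F] is the profile [r * u] of a radial
    solution of [laplacian u = F]. *)
Variables (y dy F : R -> R).
Hypothesis y0 : y 0 = 0.
Hypothesis ydy : forall x : R, is_derive x (1:R) y (dy x).
Hypothesis dyddy : forall x : R, is_derive x (1:R) dy (x * F x).
Hypothesis cF : continuous F.

Definition profile (r : R) := if r == 0 then dy 0 else y r / r.

(** [gradient r] is [profile' r / r], extended by its limit at the origin. *)
Definition gradient (r : R) := if r == 0 then F 0 / 3 else (r * dy r - y r) / r ^+ 3.

Lemma derive_bound0 (f df : R -> R) (K r : R) :
  (forall x : R, is_derive x (1:R) f (df x)) ->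
  (forall s, 0 <= s * r -> `|s| <= `|r| -> `|df s| <= K) ->
  `|f r - f 0| <= K * `|r|.
Proof.
move=> fdf dfK; have [r0|r0] := leP 0 r.
  rewrite (ger0_norm r0) -{2}(subr0 r); apply: (derive_bound fdf) => //.
  by move=> s /andP[s0 sr]; apply: dfK; rewrite ?mulr_ge0 ?ger0_norm.
rewrite (ltr0_norm r0) distrC -[X in K * X]add0r; apply: (derive_bound fdf); first exact: ltW.
by move=> s /andP[s0 sr]; apply: dfK; rewrite ?mulr_le0 ?ler0_norm ?lerN2// ltW.
Qed.

(** [r * dy r - y r] is the integral of [s^2 * F s] from [0] to [r], so [gradient r] is
    one third of a weighted mean of [F]. *)
Lemma gradient_approx (r c e : R) : r != 0 ->
  (forall s, 0 <= s * r -> `|s| <= `|r| -> `|F s - c| <= e) -> `|gradient r - c / 3| <= e.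
Proof.
move=> r0 Fc; rewrite /gradient (negbTE r0).
pose H s := s * dy s - y s - c / 3 * s ^+ 3.
have dH (s : R) : is_derive s (1:R) H (s ^+ 2 * (F s - c)).
  rewrite /H; have h1 := ydy s; have h2 := dyddy s.
  by apply: is_derive_eq; rewrite -![_ *: _]/(_ * _) ?mulr2n; field.
have := derive_bound0 (r := r) (K := `|r| ^+ 2 * e) dH.
have -> : H 0 = 0 by rewrite /H y0; ring.
rewrite subr0 => h.
have -> : (r * dy r - y r) / r ^+ 3 - c / 3 = H r / r ^+ 3 by rewrite /H; field.
rewrite normrM normfV normrX ler_pdivrMr ?exprn_gt0 ?normr_gt0//.
rewrite (le_trans (h _))//; last by rewrite mulrAC -exprSr mulrC.
move=> s s0 sr; rewrite normrM normrX ler_pM ?exprn_ge0//; last exact: Fc.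
by rewrite ler_sqr ?nnegrE.
Qed.

Lemma gradient_le (r P : R) : 0 <= r ->
  (forall s, 0 <= s <= r -> `|F s| <= P) ->
  `|gradient r| <= P.
Proof.
move=> r0 FP; have [->|rn0] := eqVneq r 0.
  rewrite /gradient eqxx normrM [`|3^-1|]ger0_norm ?invr_ge0//.
  by rewrite ler_pdivrMr//; have := FP 0; rewrite lexx r0 => /(_ isT);
    have := normr_ge0 (F 0); lra.
have := @gradient_approx r 0 P rn0; rewrite mul0r subr0; apply => s sr0 sr.
have rp : 0 < r by rewrite lt0r rn0.
have s0 : 0 <= s by move: sr0; rewrite pmulr_lge0.
by rewrite subr0 FP// s0; move: sr; rewrite !ger0_norm.
Qed.

Lemma profile_sub0 (r P : R) : (forall s, `|s| <= `|r| -> `|F s| <= P) ->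
  `|profile r - profile 0| <= P * r ^+ 2.
Proof.
move=> FP; rewrite /profile eqxx.
have P0 : 0 <= P by rewrite (le_trans _ (FP 0 _))// normr0.
have [->|r0] := eqVneq r 0; first by rewrite subrr normr0 mulr_ge0// sqr_ge0.
have dyb s : `|s| <= `|r| -> `|dy s - dy 0| <= P * r ^+ 2.
  move=> sr; apply: (@le_trans _ _ (`|s| * P * `|s|)).
    apply: derive_bound0 => // t _ ts; rewrite normrM ler_pM// FP//.
    exact: le_trans sr.
  rewrite mulrAC mulrC -expr2 ler_wpM2l// -(real_normK (num_real r)).
  by rewrite ler_sqr ?nnegrE.
pose K s := y s - s * dy 0.
have dK (s : R) : is_derive s (1:R) K (dy s - dy 0).
  rewrite /K; have h1 := ydy s.
  by apply: is_derive_eq; rewrite -![_ *: _]/(_ * _); ring.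
have := derive_bound0 dK (fun s _ => dyb s); rewrite /K y0 mul0r !subr0 => H.
have -> : y r / r - dy 0 = (y r - r * dy 0) / r by field.
by rewrite normrM normfV ler_pdivrMr ?normr_gt0.
Qed.

Lemma is_derive_profile (r : R) : r != 0 ->
  is_derive r (1:R) profile (r * gradient r).
Proof.
move=> r0; apply: (@near_eq_is_derive _ _ _ (fun t => y t * t^-1)).
  near=> t; rewrite /profile ifF//; apply/negbTE.
  by near: t; apply: open_nbhs_nbhs; split => //; exact: open_neq.
rewrite /gradient (negbTE r0).
have H := ydy r.
have Hi : is_derive r (1:R) (fun t : R => t^-1) (- r ^- 2 *: (1:R)).
  exact: is_deriveV.
by apply: is_derive_eq; rewrite -![_ *: _]/(_ * _); field.
Unshelve. all: by end_near. Qed.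

Lemma is_derive_gradient (r : R) : r != 0 ->
  is_derive r (1:R) gradient ((F r - 3 * gradient r) / r).
Proof.
move=> r0; apply: (@near_eq_is_derive _ _ _
    (fun t : R => (t * dy t - y t) * (t ^+ 3)^-1)).
  near=> t; rewrite /gradient ifF//; apply/negbTE.
  by near: t; apply: open_nbhs_nbhs; split => //; exact: open_neq.
rewrite /gradient (negbTE r0).
have H := ydy r; have H2 := dyddy r.
have Hi : is_derive r (1:R) (fun t : R => (t ^+ 3)^-1)
    (- (r ^+ 3) ^- 2 *: (3%:R *: (r ^+ 2 *: (1:R)))).
  apply: is_deriveV; first by rewrite expf_neq0.
  apply: is_derive_eq; rewrite -![_ *: _]/(_ * _); ring.
by apply: is_derive_eq; rewrite -![_ *: _]/(_ * _); field.
Unshelve. all: by end_near. Qed.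

Lemma is_derive1_continuous_at (f : R -> R) (d r : R) :
  is_derive r (1:R) f d -> {for r, continuous f}.
Proof.
by move=> [D _]; apply: differentiable_continuous; exact/derivable1_diffP.
Qed.

Lemma continuous_gradient : continuous gradient.
Proof.
move=> r; have [->|r0] := eqVneq r 0; last first.
  exact: is_derive1_continuous_at (is_derive_gradient r0).
apply/cvgrPdist_le => e e0.
have /cvgrPdist_le/(_ _ e0)[d /= d0 Hd] := @cF 0.
exists d => //= s; rewrite /ball_/= sub0r normrN => sd.
rewrite distrC {2}/gradient eqxx.
have [->|s0] := eqVneq s 0; first by rewrite /gradient eqxx subrr normr0 ltW.
apply: gradient_approx => // t _ ts; rewrite distrC; apply: Hd => /=.
by rewrite /ball_/= sub0r normrN (le_lt_trans ts).
Qed.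

Lemma continuous_profile : continuous profile.
Proof.
move=> r; have [->|r0] := eqVneq r 0; last first.
  exact: is_derive1_continuous_at (is_derive_profile r0).
have [P P0 FP] := bounded_on_segment (-1) 1 cF.
apply/cvgrPdist_le => e e0.
exists (Num.min 1 (e / (P + 1))) => /=.
  by rewrite lt_min ltr01 divr_gt0// ltr_wpDl.
move=> s; rewrite /ball_/= sub0r normrN lt_min => /andP[s1 se].
rewrite distrC (le_trans (profile_sub0 (P := P) _))//.
  by move=> t ts; apply: FP; rewrite -ler_norml (le_trans ts)// ltW.
rewrite -(real_normK (num_real s)) expr2 mulrA.
move: se; rewrite ltr_pdivlMr ?ltr_wpDl// => se.
have n0 := normr_ge0 s.
have : P * `|s| * `|s| <= P * `|s| * 1 by rewrite ler_wpM2l ?mulr_ge0// ltW.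
lra.
Qed.

Definition radial_d1 w x := gradient (enorm x) * dot x w.

Definition radial_d2 w v x := gradient (enorm x) * dot v w +
  (F (enorm x) - 3 * gradient (enorm x)) / enorm x ^+ 2 * dot x v * dot x w.

(** The quotient by [enorm x ^+ 2] in [radial_d2] is harmless: it is compensated by
    the two factors [dot x v] and [dot x w], and [F - 3 gradient] tends to zero at
    the origin. *)
Lemma radial_is_C2 : is_C2 (fun x => profile (enorm x)) radial_d1 radial_d2.
Proof.
have cg (x : R3 R) : {for x, continuous (fun x : R3 R => gradient (enorm x))}.
  by apply: continuous_comp; [exact: continuous_enorm|exact: continuous_gradient].
have line (x v : R3 R) (f : R -> R) (d : R) : x != 0 ->
    is_derive (enorm x) (1:R) f d ->
    is_derive x v (fun x => f (enorm x)) (d * (dot x v / enorm x)).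
  move=> x0 fd; apply: (is_derive_line0 _ _ _ _).2.
  have E0 : enorm (0 *: v + x) = enorm x by rewrite scale0r add0r.
  have fd' : is_derive (enorm (0 *: v + x)) (1:R) f d by rewrite E0.
  apply: (@is_derive1_comp _ f (fun h : R => enorm (h *: v + x)) 0 _ _ fd').
  exact: (is_derive_line0 _ _ _ _).1 (is_derive_enorm v x0).
split.
- move=> x v; have [->|x0] := eqVneq x 0; last first.
    have nx0 : enorm x != 0 by rewrite enorm_eq0.
    have /is_derive_eq := line _ v _ _ x0 (is_derive_profile nx0); apply.
    by rewrite /radial_d1; field.
  have [P P0 FP] := bounded_on_segment (-1) 1 cF.
  have key : h^-1 *: (profile (enorm (h *: v + 0)) - profile (enorm (0 : R3 R)))
      @[h --> 0^'] --> (0 : R).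
    have e0 : enorm (0 : R3 R) = 0 by apply/eqP; rewrite enorm_eq0.
    have c0 : 0 < P * enorm v ^+ 2 + 1 by rewrite ltr_wpDl// mulr_ge0// sqr_ge0.
    apply/cvgrPdist_le => e ep; near=> h.
    have h0 : h != 0 by near: h; exact: nbhs_dnbhs_neq.
    rewrite sub0r normrN normrZ normfV ler_pdivrMl ?normr_gt0// addr0 e0 enormZ.
    have hv : `|h| * enorm v <= 1.
      rewrite (@le_trans _ _ (`|h| * (enorm v + 1)))//.
        by rewrite ler_wpM2l// lerDl.
      rewrite -ler_pdivlMr ?ltr_wpDl ?enorm_ge0// div1r ltW//.
      by near: h; apply: dnbhs0_lt; rewrite invr_gt0 ltr_wpDl ?enorm_ge0.
    rewrite (le_trans (profile_sub0 (P := P) _))//.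
      move=> t ts; apply: FP; rewrite -ler_norml (le_trans ts)//.
      by rewrite ger0_norm// mulr_ge0// enorm_ge0.
    have he : `|h| * (P * enorm v ^+ 2 + 1) <= e.
      rewrite -ler_pdivlMr// ltW//.
      by near: h; apply: dnbhs0_lt; rewrite divr_gt0.
    have -> : P * (`|h| * enorm v) ^+ 2 = `|h| * (`|h| * (P * enorm v ^+ 2)) by ring.
    by rewrite ler_wpM2l// (le_trans _ he)// ler_wpM2l// lerDl.
  have dot0 : radial_d1 v 0 = 0 by rewrite /radial_d1 /dot/= !mul0r !addr0 mulr0.
  by rewrite dot0; apply: DeriveDef; [apply/cvg_ex; exists (0 : R)|exact/cvg_lim].
- move=> x w v; have [->|x0] := eqVneq x 0; last first.
    have nx0 : enorm x != 0 by rewrite enorm_eq0.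
    have H1 := line _ v _ _ x0 (is_derive_gradient nx0).
    have H2 := is_derive_dot x v w.
    rewrite /radial_d1; have /is_derive_eq := is_deriveM H1 H2; apply.
    by rewrite /radial_d2 -![_ *: _]/(_ * _); field.
  have key : h^-1 *: (radial_d1 w (h *: v + 0) - radial_d1 w 0)
      @[h --> 0^'] --> gradient 0 * dot v w.
    have E : \forall h \near 0^', gradient (enorm (h *: v)) * dot v w =
       h^-1 *: (radial_d1 w (h *: v + 0) - radial_d1 w 0).
      near=> h; have h0 : h != 0 by near: h; exact: nbhs_dnbhs_neq.
      rewrite /radial_d1 addr0 dot0l mulr0 subr0 dotZl.
      by rewrite -[h^-1 *: _]/(h^-1 * _); field.
    apply: cvg_trans (near_eq_cvg E) _.
    apply: cvgM; last exact: cvg_cst.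
    apply: cvg_within_filter.
    have -> : gradient 0 = gradient (enorm (0 *: v)).
      by rewrite scale0r; congr gradient; apply/esym/eqP; rewrite enorm_eq0.
    apply: (continuous_comp (f := fun h : R => h *: v)
      (g := fun x : R3 R => gradient (enorm x))); last exact: cg.
    exact: scalel_continuous.
  have e0 : enorm (0 : R3 R) = 0 by apply/eqP; rewrite enorm_eq0.
  have -> : radial_d2 w v 0 = gradient 0 * dot v w.
    by rewrite /radial_d2 e0 /dot/= !mul0r !addr0 !mulr0 addr0.
  by apply: DeriveDef; [apply/cvg_ex; eexists; exact: key|exact/cvg_lim].
- by move=> x; apply: continuous_comp; [exact: continuous_enorm|exact: continuous_profile].
- by move=> v x; apply: cvgM; [exact: cg|exact: continuous_dot].
- move=> w v x; apply: cvgD; first by apply: cvgM; [exact: cg|exact: cvg_cst].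
  have cFg : {for x, continuous (fun x : R3 R => F (enorm x) - 3 * gradient (enorm x))}.
    apply: cvgB; last by apply: cvgM; [exact: cvg_cst|exact: cg].
    by apply: continuous_comp; [exact: continuous_enorm|exact: cF].
  have [x0|x0] := eqVneq x 0; last first.
    apply: cvgM; last exact: continuous_dot.
    apply: cvgM; last exact: continuous_dot.
    apply: cvgM; first exact: cFg.
    apply: cvgV; first by rewrite expf_neq0// enorm_eq0.
    under eq_fun do rewrite expr2; rewrite expr2.
    by apply: cvgM; exact: continuous_enorm.
  have e0 : enorm (0 : R3 R) = 0 by apply/eqP; rewrite enorm_eq0.
  rewrite x0 /= in cFg *.
  have d0 : dot (0 : R3 R) w = 0 by rewrite /dot/= !mul0r !addr0.
  rewrite d0 mulr0; apply/cvgrPdist_le => e ep.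
  have ep' : 0 < e / (enorm v * enorm w + 1).
    by rewrite divr_gt0// ltr_wpDl// mulr_ge0// enorm_ge0.
  have /cvgrPdist_le/(_ _ ep') := cFg.
  apply: filterS => z; rewrite e0 {1}/gradient eqxx.
  have -> : F 0 - 3 * (F 0 / 3) = 0 by field.
  rewrite !sub0r !normrN => H.
  have [->|z0] := eqVneq z 0; first by rewrite d0 mulr0 normr0 ltW.
  have nz : 0 < enorm z by rewrite lt0r enorm_ge0 enorm_eq0 z0.
  rewrite !normrM normfV normrX [`|enorm z|]gtr0_norm//.
  have H1 := dot_le z v; have H2 := dot_le z w.
  move: H; rewrite ler_pdivlMr ?ltr_wpDl ?mulr_ge0 ?enorm_ge0//.
  set G := `|F _ - _|; have G0 : 0 <= G by exact: normr_ge0.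
  move=> H; apply: le_trans H.
  rewrite -!mulrA ler_wpM2l// mulrC ler_pdivrMr ?exprn_gt0//.
  have : `|dot z v| * `|dot z w| <= (enorm z * enorm v) * (enorm z * enorm w).
    by rewrite ler_pM.
  have := sqr_ge0 (enorm z); nra.
Unshelve. all: by end_near. Qed.

Lemma laplacian_radial x :
  laplacian (fun x => profile (enorm x)) x = F (enorm x).
Proof.
rewrite (laplacian_C2 _ radial_is_C2) /radial_d2 /dot/=.
rewrite !mul0r !mulr0 !mulr1 !addr0 !add0r.
have [x0|x0] := eqVneq x 0.
  rewrite x0/= !mulr0 !addr0.
  have -> : enorm (0 : R3 R) = 0 by apply/eqP; rewrite enorm_eq0.
  by rewrite /gradient eqxx; field.
have nx0 : enorm x != 0 by rewrite enorm_eq0.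
have E := enorm_sqr x; rewrite /dot in E.
have -> : forall g k : R, g + k * x.1.1 * x.1.1 + (g + k * x.1.2 * x.1.2) +
    (g + k * x.2 * x.2) = 3 * g + k * (x.1.1 * x.1.1 + x.1.2 * x.1.2 + x.2 * x.2).
  by move=> g k; ring.
by rewrite -E; field.
Qed.

Lemma radial_C2_bound (X P B : R) : 0 <= X -> 0 <= B ->
  (forall r, 0 <= r -> `|profile r| <= B) ->
  (forall r, 0 <= r <= 2 * X -> `|F r| <= P) ->
  C2_bound (fun x => profile (enorm x)) radial_d1 radial_d2 X
    (B + 20 * (1 + X) * P).
Proof.
move=> X0 B0 uB FP x xX.
have ex : enorm x <= 2 * X.
  by rewrite (le_trans (enorm_le_norm x))// ler_wpM2l.
have P0 : 0 <= P.
  by rewrite (le_trans _ (FP 0 _))// lexx mulr_ge0.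
have XP : 0 <= X * P by rewrite mulr_ge0.
have nx : 0 <= enorm x <= 2 * X by rewrite enorm_ge0.
have gP : `|gradient (enorm x)| <= P.
  apply: gradient_le => [|s /andP[s0 sx]]; first exact: enorm_ge0.
  by apply: FP; rewrite s0 (le_trans sx).
have FPx := FP _ nx.
have vw (v w : R3 R) : `|dot v w| <= 4 * (`|v| * `|w|).
  rewrite (le_trans (dot_le v w))//.
  have -> : 4 * (`|v| * `|w|) = (2 * `|v|) * (2 * `|w|) by ring.
  by rewrite ler_pM ?enorm_ge0// enorm_le_norm.
split.
- apply: (le_trans (uB _ (enorm_ge0 x))); rewrite lerDl; lra.
- move=> v; rewrite /radial_d1 normrM.
  apply: (@le_trans _ _ (P * (4 * (X * `|v|)))).
    rewrite ler_pM// (le_trans (vw _ _))// ler_wpM2l// ler_wpM2r//.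
  have -> : P * (4 * (X * `|v|)) = 4 * (X * P) * `|v| by ring.
  rewrite ler_wpM2r//; lra.
- move=> v w; rewrite /radial_d2.
  apply: (@le_trans _ _ (20 * P * (`|v| * `|w|))); last first.
    rewrite ler_wpM2r ?mulr_ge0//; lra.
  have -> : 20 * P * (`|v| * `|w|) =
    P * (4 * (`|w| * `|v|)) + 4 * P * (4 * (`|v| * `|w|)) by ring.
  rewrite (le_trans (ler_normD _ _))// lerD//; first by rewrite normrM ler_pM.
  have [x0|x0] := eqVneq x 0.
    rewrite x0 /dot/= !mul0r !addr0 !mulr0 normr0 !mulr_ge0//.
  have nx0 : 0 < enorm x by rewrite lt0r enorm_ge0 enorm_eq0 x0.
  rewrite -(mulrA (_ / _)) -(mulrA (F _ - _)) normrM ler_pM//.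
    rewrite (le_trans (ler_normB _ _))// normrM (normr_nat _ 3); lra.
  rewrite !normrM normfV normrX [`|enorm x|]gtr0_norm//.
  rewrite ler_pdivrMl ?exprn_gt0//.
  apply: (@le_trans _ _ ((enorm x * enorm w) * (enorm x * enorm v))).
    by rewrite ler_pM// dot_le.
  have -> : enorm x * enorm w * (enorm x * enorm v) =
    enorm x ^+ 2 * (enorm v * enorm w) by ring.
  rewrite ler_wpM2l ?sqr_ge0//.
  have -> : 4 * (`|v| * `|w|) = (2 * `|v|) * (2 * `|w|) by ring.
  by rewrite ler_pM ?enorm_ge0// enorm_le_norm.
Qed.

End radial_functions.

(** * Integration over space *)

Section integration.
Context {R : realType}.
Notation mR := (measurableTypeR R).
Notation mR2 := (mR * mR)%type.
Notation mR3 := (mR * mR * mR)%type.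
Notation leb := (@lebesgue_measure R).

Lemma measurable_ballR (a e : R) : measurable (ball a e : set mR).
Proof. by apply: open_measurable; exact: ball_open. Qed.

Lemma ball_R3E (a b c e : R) :
  ball ((a, b, c) : R3 R) e = ((ball a e `*` ball b e) `*` ball c e).
Proof. by []. Qed.

(** The product sigma-algebra contains the open sets because they are countable
    unions of rational boxes. *)
Lemma open_measurable3 (U : set (R3 R)) : open U -> measurable (U : set mR3).
Proof.
move=> oU.
pose B (a b c : rat) (k : nat) : set (R3 R) :=
  ball ((ratr a, ratr b, ratr c) : R3 R) (k.+1%:R^-1).
pose F a b c k : set mR3 := if `[< B a b c k `<=` U >] then B a b c k else set0.
suff -> : (U : set mR3) = \bigcup_a \bigcup_b \bigcup_c \bigcup_k F a b c k.
  do 3 (apply: bigcupT_measurable_rat => ?).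
  apply: bigcupT_measurable => k; rewrite /F; case: ifP => // _.
  by rewrite /B ball_R3E; apply: measurableX; [apply: measurableX|];
    exact: measurable_ballR.
apply/seteqP; split => [x Ux|x [a _ [b _ [c _ [k _]]]]]; last first.
  by rewrite /F; case: ifPn => [/asboolP + Bx|//]; exact.
have : nbhs x U by exact: open_nbhs_nbhs.
move=> /nbhs_ballP[e /= e0 eU].
have [k ke] : exists k : nat, (k.+1%:R^-1 : R) < e / 2.
  have e20 : 0 < e / 2 by rewrite divr_gt0.
  exists (Num.truncn (e / 2)^-1); rewrite invf_plt ?posrE//.
  exact: truncnS_gt.
have rat_near (t : R) : exists q : rat, ball (ratr q : R) (k.+1%:R^-1) t.
  have [//|r [tr [q _ qr]]] := @dense_rat R (ball t (k.+1%:R^-1)) _ (ball_open _ _).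
    by exists t; exact: ballxx.
  by exists q; rewrite qr; exact: ball_sym.
have [a ax] := rat_near x.1.1.
have [b bx] := rat_near x.1.2.
have [c cx] := rat_near x.2.
have Bx : B a b c k x by split => //; split.
exists a => //; exists b => //; exists c => //; exists k => //.
rewrite /F; case: ifPn => // /asboolP []; move=> y By; apply: eU.
apply: (@le_ball _ _ x (k.+1%:R^-1 + k.+1%:R^-1)).
  by rewrite [leRHS](splitr e) ltW// ltrD.
exact: ball_triangle (ball_sym Bx) By.
Qed.

Lemma continuous_measurable3 (f : R3 R -> R) : continuous f ->
  measurable_fun setT (f : mR3 -> mR).
Proof.
move=> cf; apply: (measurability _ (RGenOpens.measurableE R)).
move=> _ [_ [a [b ->] <-]]; rewrite setTI; apply: open_measurable3.
by move/continuousP : cf; apply; exact: interval_open.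
Qed.

(** A named copy of the planar measure, on which sigma-finiteness, needed to
    iterate Fubini, can be recorded. *)
Definition leb2 : set mR2 -> \bar R := (leb \x leb)%E.
HB.instance Definition _ := Measure.on leb2.

Lemma leb2_sigma_finite : sigma_finite setT leb2.
Proof.
exists (fun n : nat => [set` `[- (n%:R : R), n%:R]] `*` [set` `[- (n%:R : R), n%:R]]).
  apply/seteqP; split => // -[x y] _.
  exists (Num.truncn (Num.max `|x| `|y|)).+1 => //=.
  rewrite !in_itv/= -!ler_norml.
  by split; apply: le_trans (ltW (truncnS_gt _)); rewrite le_max lexx ?orbT.
move=> n; split; first exact: measurableX.
rewrite [ltLHS](_ : _ = (leb `[(- n%:R)%R, n%:R] * leb `[(- n%:R)%R, n%:R])%E).
  rewrite !lebesgue_measure_itv/=; case: ifP => _; first by rewrite -EFinM ltry.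
  by rewrite mule0 ltry.
exact: product_measure1E.
Qed.

HB.instance Definition _ :=
  @Measure_isSigmaFinite.Build _ _ _ leb2 leb2_sigma_finite.

Definition csupp (N : R) (f : R3 R -> R) :=
  continuous f /\ forall x, N < `|x| -> f x = 0.

Definition cube (a : R3 R) (N : R) : set mR3 :=
  ([set` `[a.1.1 - N, a.1.1 + N]] `*` [set` `[a.1.2 - N, a.1.2 + N]]) `*`
  [set` `[a.2 - N, a.2 + N]].

Lemma measurable_cube a N : measurable (cube a N).
Proof. by do 2 (apply: measurableX => //). Qed.

Lemma lebesgue3_cube a (N : R) : 0 <= N -> lebesgue3 (cube a N) = ((2 * N) ^+ 3)%:E.
Proof.
move=> N0; rewrite /lebesgue3 /cube.
have E (t : R) : leb `[t - N, t + N] = (2 * N)%:E.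
  rewrite lebesgue_measure_itv/= lte_fin.
  have [h|h] := ltP (t - N) (t + N).
    by congr EFin; ring.
  have -> : N = 0 by lra.
  by rewrite mulr0.
rewrite product_measure1E//; last by apply: measurableX.
transitivity (leb `[(a.1.1 - N)%R, (a.1.1 + N)%R] *
  leb `[(a.1.2 - N)%R, (a.1.2 + N)%R] * leb `[(a.2 - N)%R, (a.2 + N)%R])%E.
  by congr (_ * _)%E; exact: product_measure1E.
rewrite !E -!EFinM; congr EFin; ring.
Qed.

Lemma cubeP a N x : cube a N x <-> `|x - a| <= N.
Proof.
have E (s t : R) : (s - N <= t <= s + N) = (`|t - s| <= N).
  rewrite ler_norml [in RHS]lerBrDr [in RHS]lerBlDr.
  by rewrite [- N + s]addrC [N + s]addrC.
rewrite prod_normE [`|(x - a).1|]prod_normE !ge_max /cube /=.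
rewrite !in_itv/= !E.
by split => [[[-> ->] ->//]|/andP[/andP[]]].
Qed.

Lemma integral_leb2 (f : mR2 -> \bar R) :
  (\int[leb2]_x f x = \int[leb \x leb]_x f x)%E.
Proof. exact: eq_measure_integral. Qed.

Lemma bounded_on_cube (f : R3 R -> R) (N : R) : continuous f ->
  exists2 K : R, 0 <= K & forall x, `|x| <= N -> `|f x| <= K.
Proof.
move=> cf; have [N0|N0] := ltP N 0.
  by exists 0 => // x xN; move: (le_lt_trans xN N0); rewrite normr_lt0.
pose I : set R := [set` `[- N, N]].
have cI : compact I by exact: segment_compact.
have cc : compact ((I `*` I) `*` I) by apply: compact_setX => //; exact: compact_setX.
have [||c _ H] := @compact_EVT_max _ R (fun x => `|f x|) _ _ cc.
- by exists 0; rewrite /I /= !in_itv/= !oppr_le0 !N0.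
- apply: continuous_subspaceT => x; apply: cvg_norm; exact: cf.
exists `|f c| => // x xN; apply: H; rewrite inE /I /= !in_itv/= -!ler_norml.
by have [h1 h2 h3] := coord_le_norm x; split; [split|]; apply: le_trans xN.
Qed.

Lemma bounded_support_integrable d (T : measurableType d)
    (mu : {measure set T -> \bar R}) (A : set T) (f : T -> R) (K : R) :
  measurable A -> (mu A < +oo)%E -> measurable_fun setT f ->
  (forall x, `|f x| <= K) -> (forall x, ~ A x -> f x = 0) ->
  mu.-integrable setT (EFin \o f).
Proof.
move=> mA Afin mf fK fA.
have H : mu.-integrable (setT `&` A) (EFin \o f).
  rewrite setTI; apply: measurable_bounded_integrable => //.
    exact: measurable_funTS.
  exists K; split; first exact: num_real.
  by move=> M KM x _ /=; exact: le_trans (fK x) (ltW KM).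
have {}H := (integrable_restrict mu mA measurableT _).1 H.
apply: (eq_integrable measurableT _ _ _ H).
move=> x _; rewrite /patch/=; case: ifPn => // xA; rewrite fA//.
by move=> Ax; move: xA; rewrite mem_set.
Qed.

Lemma csupp_bounded N f : csupp N f -> exists2 K : R, 0 <= K & forall x, `|f x| <= K.
Proof.
move=> [cf fN]; have [K K0 HK] := bounded_on_cube N cf.
exists K => // x; have [xN|xN] := leP `|x| N; first exact: HK.
by rewrite fN// normr0.
Qed.

Lemma csupp_integrable_product N f : 0 <= N -> csupp N f ->
  (leb2 \x leb)%E.-integrable setT (EFin \o (f : mR3 -> R)).
Proof.
move=> N0 nf; have [K K0 fK] := csupp_bounded nf; case: nf => cf fN.
apply: (@bounded_support_integrable _ _ _ (cube 0 N) _ K) => //.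
- exact: measurable_cube.
- by rewrite [ltLHS](lebesgue3_cube 0 N0) ltry.
- exact: continuous_measurable3.
- move=> x nx; apply: fN; rewrite ltNge; apply/negP => xN; apply: nx.
  by apply/cubeP; rewrite subr0.
Qed.

Lemma csupp_integrable N f : 0 <= N -> csupp N f ->
  (@lebesgue3 R).-integrable setT (EFin \o (f : mR3 -> R)).
Proof.
move=> N0 nf; have [K K0 fK] := csupp_bounded nf; case: nf => cf fN.
apply: (@bounded_support_integrable _ _ _ (cube 0 N) _ K) => //.
- exact: measurable_cube.
- by rewrite [ltLHS](lebesgue3_cube 0 N0) ltry.
- exact: continuous_measurable3.
- move=> x nx; apply: fN; rewrite ltNge; apply/negP => xN; apply: nx.
  by apply/cubeP; rewrite subr0.
Qed.

Lemma integral_lebesgue3 (f : mR3 -> \bar R) :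
  (\int[@lebesgue3 R]_x f x = \int[leb2 \x leb]_x f x)%E.
Proof. exact: eq_measure_integral. Qed.

Lemma csupp_slice_integrable N f (z : R) : 0 <= N -> csupp N f ->
  (leb \x leb)%E.-integrable setT
    (EFin \o (fun p : mR2 => f (p, z) : R)).
Proof.
move=> N0 nf; have [K K0 fK] := csupp_bounded nf; case: nf => cf fN.
pose A : set mR2 := [set` `[- N, N]] `*` [set` `[- N, N]].
apply: (@bounded_support_integrable _ _ _ A (fun p : mR2 => f (p, z) : R) K) => //.
- exact: measurableX.
- rewrite [ltLHS](_ : _ = (leb `[(- N)%R, N] * leb `[(- N)%R, N])%E).
  rewrite !lebesgue_measure_itv/=; case: ifP => _; first by rewrite -EFinM ltry.
  by rewrite mule0 ltry.
  exact: product_measure1E.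
- exact: measurable_fun_pair1 (continuous_measurable3 cf).
- move=> [x y] nx; apply: fN; rewrite ltNge; apply/negP => xN; apply: nx.
  have [h1 h2 _] := coord_le_norm (x, y, z).
  by rewrite /A/= !in_itv/= -!ler_norml; split; [exact: le_trans h1 xN|exact: le_trans h2 xN].
Qed.

Lemma integral_derive_compact (f df : R -> R) (N : R) :
  (forall t : R, is_derive t (1:R) f (df t)) -> continuous df ->
  (forall t, N < `|t| -> f t = 0) -> (forall t, N < `|t| -> df t = 0) ->
  (\int[leb]_t (df t)%:E = 0)%E.
Proof.
move=> fdf cdf fN dfN; pose M : R := `|N| + 1.
have NM : N < M by rewrite /M (le_lt_trans (ler_norm N))// ltrDl.
have M0 : 0 < M by rewrite /M ltr_wpDl.
have -> : (\int[leb]_t (df t)%:E = \int[leb]_(t in `[(- M)%R, M]) (df t)%:E)%E.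
  rewrite [RHS]integral_mkcond; apply: eq_integral => t _; rewrite /patch.
  case: ifPn => // /negP tM; rewrite dfN//; rewrite ltNge; apply/negP => tN.
  apply: tM; rewrite inE/= in_itv/= -ler_norml (le_trans tN)// ltW//.
rewrite (continuous_FTC2 (F := f)).
- by rewrite (fN M) ?(fN (- M)) ?normrN ?gtr0_norm// sube0.
- by lra.
- exact: continuous_subspaceT.
- split=> [t _||]; first exact: ex_derive.
  + by apply: cvg_at_right_filter; exact: (is_derive_continuous fdf).
  + by apply: cvg_at_left_filter; exact: (is_derive_continuous fdf).
- by move=> t _; rewrite derive1E; have [_ ->] := fdf t.
Qed.

Lemma integral_slice3 N (f : R3 R -> R) : 0 <= N -> csupp N f ->
  (forall x y : R, \int[leb]_z (f (x, y, z))%:E = 0)%E ->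
  (\int[@lebesgue3 R]_x (f x)%:E = 0)%E.
Proof.
move=> N0 /(csupp_integrable_product N0) fi f0.
rewrite integral_lebesgue3 -(integral12_prod_meas1 fi).
by apply: integral0_eq => -[x y] _ /=; exact: f0.
Qed.

Lemma integral_slice2 N (f : R3 R -> R) : 0 <= N -> csupp N f ->
  (forall x z : R, \int[leb]_y (f (x, y, z))%:E = 0)%E ->
  (\int[@lebesgue3 R]_x (f x)%:E = 0)%E.
Proof.
move=> N0 nf f0; have fi := csupp_integrable_product N0 nf.
rewrite integral_lebesgue3 -(integral21_prod_meas1 fi).
apply: integral0_eq => z _ /=.
rewrite /fubini_G integral_leb2.
rewrite -(integral12_prod_meas1 (csupp_slice_integrable z N0 nf)).
by apply: integral0_eq => x _ /=; exact: f0.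
Qed.

Lemma integral_slice1 N (f : R3 R -> R) : 0 <= N -> csupp N f ->
  (forall y z : R, \int[leb]_x (f (x, y, z))%:E = 0)%E ->
  (\int[@lebesgue3 R]_x (f x)%:E = 0)%E.
Proof.
move=> N0 nf f0; have fi := csupp_integrable_product N0 nf.
rewrite integral_lebesgue3 -(integral21_prod_meas1 fi).
apply: integral0_eq => z _ /=.
rewrite /fubini_G integral_leb2.
rewrite -(integral21_prod_meas1 (csupp_slice_integrable z N0 nf)).
by apply: integral0_eq => y _ /=; exact: f0.
Qed.

Definition axis (i : 'I_3) : R3 R :=
  ((i == 0%N :> nat)%:R, (i == 1%N :> nat)%:R, (i == 2%N :> nat)%:R).

(** Fubini along the axis and the fundamental theorem of calculus; for a function
    of the form [u * dphi - phi * du] this is integration by parts. *)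
Lemma integral_axis_derive N (i : 'I_3) (f df : R3 R -> R) : 0 <= N ->
  csupp N f -> csupp N df -> (forall x, is_derive x (axis i) f (df x)) ->
  (\int[@lebesgue3 R]_x (df x)%:E = 0)%E.
Proof.
move=> N0 [cf fN] ndf fdf; have [cdf dfN] := ndf.
have line (x : R3 R) (j : R -> R3 R) : (forall t, j t = t *: axis i + x) ->
    (forall t, `|t| <= `|j t|) -> (\int[leb]_t (df (j t))%:E = 0)%E.
  move=> jE tj.
  have cj : continuous j.
    have -> : j = (fun t => t *: axis i + x) by exact/funext.
    by move=> t; apply: cvgD; [exact: scalel_continuous|exact: cvg_cst].
  apply: (@integral_derive_compact (fun t => f (j t)) (fun t => df (j t)) N).
  - move=> t; have -> : (fun t => f (j t)) = (fun t => f (t *: axis i + x)).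
      by apply/funext => s; rewrite jE.
    rewrite jE; exact: (is_derive_line f x (axis i) t _).1.
  - by move=> t; apply: continuous_comp; [exact: cj|exact: cdf].
  - by move=> t tN; apply: fN; exact: lt_le_trans (tj t).
  - by move=> t tN; apply: dfN; exact: lt_le_trans (tj t).
move: i fdf line; case=> [[|[|[|//]]] i3] fdf line.
- apply: (integral_slice1 N0 ndf) => y z.
  apply: (line (0, y, z) (fun t => (t, y, z))) => // t.
    by rewrite -[RHS]/(t * 1 + 0, t * 0 + y, t * 0 + z); congr (_, _, _); ring.
  by have [h _ _] := coord_le_norm (t, y, z).
- apply: (integral_slice2 N0 ndf) => x z.
  apply: (line (x, 0, z) (fun t => (x, t, z))) => // t.
    by rewrite -[RHS]/(t * 0 + x, t * 1 + 0, t * 0 + z); congr (_, _, _); ring.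
  by have [_ h _] := coord_le_norm (x, t, z).
- apply: (integral_slice3 N0 ndf) => x y.
  apply: (line (x, y, 0) (fun t => (x, y, t))) => // t.
    by rewrite -[RHS]/(t * 0 + x, t * 0 + y, t * 1 + 0); congr (_, _, _); ring.
  by have [_ _ h] := coord_le_norm (x, y, t).
Qed.

End integration.

(** * Test functions and weak solutions *)

Section test_functions.
Context {R : realType}.

Section Ck_closure.
Context {V : normedModType R}.
Implicit Types (f g : V -> R).

Lemma CkS_intro n f : continuous f ->
  (forall v, exists2 df : V -> R, forall x, is_derive x v f (df x) & Ck setT n df) ->
  Ck setT n.+1 f.
Proof.
move=> cf H; split => [x _|v]; first exact: cf.
have [df fdf cdf] := H v.
have -> : 'D_v f = df by apply/funext => x; have [_ ->] := fdf x.
by split => // x _; have [] := fdf x.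
Qed.

Lemma CkS_elim n f : Ck setT n.+1 f -> continuous f /\
  forall v, (forall x, is_derive x v f ('D_v f x)) /\ Ck setT n ('D_v f).
Proof.
move=> [cf H]; split => [x|v]; first exact: cf.
by have [dv cdv] := H v; split => // x; apply: DeriveDef => //; exact: dv.
Qed.

Lemma Ck_continuous n f : Ck setT n f -> continuous f.
Proof. by case: n => [|n] [cf _] x; exact: cf. Qed.

Lemma Ck_le n f : Ck setT n.+1 f -> Ck setT n f.
Proof.
elim: n f => [|n IH] f /CkS_elim[cf H]; first by split => // x _; exact: cf.
apply: CkS_intro => // v; have [H1 H2] := H v.
by exists ('D_v f) => //; exact: IH.
Qed.

Lemma CkD n f g : Ck setT n f -> Ck setT n g -> Ck setT n (fun x => f x + g x).
Proof.
elim: n f g => [|n IH] f g.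
  move=> [cf _] [cg _]; split => // x _.
  by apply: cvgD; [exact: cf|exact: cg].
move=> /CkS_elim[cf Hf] /CkS_elim[cg Hg]; apply: CkS_intro.
  by move=> x; apply: cvgD; [exact: cf|exact: cg].
move=> v; have [f1 f2] := Hf v; have [g1 g2] := Hg v.
exists (fun x => 'D_v f x + 'D_v g x); last exact: IH.
by move=> x; apply: is_deriveD.
Qed.

Lemma CkM n f g : Ck setT n f -> Ck setT n g -> Ck setT n (fun x => f x * g x).
Proof.
elim: n f g => [|n IH] f g.
  move=> [cf _] [cg _]; split => // x _.
  by apply: cvgM; [exact: cf|exact: cg].
move=> Cf Cg; have [cf Hf] := CkS_elim Cf; have [cg Hg] := CkS_elim Cg.
apply: CkS_intro.
  by move=> x; apply: cvgM; [exact: cf|exact: cg].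
move=> v; have [f1 f2] := Hf v; have [g1 g2] := Hg v.
exists (fun x => f x * 'D_v g x + g x * 'D_v f x).
  by move=> x; apply: is_deriveM.
by apply: CkD; apply: IH => //; exact: Ck_le.
Qed.

Lemma Ck_cst n (c : R) : Ck setT n (fun _ : V => c).
Proof.
elim: n c => [|n IH] c.
  by split => // x _; exact: cst_continuous.
apply: CkS_intro; first exact: cst_continuous.
by move=> v; exists (fun=> 0) => // x; exact: is_derive_cst.
Qed.

End Ck_closure.

Lemma Ck_affine {V : normedModType R} n (l : V -> R) (b : R -> R) (c : R) : continuous l ->
  (forall h v x, l (h *: v + x) = h * l v + l x) ->
  Ck setT n b -> Ck setT n (fun x => b (l x + c)).
Proof.
move=> cl lin; have cc : continuous (fun x => l x + c).
  by move=> x; apply: cvgD; [exact: cl|exact: cvg_cst].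
elim: n b => [|n IH] b.
  move=> [cb _]; split => // x _.
  by apply: continuous_comp; [exact: cc|exact: cb].
move=> /CkS_elim[cb Hb]; apply: CkS_intro.
  by move=> x; apply: continuous_comp; [exact: cc|exact: cb].
move=> v; have [b1 b2] := Hb (1:R).
exists (fun x => l v * 'D_1 b (l x + c)); last first.
  by apply: CkM; [exact: Ck_cst|exact: (IH ('D_(1:R) b) b2)].
move=> x; apply: (is_derive_line0 _ _ _ _).2.
under eq_fun do rewrite lin.
have D : is_derive (0 * l v + l x + c) (1:R) b ('D_1 b (l x + c)).
  by rewrite mul0r add0r; exact: b1.
have Dl : is_derive (0:R) (1:R) (fun h : R => h * l v + l x + c) (l v).
  by apply: is_derive_eq; rewrite -![_ *: _]/(_ * _); ring.
rewrite mulrC; exact: (@is_derive1_comp _ b _ 0 _ _ D Dl).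
Qed.

Implicit Types (x v w : R3 R).

Lemma test_function_C2 (phi : R3 R -> R) : test_function phi ->
  exists d1 d2 (N : R), [/\ 0 <= N, is_C2 phi d1 d2 &
    forall x, N < `|x| -> [/\ phi x = 0, forall v, d1 v x = 0 &
      forall v w, d2 v w x = 0]].
Proof.
move=> [sphi cphi].
have [c0 H1] := CkS_elim (sphi 2%N).
have H2 v := CkS_elim (H1 v).2.
have [M [Mr HM]] := compact_bounded cphi.
pose N : R := `|M| + 1.
have N0 : 0 <= N by rewrite addr_ge0.
have zero x : N < `|x| -> phi x = 0.
  move=> Nx; apply/eqP/negPn/negP => px.
  have : `|x| <= N.
    apply: HM; first by rewrite /N (le_lt_trans (ler_norm M))// ltrDl.
    by apply: subset_closure.
  by rewrite leNgt Nx.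
have nearN x : N < `|x| -> \forall y \near x, N < `|y|.
  move=> Nx; have cn : {for x, continuous (fun y : R3 R => `|y|)}.
    exact: norm_continuous.
  exact: (cvgr_gt _ cn _ Nx).
have zeroD (f df : R3 R -> R) v : (forall x, is_derive x v f (df x)) ->
    (forall x, N < `|x| -> f x = 0) -> forall x, N < `|x| -> df x = 0.
  move=> fdf f0 x Nx.
  have [_ <-] := fdf x.
  rewrite (@near_eq_derive _ _ _ f (cst 0)) ?derive_cst//.
  by apply: filterS (nearN x Nx) => y /f0.
exists (fun v => 'D_v phi), (fun v w => 'D_w ('D_v phi)), N; split => //.
  split.
  - by move=> x v; exact: (H1 v).1.
  - by move=> x v w; exact: ((H2 v).2 w).1.
  - exact: c0.
  - by move=> v; exact: (H2 v).1.
  - by move=> v w; exact: Ck_continuous ((H2 v).2 w).2.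
have z1 v x : N < `|x| -> 'D_v phi x = 0.
  exact: (zeroD phi _ v (H1 v).1).
move=> x Nx; split=> [|v|v w]; [exact: zero|exact: z1|].
exact: (zeroD ('D_v phi) _ w ((H2 v).2 w).1 (z1 v) x Nx).
Qed.

Local Notation I := (fun f : R3 R -> R => \int[@lebesgue3 R]_x f x).

Lemma csupp_integralD N (f g : R3 R -> R) : 0 <= N -> csupp N f -> csupp N g ->
  I (fun x => f x + g x) = I f + I g.
Proof.
by move=> N0 nf ng; apply: RintegralD => //; exact: csupp_integrable N0 _.
Qed.

Lemma csuppD N (f g : R3 R -> R) : csupp N f -> csupp N g ->
  csupp N (fun x => f x + g x).
Proof.
move=> [cf fN] [cg gN]; split.
  by move=> x; apply: cvgD; [exact: cf|exact: cg].
by move=> x Nx; rewrite fN// gN// addr0.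
Qed.

Lemma csuppN N (f : R3 R -> R) : csupp N f -> csupp N (fun x => - f x).
Proof.
move=> [cf fN]; split; first by move=> x; apply: cvgN; exact: cf.
by move=> x Nx; rewrite fN// oppr0.
Qed.

Lemma csuppMr N (f g : R3 R -> R) : continuous f -> csupp N g ->
  csupp N (fun x => f x * g x).
Proof.
move=> cf [cg gN]; split.
  by move=> x; apply: cvgM; [exact: cf|exact: cg].
by move=> x Nx; rewrite gN// mulr0.
Qed.

(** Integration by parts against a test function. *)
Lemma distributional_of_classical (m : R) (u f : R3 R -> R) d1 d2 :
  is_C2 u d1 d2 -> (forall x, - laplacian u x + m ^+ 2 * u x = f x) ->
  distributional_solution m u f.
Proof.
move=> uC uf phi /test_function_C2[e1 [e2 [N [N0 pC pN]]]].
have [uD uDD cu cu1 cu2] := uC; have [pD pDD cp cp1 cp2] := pC.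
have np : csupp N phi by split => // x /pN[].
have np1 v : csupp N (e1 v) by split => // x /pN[].
have np2 v w : csupp N (e2 v w) by split => // x /pN[].
pose dg i x := u x * e2 (axis i) (axis i) x - phi x * d2 (axis i) (axis i) x.
have ndg i : csupp N (dg i).
  apply: csuppD; first exact: csuppMr.
  apply: csuppN; rewrite (_ : (fun x => _) = fun x => d2 (axis i) (axis i) x * phi x).
    exact: csuppMr.
  by apply/funext => x; rewrite mulrC.
have Idg i : I (dg i) = 0.
  rewrite /Rintegral.
  suff -> : (\int[lebesgue3]_x (dg i x)%:E = 0)%E by [].
  apply: (@integral_axis_derive _ N i
    (fun x => u x * e1 (axis i) x - phi x * d1 (axis i) x)) => //.
    apply: csuppD; first exact: csuppMr.
    apply: csuppN; rewrite (_ : (fun x => _) = fun x => d1 (axis i) x * phi x).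
      exact: csuppMr.
    by apply/funext => x; rewrite mulrC.
  move=> x.
  have A := is_deriveM (uD x (axis i)) (pDD x (axis i) (axis i)).
  have B := is_deriveM (pD x (axis i)) (uDD x (axis i) (axis i)).
  have /is_derive_eq := is_deriveB A B; apply.
  by rewrite /dg -![_ *: _]/(_ * _); ring.
have E x : u x * (- laplacian phi x + m ^+ 2 * phi x) =
    f x * phi x + (- dg ord0 x + (- dg (inord 1) x + - dg (inord 2) x)).
  rewrite -uf (laplacian_C2 x uC) (laplacian_C2 x pC) /dg.
  have -> : axis ord0 = (1, 0, 0) :> R3 R by [].
  have -> : axis (inord 1) = (0, 1, 0) :> R3 R by rewrite /axis !inordK.
  have -> : axis (inord 2) = (0, 0, 1) :> R3 R by rewrite /axis !inordK.
  ring.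
transitivity (I (fun x => f x * phi x +
    (- dg ord0 x + (- dg (inord 1) x + - dg (inord 2) x)))).
  by apply: eq_Rintegral => x _; exact: E.
have cf : continuous f.
  have -> : f = fun x => - (d2 (1, 0, 0) (1, 0, 0) x + d2 (0, 1, 0) (0, 1, 0) x +
      d2 (0, 0, 1) (0, 0, 1) x) + m ^+ 2 * u x.
    by apply/funext => x; rewrite -uf (laplacian_C2 x uC).
  move=> x; apply: cvgD; last by apply: cvgM; [exact: cvg_cst|exact: cu].
  by apply: cvgN; apply: cvgD; [apply: cvgD|]; exact: cu2.
have IN i : I (fun x => - dg i x) = 0.
  rewrite -[LHS]addr0 -{1}(Idg i) -(csupp_integralD N0)//; last exact: csuppN.
  by under eq_Rintegral do rewrite addNr; rewrite /Rintegral integral0.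
rewrite (csupp_integralD N0); last 2 first.
- exact: csuppMr.
- by do 2 (apply: csuppD; first exact: csuppN); exact: csuppN.
rewrite (csupp_integralD N0); last 2 first.
- exact: csuppN.
- by apply: csuppD; exact: csuppN.
rewrite (csupp_integralD N0); last 2 first.
- exact: csuppN.
- exact: csuppN.
by rewrite !IN !addr0.
Qed.

End test_functions.

(** * Smooth bump functions *)

Section bump.
Context {R : realType}.

Lemma expR_beats_poly (p : {poly R}) (a : R) : 0 < a ->
  exists2 C : R, 0 <= C & forall s, 0 <= s -> `|p.[s]| <= C * expR (a * s).
Proof.
elim/poly_ind: p a => [|p c IH] a a0.
  by exists 0 => // s _; rewrite horner0 normr0 mul0r.
have a20 : 0 < a / 2 by rewrite divr_gt0.
have [C C0 HC] := IH _ a20.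
exists (C * (2 / a) + `|c|).
  by rewrite addr_ge0// mulr_ge0// divr_ge0// ltW.
move=> s s0; rewrite hornerMXaddC (le_trans (ler_normD _ _))// mulrDl lerD//.
  have -> : a * s = a / 2 * s + a / 2 * s by field.
  rewrite expRD normrM (ger0_norm s0).
  have se : s <= 2 / a * expR (a / 2 * s).
    rewrite -ler_pdivrMl ?divr_gt0// invf_div.
    by apply: le_trans (expR_ge1Dx _); rewrite lerDr.
  have -> : C * (2 / a) * (expR (a / 2 * s) * expR (a / 2 * s)) =
    (C * expR (a / 2 * s)) * (2 / a * expR (a / 2 * s)) by ring.
  by rewrite ler_pM// HC.
by rewrite ler_peMr// -expR0 ler_expR mulr_ge0// ltW.
Qed.

(** Smooth functions vanishing to infinite order at the origin; the family is
    stable under differentiation. *)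
Definition flat (p : {poly R}) (t : R) := if 0 < t then p.[t^-1] * expR (- t^-1) else 0.

Lemma is_derive_flat (p : {poly R}) (t : R) :
  is_derive t (1:R) (flat p) (flat ('X^2 * (p - p^`())) t).
Proof.
have [t0|t0|<-] := ltgtP 0 t.
- apply: (@near_eq_is_derive _ _ _ (fun s : R => p.[s^-1] * expR (- s^-1))).
    by near=> s; rewrite /flat ifT//; near: s; exact: lt_nbhsr.
  have tn0 : t != 0 by rewrite gt_eqF.
  have Di : is_derive t (1:R) (fun s : R => s^-1) (- t ^- 2).
    have /is_derive_eq : is_derive t (1:R) (fun s : R => s^-1) (- t ^- 2 *: (1:R)).
      exact: is_deriveV.
    by apply; rewrite -[_ *: _]/(_ * _) mulr1.
  have Dp : is_derive t (1:R) (fun s : R => p.[s^-1]) (p^`().[t^-1] * - t ^- 2).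
    by apply: (@is_derive1_comp _ (horner p) (fun s : R => s^-1)).
  have De : is_derive t (1:R) (fun s : R => expR (- s^-1)) (expR (- t^-1) * t ^- 2).
    have Dn : is_derive t (1:R) (fun s : R => - s^-1) (t ^- 2).
      by rewrite -[t ^- 2]opprK; apply: is_deriveN.
    exact: (@is_derive1_comp _ expR (fun s : R => - s^-1)).
  have /is_derive_eq := is_deriveM Dp De; apply.
  rewrite /flat t0 -![_ *: _]/(_ * _) hornerM hornerXn hornerD hornerN exprVn.
  ring.
- apply: (@near_eq_is_derive _ _ _ (cst (0:R))).
    near=> s; rewrite /flat ifF//; apply/negbTE; rewrite -leNgt ltW//.
    by near: s; exact: lt_nbhsl.
  by rewrite /flat ifF; [exact: is_derive_cst|apply/negbTE; rewrite -leNgt ltW].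
have [C C0 HC] := expR_beats_poly (p * 'X^2) (@ltr01 R).
have flat_le (h : R) : `|flat p h| <= C * h ^+ 2.
  rewrite /flat; case: ifPn => h0; last by rewrite normr0 mulr_ge0// sqr_ge0.
  have ih0 : 0 <= h^-1 by rewrite invr_ge0 ltW.
  have := HC _ ih0; rewrite hornerM hornerXn mul1r.
  rewrite normrM [`|_ ^+ 2|]ger0_norm ?sqr_ge0// => H.
  rewrite normrM [`|expR _|]ger0_norm ?expR_ge0// expRN ler_pdivrMr ?expR_gt0//.
  have h20 : 0 < h ^+ 2 by rewrite exprn_gt0.
  by move: H; rewrite exprVn ler_pdivrMr// mulrAC.
rewrite {2}/flat ltxx.
have key : h^-1 *: (flat p (h *: (1:R) + 0) - flat p 0) @[h --> 0^'] --> (0 : R).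
  apply/cvgrPdist_le => e e0; near=> h.
  have h0 : h != 0 by near: h; exact: nbhs_dnbhs_neq.
  rewrite sub0r normrN normrZ normfV ler_pdivrMl ?normr_gt0//.
  rewrite addr0 {2}/flat ltxx subr0 -[h *: _]/(h * 1) mulr1.
  apply: (le_trans (flat_le h)).
  rewrite -(real_normK (num_real h)) expr2 mulrCA ler_wpM2l//.
  have C1 : 0 < C + 1 by rewrite ltr_wpDl.
  apply: (@le_trans _ _ ((C + 1) * `|h|)); first by rewrite ler_wpM2r// lerDl.
  rewrite -ler_pdivlMl// mulrC ltW//.
  by near: h; apply: dnbhs0_lt; rewrite divr_gt0// ltr_wpDl.
by apply: DeriveDef; [apply/cvg_ex; exists (0 : R)|exact/cvg_lim].
Unshelve. all: by end_near. Qed.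

Lemma Ck_flat n (p : {poly R}) : Ck setT n (flat p).
Proof.
elim: n p => [|n IH] p.
  by split => // x _; exact: (is_derive_continuous (is_derive_flat p)).
apply: CkS_intro; first exact: (is_derive_continuous (is_derive_flat p)).
move=> v; exists (fun x => v * flat ('X^2 * (p - p^`())) x); last first.
  by apply: CkM; [exact: Ck_cst|exact: IH].
move=> x; apply: (is_derive_line0 _ _ _ _).2.
have D : is_derive (0 *: v + x) (1:R) (flat p) (flat ('X^2 * (p - p^`())) x).
  by rewrite scale0r add0r; exact: is_derive_flat.
have Dl : is_derive (0:R) (1:R) (fun h : R => h *: v + x) v.
  by apply: is_derive_eq; rewrite -![_ *: _]/(_ * _); ring.
rewrite mulrC; exact: (@is_derive1_comp _ (flat p) _ 0 _ _ D Dl).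
Qed.

Definition bump (d t : R) := flat 1 (t + d) * flat 1 (- t + d).

Lemma Ck_bump n d : Ck setT n (bump d).
Proof.
apply: CkM.
  apply: (@Ck_affine _ R n id (flat 1) d) => //; last exact: Ck_flat.
  by move=> x; exact: cvg_id.
apply: (@Ck_affine _ R n -%R (flat 1) d); last exact: Ck_flat.
  by move=> x; apply: cvgN; exact: cvg_id.
by move=> h v x; rewrite -[h *: v]/(h * v); ring.
Qed.

Lemma bump_eq0 d t : d <= `|t| -> bump d t = 0.
Proof.
rewrite /bump /flat ler_normr => /orP[] dt.
  by rewrite [X in _ * X]ifF ?mulr0//; apply/negbTE; rewrite -leNgt; lra.
by rewrite ifF ?mul0r//; apply/negbTE; rewrite -leNgt; lra.
Qed.

Lemma flat1_gt0 (t : R) : 0 < t -> 0 < flat 1 t.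
Proof. by move=> t0; rewrite /flat t0 -polyC1 hornerC mul1r expR_gt0. Qed.

Lemma flat1_ge0 (t : R) : 0 <= flat 1 t.
Proof.
have [t0|t0] := ltP 0 t; first exact/ltW/flat1_gt0.
by rewrite /flat ifF//; apply/negbTE; rewrite -leNgt.
Qed.

Lemma bump_ge0 d t : 0 <= bump d t.
Proof. by rewrite /bump mulr_ge0// flat1_ge0. Qed.

Lemma bump0_gt0 d : 0 < d -> 0 < bump d 0.
Proof. by move=> d0; rewrite /bump oppr0 add0r mulr_gt0// flat1_gt0. Qed.

(** The error being cubic in [t], the symmetric second difference is governed by
    [t ^+ 2 * b2 s] for small [t]. *)
Lemma second_difference (b b1 b2 b3 : R -> R) (K s t : R) : 0 <= t ->
  (forall x : R, is_derive x (1:R) b (b1 x)) ->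
  (forall x : R, is_derive x (1:R) b1 (b2 x)) ->
  (forall x : R, is_derive x (1:R) b2 (b3 x)) ->
  (forall x, `|b3 x| <= K) ->
  `|b (s + t) + b (s - t) - 2 * b s - t ^+ 2 * b2 s| <= 2 * K * t ^+ 3.
Proof.
move=> t0 D0 D1 D2 HK.
have K0 : 0 <= K by exact: le_trans (HK 0).
have Dp (f df : R -> R) (x : R) : (forall x : R, is_derive x (1:R) f (df x)) ->
    is_derive x (1:R) (fun u => f (s + u)) (df (s + x)).
  move=> fD; under eq_fun do rewrite addrC.
  by rewrite addrC; apply: is_derive_translate; exact: fD.
have Dm (f df : R -> R) (x : R) : (forall x : R, is_derive x (1:R) f (df x)) ->
    is_derive x (1:R) (fun u => f (s - u)) (- df (s - x)).
  move=> fD; have Dl : is_derive x (1:R) (fun u : R => s - u) (-1).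
    by rewrite -[-1]add0r; apply: is_deriveB.
  have /is_derive_eq := @is_derive1_comp _ f (fun u : R => s - u) x _ _ (fD _) Dl.
  by apply; rewrite mulrN1.
pose G0 u := b (s + u) + b (s - u) - 2 * b s - u ^+ 2 * b2 s.
pose G1 u := b1 (s + u) - b1 (s - u) - 2 * u * b2 s.
pose G2 u := b2 (s + u) + b2 (s - u) - 2 * b2 s.
have DG0 (u : R) : is_derive u (1:R) G0 (G1 u).
  rewrite /G0 /G1; have A := Dp _ _ u D0; have B := Dm _ _ u D0.
  by apply: is_derive_eq; rewrite -![_ *: _]/(_ * _) ?mulr2n; ring.
have DG1 (u : R) : is_derive u (1:R) G1 (G2 u).
  rewrite /G1 /G2; have A := Dp _ _ u D1; have B := Dm _ _ u D1.
  by apply: is_derive_eq; rewrite -![_ *: _]/(_ * _) ?mulr2n; ring.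
have H2 u : 0 <= u <= t -> `|G2 u| <= 2 * K * t.
  move=> /andP[u0 ut].
  have A : `|b2 (s + u) - b2 s| <= K * (s + u - s).
    by apply: (derive_bound D2) => //; rewrite lerDl.
  have B : `|b2 s - b2 (s - u)| <= K * (s - (s - u)).
    by apply: (derive_bound D2) => //; rewrite gerBl.
  have -> : G2 u = (b2 (s + u) - b2 s) - (b2 s - b2 (s - u)) by rewrite /G2; ring.
  rewrite (le_trans (ler_normB _ _))//.
  have : K * u <= K * t by rewrite ler_wpM2l.
  move: A B; have -> : s + u - s = u by ring.
  have -> : s - (s - u) = u by ring.
  lra.
have H1 u : 0 <= u <= t -> `|G1 u| <= 2 * K * t * t.
  move=> /andP[u0 ut].
  have G10 : G1 0 = 0 by rewrite /G1 addr0 subr0; ring.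
  rewrite -[G1 u]subr0 -{1}G10.
  apply: le_trans (derive_bound (K := 2 * K * t) DG1 u0 _) _.
    by move=> x /andP[x0 xu]; apply: H2; rewrite x0 (le_trans xu).
  by rewrite subr0 ler_wpM2l// !mulr_ge0.
have G00 : G0 0 = 0 by rewrite /G0 addr0 subr0; ring.
rewrite -/(G0 t) -[G0 t]subr0 -{1}G00.
apply: le_trans (derive_bound (K := 2 * K * t * t) DG0 t0 _) _; first exact: H1.
by rewrite subr0 le_eqVlt; apply/orP; left; apply/eqP; ring.
Qed.

End bump.

(** * Uniqueness of bounded weak solutions *)

Section weak_uniqueness.
Context {R : realType}.
Implicit Types (x z e : R3 R) (f g : R3 R -> R).
Local Notation I := (fun f : R3 R -> R => \int[@lebesgue3 R]_x f x).

Lemma csupp_cst_out z (r : R) f : continuous f ->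
  (forall x, r < `|x - z| -> f x = 0) -> csupp (`|z| + r) f.
Proof.
move=> cf f0; split => // x xr; apply: f0.
rewrite -(ltrD2l `|z|) (lt_le_trans xr)//.
by rewrite -[x in leLHS](subrK z) addrC ler_normD.
Qed.

Lemma integral_cube_bound N z (r K : R) f : 0 <= N -> 0 <= r -> csupp N f ->
  (forall x, `|f x| <= K) -> (forall x, r < `|x - z| -> f x = 0) ->
  `|I f| <= K * (2 * r) ^+ 3.
Proof.
move=> N0 r0 nf fK fz.
have mc := measurable_cube z r.
have fi := csupp_integrable N0 nf.
have ficube : (@lebesgue3 R).-integrable (cube z r) (EFin \o f).
  exact: integrableS fi.
have -> : I f = \int[@lebesgue3 R]_(x in cube z r) f x.
  rewrite [RHS]Rintegral_mkcond; apply: eq_Rintegral => x _; rewrite /patch.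
  case: ifPn => // /negP xc; rewrite fz// ltNge; apply/negP => xr.
  by apply: xc; rewrite inE; apply/cubeP.
have mu : @lebesgue3 R (cube z r) = ((2 * r) ^+ 3)%:E by exact: lebesgue3_cube.
apply: (le_trans (le_normr_Rintegral _ ficube)) => //.
have Ki : (@lebesgue3 R).-integrable (cube z r) (EFin \o (cst K : R3 R -> R)).
  apply: measurable_bounded_integrable => //.
  - by rewrite [ltLHS]mu ltry.
  - by exists `|K|; split; [exact: num_real|move=> M KM x _ /=; exact: ltW].
apply: (@le_trans _ _ (\int[@lebesgue3 R]_(x in cube z r) cst K x)).
  by apply: le_Rintegral => //; exact: integrable_norm.
by rewrite Rintegral_cst// [X in fine X]mu.
Qed.

Lemma integral_gt0 N z f : 0 <= N -> csupp N f -> (forall x, 0 <= f x) ->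
  0 < f z -> 0 < I f.
Proof.
move=> N0 nf f0 fz; have fi := csupp_integrable N0 nf.
have [cf _] := nf.
have fz2 : f z / 2 < f z by rewrite ltr_pdivrMr// mulr_natr mulr2n ltrDl.
have [r /= r0 Hr] := (nbhs_ballP _ _).1 (cvgr_gt _ (cf z) _ fz2).
pose s := r / 2.
have s0 : 0 < s by rewrite divr_gt0.
have mc := measurable_cube z s.
have mu : @lebesgue3 R (cube z s) = ((2 * s) ^+ 3)%:E.
  by apply: lebesgue3_cube; exact: ltW.
have Hs x : cube z s x -> f z / 2 <= f x.
  move=> /cubeP xs; apply/ltW/Hr; rewrite -ball_normE /= distrC (le_lt_trans xs)//.
  by rewrite ltr_pdivrMr// mulr_natr mulr2n ltrDl.
have Ki : (@lebesgue3 R).-integrable (cube z s) (EFin \o (cst (f z / 2) : R3 R -> R)).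
  apply: measurable_bounded_integrable => //.
  - by rewrite [ltLHS]mu ltry.
  - by exists `|f z / 2|; split; [exact: num_real|move=> M KM x _ /=; exact: ltW].
have ficube : (@lebesgue3 R).-integrable (cube z s) (EFin \o f).
  exact: integrableS fi.
apply: (@lt_le_trans _ _ (\int[@lebesgue3 R]_(x in cube z s) cst (f z / 2) x)).
  rewrite Rintegral_cst// [X in fine X]mu/= mulr_gt0 ?divr_gt0//.
  by rewrite exprn_gt0// mulr_gt0.
apply: (@le_trans _ _ (\int[@lebesgue3 R]_(x in cube z s) f x)).
  by apply: le_Rintegral => // x; exact: Hs.
rewrite [leLHS]Rintegral_mkcond; apply: le_Rintegral => //.
  rewrite -restrict_EFin; apply: (integrable_restrict _ mc measurableT _).1.
  by rewrite setTI.
by move=> x _; rewrite /patch; case: ifP.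
Qed.

Lemma csupp_integralZ N (c : R) f : 0 <= N -> csupp N f ->
  I (fun x => c * f x) = c * I f.
Proof. by move=> N0 nf; apply: RintegralZl => //; exact: csupp_integrable N0 nf. Qed.

Lemma csuppZ N (c : R) f : csupp N f -> csupp N (fun x => c * f x).
Proof. by move=> nf; apply: csuppMr => //; exact: cst_continuous. Qed.

Section mollify.
Variables (d : R) (b0 b1 b2 b3 : R -> R) (K : R).
Hypotheses (d0 : 0 < d) (K0 : 0 <= K).
Hypothesis D0 : forall x : R, is_derive x (1:R) b0 (b1 x).
Hypothesis D1 : forall x : R, is_derive x (1:R) b1 (b2 x).
Hypothesis D2 : forall x : R, is_derive x (1:R) b2 (b3 x).
Hypothesis cb2 : continuous b2.
Hypothesis b0K : forall t, `|b0 t| <= K.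
Hypothesis b3K : forall t, `|b3 t| <= K.
Hypothesis b0z : forall t, d < `|t| -> b0 t = 0.
Hypothesis b2z : forall t, d < `|t| -> b2 t = 0.

Definition mollifier (f g k : R -> R) z x :=
  f (x.1.1 - z.1.1) * g (x.1.2 - z.1.2) * k (x.2 - z.2).

Lemma continuous_mollifier (f g k : R -> R) z : continuous f -> continuous g ->
  continuous k -> continuous (mollifier f g k z).
Proof.
have sh (p : R3 R -> R) (c : R) (q : R -> R) : continuous p -> continuous q ->
    continuous (fun x => q (p x - c)).
  move=> cp cq x; apply: (@continuous_comp _ _ _ (fun x => p x - c) q).
    by apply: cvgB; [exact: cp|exact: cvg_cst].
  exact: cq.
move=> cf cg ck x; apply: cvgM; first apply: cvgM.
- exact: (sh _ _ _ continuous_coord1 cf).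
- exact: (sh _ _ _ continuous_coord2 cg).
- exact: (sh _ _ _ continuous_coord3 ck).
Qed.

Lemma mollifier_out (f g k : R -> R) z x : (forall t, d < `|t| -> f t = 0) ->
  (forall t, d < `|t| -> g t = 0) -> (forall t, d < `|t| -> k t = 0) ->
  d < `|x - z| -> mollifier f g k z x = 0.
Proof.
move=> fz gz kz; rewrite prod_normE [`|(x - z).1|]prod_normE !lt_max.
rewrite /mollifier => /orP[/orP[]|] h.
- by rewrite fz// !mul0r.
- by rewrite gz// mulr0 mul0r.
- by rewrite kz// mulr0.
Qed.

Let rho := mollifier b0 b0 b0.

Let c0 : continuous b0. Proof. exact: is_derive_continuous D0. Qed.

Lemma laplacian_mollifier z x : laplacian (rho z) x =
  mollifier b2 b0 b0 z x + mollifier b0 b2 b0 z x + mollifier b0 b0 b2 z x.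
Proof.
have sh (q dq : R -> R) (c a t : R) : (forall t : R, is_derive t (1:R) q (dq t)) ->
    is_derive (0:R) (1:R) (fun h : R => q (h * a + t - c)) (dq (t - c) * a).
  move=> qd; have Dl : is_derive (0:R) (1:R) (fun h : R => h * a + t - c) a.
    by apply: is_derive_eq; rewrite -![_ *: _]/(_ * _); ring.
  have Dq : is_derive (0 * a + t - c) (1:R) q (dq (t - c)).
    by rewrite mul0r add0r; exact: qd.
  exact: (@is_derive1_comp _ q _ 0 _ _ Dq Dl).
have D (f df g dg k dk : R -> R) y v : (forall t : R, is_derive t (1:R) f (df t)) ->
    (forall t : R, is_derive t (1:R) g (dg t)) -> (forall t : R, is_derive t (1:R) k (dk t)) ->
    is_derive y v (mollifier f g k z)
     (v.1.1 * mollifier df g k z y + v.1.2 * mollifier f dg k z y +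
      v.2 * mollifier f g dk z y).
  move=> fd gd kd; apply: (is_derive_line0 _ _ _ _).2; rewrite /mollifier/=.
  have Hf := sh _ _ z.1.1 v.1.1 y.1.1 fd.
  have Hg := sh _ _ z.1.2 v.1.2 y.1.2 gd.
  have Hk := sh _ _ z.2 v.2 y.2 kd.
  have Hfg : is_derive (0:R) (1:R)
      (fun t : R => f (t * v.1.1 + y.1.1 - z.1.1) * g (t * v.1.2 + y.1.2 - z.1.2))
      (df (y.1.1 - z.1.1) * v.1.1 * g (y.1.2 - z.1.2) +
       f (y.1.1 - z.1.1) * (dg (y.1.2 - z.1.2) * v.1.2)).
    have /is_derive_eq := is_deriveM Hf Hg; apply.
    by rewrite -![_ *: _]/(_ * _) !mul0r !add0r; ring.
  have /is_derive_eq := is_deriveM Hfg Hk; apply.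
  by rewrite -![_ *: _]/(_ * _) !mul0r !add0r; ring.
have DD v : 'D_v (rho z) = fun y => v.1.1 * mollifier b1 b0 b0 z y +
    v.1.2 * mollifier b0 b1 b0 z y + v.2 * mollifier b0 b0 b1 z y.
  by apply/funext => y; have [_ ->] := D _ _ _ _ _ _ y v D0 D0 D0.
rewrite /laplacian; congr (_ + _ + _).
- rewrite [X in 'D__ X _](_ : _ = mollifier b1 b0 b0 z).
    have [_ ->] := D _ _ _ _ _ _ x (1, 0, 0) D1 D0 D0.
    by rewrite /= mul1r !mul0r !addr0.
  by rewrite [LHS]DD; apply/funext => y /=; rewrite mul1r !mul0r !addr0.
- rewrite [X in 'D__ X _](_ : _ = mollifier b0 b1 b0 z).
    have [_ ->] := D _ _ _ _ _ _ x (0, 1, 0) D0 D1 D0.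
    by rewrite /= mul1r !mul0r !addr0 add0r.
  by rewrite [LHS]DD; apply/funext => y /=; rewrite mul1r !mul0r !addr0 add0r.
- rewrite [X in 'D__ X _](_ : _ = mollifier b0 b0 b1 z).
    have [_ ->] := D _ _ _ _ _ _ x (0, 0, 1) D0 D0 D1.
    by rewrite /= mul1r !mul0r !add0r.
  by rewrite [LHS]DD; apply/funext => y /=; rewrite mul1r !mul0r !add0r.
Qed.

Variables (m Kh : R) (h : R3 R -> R).
Hypotheses (m0 : 0 < m) (Kh0 : 0 <= Kh) (ch : continuous h).
Hypothesis hK : forall x, `|h x| <= Kh.
Hypothesis weak : forall z,
  I (fun x => h x * (- laplacian (rho z) x + m ^+ 2 * rho z x)) = 0.

Let H z := I (fun x => h x * rho z x).

Let rho_out z x : d < `|x - z| -> rho z x = 0.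
Proof. exact: mollifier_out. Qed.

Let crho z : continuous (rho z). Proof. exact: continuous_mollifier. Qed.

(** All the differencing is done on the mollifier, which is smooth, whereas [h] is
    merely continuous. *)
Lemma mollified_difference z e (t : R) (P : R3 R -> R) (C : R) :
  0 <= t -> `|e| <= 1 -> continuous P -> (forall x, d < `|x - z| -> P x = 0) ->
  (forall x, `|rho (z + t *: e) x + rho (z - t *: e) x - 2 * rho z x
     - t ^+ 2 * P x| <= C) ->
  `|H (z + t *: e) + H (z - t *: e) - 2 * H z - t ^+ 2 * I (fun x => h x * P x)|
    <= Kh * C * (2 * (d + t)) ^+ 3.
Proof.
move=> t0 e1 cP Pz HC; pose N := `|z| + (d + t).
have N0 : 0 <= N by rewrite !addr_ge0// ltW.
have te : `|t *: e| <= t by rewrite normrZ ger0_norm// ler_piMr.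
have nr z' : `|z - z'| <= t -> csupp N (fun x => h x * rho z' x).
  move=> zz'; apply: csuppMr => //; apply: csupp_cst_out => // x dx.
  apply: rho_out; have : `|x - z| <= `|x - z'| + `|z - z'|.
    rewrite [`|z - z'|]distrC.
    have -> : x - z = (x - z') + (z' - z) by rewrite addrA subrK.
    exact: ler_normD.
  lra.
have n1 : csupp N (fun x => h x * rho (z + t *: e) x).
  by apply: nr; rewrite opprD addrA subrr add0r normrN.
have n2 : csupp N (fun x => h x * rho (z - t *: e) x).
  by apply: nr; rewrite opprB addrC subrK.
have n3 : csupp N (fun x => h x * rho z x) by apply: nr; rewrite subrr normr0.
have n4 : csupp N (fun x => h x * P x).
  apply: csuppMr => //; apply: csupp_cst_out => // x dx; apply: Pz.
  by apply: le_lt_trans dx; rewrite lerDl.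
pose F x := h x * rho (z + t *: e) x + (h x * rho (z - t *: e) x +
  (-2 * (h x * rho z x) + - t ^+ 2 * (h x * P x))).
have nF : csupp N F by do 3 (apply: csuppD => //); apply: csuppZ.
have -> : H (z + t *: e) + H (z - t *: e) - 2 * H z - t ^+ 2 * I (fun x => h x * P x)
    = I F.
  have z3 := csuppZ (-2) n3; have z4 := csuppZ (- t ^+ 2) n4.
  rewrite /F (csupp_integralD N0 n1 (csuppD n2 (csuppD z3 z4))).
  rewrite (csupp_integralD N0 n2 (csuppD z3 z4)) (csupp_integralD N0 z3 z4).
  rewrite (csupp_integralZ _ N0 n3) (csupp_integralZ _ N0 n4) /H; ring.
have EF x : F x = h x * (rho (z + t *: e) x + rho (z - t *: e) x - 2 * rho z x
     - t ^+ 2 * P x) by rewrite /F; ring.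
apply: (@integral_cube_bound N z) => //; first by rewrite addr_ge0// ltW.
  by move=> x; rewrite EF normrM ler_pM.
move=> x dx.
have out z' : `|z - z'| <= t -> rho z' x = 0.
  move=> zz'; apply: rho_out; have : `|x - z| <= `|x - z'| + `|z - z'|.
    rewrite [`|z - z'|]distrC.
    have -> : x - z = (x - z') + (z' - z) by rewrite addrA subrK.
    exact: ler_normD.
  lra.
have op : rho (z + t *: e) x = 0.
  by apply: out; rewrite opprD addrA subrr add0r normrN.
have om : rho (z - t *: e) x = 0 by apply: out; rewrite opprB addrC subrK.
rewrite EF op om (out z) ?subrr ?normr0//.
by rewrite Pz; [ring|apply: le_lt_trans dx; rewrite lerDl].
Qed.

Lemma mollDE (f g k : R -> R) z e (t : R) x : mollifier f g k (z + t *: e) x =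
  f (x.1.1 - z.1.1 - t * e.1.1) * g (x.1.2 - z.1.2 - t * e.1.2) *
  k (x.2 - z.2 - t * e.2).
Proof. by rewrite /mollifier /= !opprD !addrA. Qed.

Lemma mollBE (f g k : R -> R) z e (t : R) x : mollifier f g k (z - t *: e) x =
  f (x.1.1 - z.1.1 + t * e.1.1) * g (x.1.2 - z.1.2 + t * e.1.2) *
  k (x.2 - z.2 + t * e.2).
Proof. by rewrite /mollifier /= !opprD !opprK !addrA. Qed.

(** At a near-maximum of the mollification all symmetric second differences are
    nearly nonpositive, whereas their sum is close to [m^2] times its value. *)
Lemma mollified_le0 z : H z <= 0.
Proof.
pose e1 : R3 R := (1, 0, 0); pose e2 : R3 R := (0, 1, 0); pose e3 : R3 R := (0, 0, 1).
pose P1 z := mollifier b2 b0 b0 z.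
pose P2 z := mollifier b0 b2 b0 z.
pose P3 z := mollifier b0 b0 b2 z.
have ne : [/\ `|e1| <= 1, `|e2| <= 1 & `|e3| <= 1].
  by rewrite /e1 /e2 /e3 !prod_normE/= !normr0 !normr1 !ge_max !lexx !ler01.
pose C t := 2 * K * t ^+ 3 * K * K.
have diff z' (t : R) : 0 <= t -> t <= d -> exists2 E, `|E| <= 3 * (Kh * C t * (2 * (d + d)) ^+ 3) &
    t ^+ 2 * (m ^+ 2 * H z') + E =
    (H (z' + t *: e1) + H (z' - t *: e1) - 2 * H z') +
    (H (z' + t *: e2) + H (z' - t *: e2) - 2 * H z') +
    (H (z' + t *: e3) + H (z' - t *: e3) - 2 * H z').
  move=> t0 td; have [n1 n2 n3] := ne.
  have SD s : `|b0 (s + t) + b0 (s - t) - 2 * b0 s - t ^+ 2 * b2 s| <= 2 * K * t ^+ 3.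
    exact: second_difference D0 D1 D2 b3K.
  have SD0 : 0 <= 2 * K * t ^+ 3 by rewrite !mulr_ge0// exprn_ge0.
  have prod3 (p q r : R) : `|p| <= 2 * K * t ^+ 3 -> `|q| <= K -> `|r| <= K ->
      `|p * q * r| <= C t.
    move=> pb qb rb; rewrite !normrM /C.
    have pq : `|p| * `|q| <= 2 * K * t ^+ 3 * K by apply: ler_pM.
    by apply: ler_pM; rewrite ?mulr_ge0.
  have A1 := @mollified_difference z' e1 t (P1 z') (C t) t0 n1 _ _ _.
  have A2 := @mollified_difference z' e2 t (P2 z') (C t) t0 n2 _ _ _.
  have A3 := @mollified_difference z' e3 t (P3 z') (C t) t0 n3 _ _ _.
  have lap : m ^+ 2 * H z' = I (fun x => h x * P1 z' x) + I (fun x => h x * P2 z' x) +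
      I (fun x => h x * P3 z' x).
    pose N := `|z'| + d; have N0 : 0 <= N by rewrite addr_ge0// ltW.
    have nP1 : csupp N (fun x => h x * P1 z' x).
      apply: csuppMr => //; apply: csupp_cst_out; first exact: continuous_mollifier.
      by move=> x; exact: mollifier_out.
    have nP2 : csupp N (fun x => h x * P2 z' x).
      apply: csuppMr => //; apply: csupp_cst_out; first exact: continuous_mollifier.
      by move=> x; exact: mollifier_out.
    have nP3 : csupp N (fun x => h x * P3 z' x).
      apply: csuppMr => //; apply: csupp_cst_out; first exact: continuous_mollifier.
      by move=> x; exact: mollifier_out.
    have nr : csupp N (fun x => h x * rho z' x).
      by apply: csuppMr => //; apply: csupp_cst_out => // x; exact: rho_out.
    have := weak z'.
    have -> : I (fun x => h x * (- laplacian (rho z') x + m ^+ 2 * rho z' x)) =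
        I (fun x => m ^+ 2 * (h x * rho z' x) + (-1 * (h x * P1 z' x) +
          (-1 * (h x * P2 z' x) + -1 * (h x * P3 z' x)))).
      by apply: eq_Rintegral => x _; rewrite laplacian_mollifier /P1 /P2 /P3; ring.
    have z1 := csuppZ (-1) nP1; have z2 := csuppZ (-1) nP2; have z3 := csuppZ (-1) nP3.
    rewrite (csupp_integralD N0 (csuppZ _ nr) (csuppD z1 (csuppD z2 z3))).
    rewrite (csupp_integralD N0 z1 (csuppD z2 z3)) (csupp_integralD N0 z2 z3).
    rewrite (csupp_integralZ _ N0 nr) (csupp_integralZ _ N0 nP1).
    rewrite (csupp_integralZ _ N0 nP2) (csupp_integralZ _ N0 nP3) -/(H z'); lra.
  have vol : (2 * (d + t)) ^+ 3 <= (2 * (d + d)) ^+ 3.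
    by rewrite lerXn2r ?nnegrE ?mulr_ge0 ?addr_ge0 ?(ltW d0)// ler_pM2l// lerD2l.
  have CV : Kh * C t * (2 * (d + t)) ^+ 3 <= Kh * C t * (2 * (d + d)) ^+ 3.
    by rewrite ler_wpM2l// mulr_ge0// /C !mulr_ge0// exprn_ge0.
  exists ((H (z' + t *: e1) + H (z' - t *: e1) - 2 * H z' - t ^+ 2 * I (fun x => h x * P1 z' x)) +
    (H (z' + t *: e2) + H (z' - t *: e2) - 2 * H z' - t ^+ 2 * I (fun x => h x * P2 z' x)) +
    (H (z' + t *: e3) + H (z' - t *: e3) - 2 * H z' - t ^+ 2 * I (fun x => h x * P3 z' x))).
    apply: (le_trans (ler_normD _ _)).
    apply: (le_trans (lerD (ler_normD _ _) (lexx _))).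
    have -> : forall a : R, 3 * a = a + a + a by move=> a; ring.
    rewrite !lerD//; apply: le_trans CV.
    - apply: A1; [exact: continuous_mollifier|by move=> x; exact: mollifier_out|].
      move=> x; rewrite /rho mollDE mollBE /P1 /mollifier/= !mulr1 !mulr0 !subr0 !addr0.
      set a := x.1.1 - _; set b := b0 (x.1.2 - _); set c := b0 (x.2 - _).
      have -> : b0 (a - t) * b * c + b0 (a + t) * b * c - 2 * (b0 a * b * c) -
          t ^+ 2 * (b2 a * b * c) =
          (b0 (a + t) + b0 (a - t) - 2 * b0 a - t ^+ 2 * b2 a) * b * c by ring.
      by apply: prod3; [exact: SD|exact: b0K|exact: b0K].
    - apply: A2; [exact: continuous_mollifier|by move=> x; exact: mollifier_out|].
      move=> x; rewrite /rho mollDE mollBE /P2 /mollifier/= !mulr1 !mulr0 !subr0 !addr0.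
      set a := x.1.2 - _; set b := b0 (x.1.1 - _); set c := b0 (x.2 - _).
      have -> : b * b0 (a - t) * c + b * b0 (a + t) * c - 2 * (b * b0 a * c) -
          t ^+ 2 * (b * b2 a * c) =
          (b0 (a + t) + b0 (a - t) - 2 * b0 a - t ^+ 2 * b2 a) * b * c by ring.
      by apply: prod3; [exact: SD|exact: b0K|exact: b0K].
    - apply: A3; [exact: continuous_mollifier|by move=> x; exact: mollifier_out|].
      move=> x; rewrite /rho mollDE mollBE /P3 /mollifier/= !mulr1 !mulr0 !subr0 !addr0.
      set a := x.2 - _; set b := b0 (x.1.1 - _); set c := b0 (x.1.2 - _).
      have -> : b * c * b0 (a - t) + b * c * b0 (a + t) - 2 * (b * c * b0 a) -
          t ^+ 2 * (b * c * b2 a) =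
          (b0 (a + t) + b0 (a - t) - 2 * b0 a - t ^+ 2 * b2 a) * b * c by ring.
      by apply: prod3; [exact: SD|exact: b0K|exact: b0K].
  rewrite lap; move: (H z') => Hz'; set i1 := I _; set i2 := I _; set i3 := I _; ring.
have Hbound y : H y <= Kh * (K * K * K) * (2 * d) ^+ 3.
  apply: (le_trans (ler_norm _)).
  have N0 : 0 <= `|y| + d by rewrite addr_ge0// ltW.
  apply: (@integral_cube_bound (`|y| + d) y) => //.
  - exact: ltW.
  - by apply: csuppMr => //; apply: csupp_cst_out => // x; exact: rho_out.
  - move=> x; rewrite normrM ler_pM// /rho /mollifier !normrM;
    by apply: ler_pM; rewrite ?mulr_ge0//; apply: ler_pM; rewrite ?mulr_ge0.
  - by move=> x /rho_out ->; rewrite mulr0.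
rewrite leNgt; apply/negP => Hz.
pose S := [set H y | y in [set: R3 R]].
have supS : has_sup S.
  split; first by exists (H z), z.
  by exists (Kh * (K * K * K) * (2 * d) ^+ 3) => _ [y _ <-].
have S0 : 0 < sup S.
  by apply: (lt_le_trans Hz); apply: sup_upper_bound => //; exists z.
have HS y : H y <= sup S by apply: sup_upper_bound => //; exists y.
pose A := 3 * (Kh * (2 * K * K * K) * (2 * (d + d)) ^+ 3).
have A0 : 0 <= A.
  by rewrite /A !mulr_ge0// ?addr_ge0// (ltW d0).
have m20 : 0 < m ^+ 2 by rewrite exprn_gt0.
(* a step so short that the cubic error is negligible against the quadratic term *)
pose t := Num.min d (m ^+ 2 * sup S / (4 * (A + 1))).
have A1 : 0 < A + 1 by rewrite ltr_wpDl.
have t0 : 0 < t by rewrite /t lt_min d0 divr_gt0// ?mulr_gt0.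
have td : t <= d by rewrite /t ge_min lexx.
have tA : A * t <= m ^+ 2 * sup S / 4.
  have : t <= m ^+ 2 * sup S / (4 * (A + 1)) by rewrite /t ge_min lexx orbT.
  rewrite ler_pdivlMr ?mulr_gt0// => h1.
  rewrite ler_pdivlMr//; have : 0 <= t * 4 by rewrite mulr_ge0// ltW.
  by nra.
pose eta := t ^+ 2 * m ^+ 2 * sup S / (4 * (6 + t ^+ 2 * m ^+ 2)).
have q0 : 0 < t ^+ 2 * m ^+ 2 by rewrite mulr_gt0// exprn_gt0.
have eta0 : 0 < eta.
  by rewrite /eta divr_gt0 ?mulr_gt0// addr_gt0.
have [_ [y _ <-] ySe] := sup_adherent eta0 supS.
have [E HE EE] := diff y t (ltW t0) td.
have etaE : (6 + t ^+ 2 * m ^+ 2) * eta = t ^+ 2 * m ^+ 2 * sup S / 4.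
  have : 6 + t ^+ 2 * m ^+ 2 != 0 by rewrite gt_eqF// addr_gt0.
  rewrite /eta; move: (t ^+ 2 * m ^+ 2) (sup S) => p q p0; field.
  by [].
have HE2 : `|E| <= t ^+ 2 * (A * t).
  by apply: (le_trans HE); rewrite le_eqVlt; apply/orP; left; apply/eqP; rewrite /C /A; ring.
have t20 : 0 < t ^+ 2 by rewrite exprn_gt0.
have tA2 : t ^+ 2 * (A * t) <= t ^+ 2 * (m ^+ 2 * sup S / 4) by rewrite ler_wpM2l// ltW.
have b1' := HS (y + t *: e1); have b1'' := HS (y - t *: e1).
have b2' := HS (y + t *: e2); have b2'' := HS (y - t *: e2).
have b3' := HS (y + t *: e3); have b3'' := HS (y - t *: e3).
have low : t ^+ 2 * (m ^+ 2 * (sup S - eta)) <= t ^+ 2 * (m ^+ 2 * H y).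
  by rewrite ler_pM2l// ler_pM2l// ltW.
have := ler_norm (- E); rewrite normrN => NE.
have : 0 < t ^+ 2 * m ^+ 2 * sup S by rewrite mulr_gt0.
have -> : t ^+ 2 * m ^+ 2 * sup S = t ^+ 2 * (m ^+ 2 * sup S) by ring.
move: etaE low tA2; rewrite mulrBr mulrBr.
have -> : t ^+ 2 * m ^+ 2 * sup S / 4 = t ^+ 2 * (m ^+ 2 * sup S) / 4 by ring.
have -> : t ^+ 2 * (m ^+ 2 * sup S / 4) = t ^+ 2 * (m ^+ 2 * sup S) / 4 by ring.
have -> : (6 + t ^+ 2 * m ^+ 2) * eta = 6 * eta + t ^+ 2 * (m ^+ 2 * eta) by ring.
lra.
Qed.


End mollify.
(** Were [h] positive somewhere, so would be its mollification at a small scale,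
    contrary to [mollified_le0]. Applied to [- h] as well, this gives [h = 0]. *)
Lemma weak_solution_le0 (m : R) (h : R3 R -> R) : 0 < m -> continuous h ->
  (exists K : R, forall x, `|h x| <= K) ->
  distributional_solution m h (fun=> 0) -> forall z, h z <= 0.
Proof.
move=> m0 ch [Kh hK] weak z; rewrite leNgt; apply/negP => hz.
have Kh0 : 0 <= Kh by exact: le_trans (hK 0).
have [r /= r0 Hr] := (nbhs_ballP _ _).1 (cvgr_gt _ (ch z) _ hz).
pose d := r / 2.
have d0 : 0 < d by rewrite divr_gt0.
pose b0 := bump d.
have b0ge t : 0 <= b0 t by exact: bump_ge0.
have b00 : 0 < b0 0 by exact: bump0_gt0.
have [c0 H0] := CkS_elim (Ck_bump 3 d).
have [D0 C1] := H0 (1:R).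
have [c1 H1] := CkS_elim C1; have [D1 C2] := H1 (1:R).
have [c2 H2] := CkS_elim C2; have [D2 C3] := H2 (1:R).
set b1 := (fun x : R => 'D_1 b0 x) in D0 D1.
set b2 := (fun x : R => 'D_1 b1 x) in D1 D2 c2.
set b3 := (fun x : R => 'D_1 b2 x) in D2.
have c3 : continuous b3 by exact: Ck_continuous C3.
have b0z (t : R) : d < `|t| -> b0 t = 0 by move=> dt; apply: bump_eq0; exact: ltW.
have dz (f df : R -> R) : (forall x : R, is_derive x (1:R) f (df x)) ->
    (forall t, d < `|t| -> f t = 0) -> forall t, d < `|t| -> df t = 0.
  move=> fd f0 t dt; have [_ <-] := fd t.
  rewrite (@near_eq_derive _ _ _ f (cst 0)) ?derive_cst//.
  have cn : {for t, continuous (fun y : R => `|y|)} by exact: norm_continuous.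
  by apply: filterS (cvgr_gt _ cn _ dt) => y; exact: f0.
have b1z := dz _ _ D0 b0z; have b2z := dz _ _ D1 b1z; have b3z := dz _ _ D2 b2z.
have bd (f : R -> R) : continuous f -> (forall t, d < `|t| -> f t = 0) ->
    exists2 K, 0 <= K & forall t, `|f t| <= K.
  move=> cf f0; have [K K0 HK] := bounded_on_segment (- d) d cf.
  exists K => // t; have [td|td] := leP `|t| d; first by apply: HK; rewrite -ler_norml.
  by rewrite f0// normr0.
have [K0 K00 HK0] := bd _ c0 b0z; have [K3 K30 HK3] := bd _ c3 b3z.
pose K := Num.max K0 K3.
have KK : 0 <= K by rewrite /K le_max K00.
have test y : test_function (mollifier b0 b0 b0 y).
  split.
    move=> n; apply: CkM; first apply: CkM.
    - apply: (@Ck_affine _ _ n (fun x : R3 R => x.1.1) b0 (- y.1.1)) => //.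
        exact: continuous_coord1.
      exact: Ck_bump.
    - apply: (@Ck_affine _ _ n (fun x : R3 R => x.1.2) b0 (- y.1.2)) => //.
        exact: continuous_coord2.
      exact: Ck_bump.
    - apply: (@Ck_affine _ _ n (fun x : R3 R => x.2) b0 (- y.2)) => //.
        exact: continuous_coord3.
      exact: Ck_bump.
  pose J (t : R) : set R := [set` `[t - d, t + d]].
  have cJ t : compact (J t) by exact: segment_compact.
  have cc : compact ((J y.1.1 `*` J y.1.2) `*` J y.2).
    by apply: compact_setX => //; exact: compact_setX.
  apply: (subclosed_compact _ cc); first exact: closed_closure.
  have hsd : hausdorff_space (R3 R) by exact: norm_hausdorff.
  rewrite [X in _ `<=` X](closure_id _).1; last exact: compact_closed.
  apply: closure_subset => x /= nx; apply/cubeP; rewrite leNgt; apply/negP => dx.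
  by move/eqP: nx; apply; exact: (mollifier_out b0z b0z b0z dx).
have weak' y : \int[@lebesgue3 R]_x (h x * (- laplacian (mollifier b0 b0 b0 y) x +
    m ^+ 2 * mollifier b0 b0 b0 y x)) = 0.
  rewrite (weak _ (test y)); under eq_Rintegral do rewrite mul0r.
  by rewrite /Rintegral integral0.
have := @mollified_le0 d b0 b1 b2 b3 K d0 KK D0 D1 D2 c2 _ _ b0z b2z m Kh h m0 Kh0 ch hK weak' z.
have b0K t : `|b0 t| <= K by rewrite le_max HK0.
have b3K t : `|b3 t| <= K by rewrite le_max HK3 orbT.
move=> /(_ b0K b3K); apply/negP; rewrite -ltNge.
have cm : continuous (mollifier b0 b0 b0 z) by exact: continuous_mollifier.
apply: (@integral_gt0 (`|z| + d) z).
- by rewrite addr_ge0// ltW.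
- apply: csuppMr => //; apply: csupp_cst_out => // x; exact: mollifier_out.
- move=> x; have [xd|xd] := leP `|x - z| d; last by rewrite (mollifier_out _ _ _ xd)// mulr0.
  apply: mulr_ge0; last by rewrite /mollifier; do 2 (apply: mulr_ge0; last exact: b0ge); exact: b0ge.
  apply/ltW/Hr; rewrite -ball_normE/= distrC (le_lt_trans xd)//.
  by rewrite ltr_pdivrMr// mulr_natr mulr2n ltrDl.
- apply: mulr_gt0 => //; rewrite /mollifier !subrr.
  by do 2 (apply: mulr_gt0; last exact: b00); exact: b00.
Qed.

End weak_uniqueness.

(** * Decaying radial solutions *)

Section decaying_modes.
Context {R : realType}.
Implicit Types (x : R3 R) (f V v w : R3 R -> R).
Local Notation weight := (@X1_weight R).

Lemma X1_weight_sqr x : weight x ^+ 2 = 1 + enorm x ^+ 2.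
Proof. by rewrite sqr_sqrtr// addr_ge0// sqr_ge0. Qed.

Lemma X1_weight_ge1 x : 1 <= weight x.
Proof. by rewrite -[leLHS]sqrtr1 ler_sqrt ?lerDl ?sqr_ge0// addr_ge0// sqr_ge0. Qed.

Lemma X1_weight_gt0 x : 0 < weight x.
Proof. exact: lt_le_trans (X1_weight_ge1 x). Qed.

Lemma enorm_le_weight x : enorm x <= weight x.
Proof.
rewrite -(ler_sqr (enorm_ge0 x)) ?nnegrE ?(ltW (X1_weight_gt0 x))//.
by rewrite X1_weight_sqr lerDr.
Qed.

Lemma X1_weight_le x : weight x <= 1 + enorm x.
Proof.
have e0 := enorm_ge0 x.
rewrite -(ler_sqr (ltW (X1_weight_gt0 x))) ?nnegrE ?addr_ge0//.
by rewrite X1_weight_sqr; nra.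
Qed.

Lemma X1_radial (u : X1 R) : radial u.
Proof. by have := X1_funP u; rewrite inE => -[]. Qed.

Lemma X1_continuous (u : X1 R) : continuous u.
Proof. by have := X1_funP u; rewrite inE => -[]. Qed.

Lemma X1_has_sup (u : X1 R) : has_sup (range (fun x => weight x * `|u x|)).
Proof.
split; first by exists (weight 0 * `|u 0|), 0.
by have := X1_funP u; rewrite inE => -[].
Qed.

Lemma X1_norm_ub (u : X1 R) x : weight x * `|u x| <= `|u|.
Proof. by apply: sup_upper_bound; [exact: X1_has_sup|exists x]. Qed.

Lemma X1_norm_le (u : X1 R) (M : R) :
  (forall x, weight x * `|u x| <= M) -> `|u| <= M.
Proof.
move=> uM; apply: ge_sup; first by case: (X1_has_sup u).
by move=> _ [x _ <-].
Qed.

Lemma X1_exists v (M : R) : radial v -> continuous v ->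
  (forall x, weight x * `|v x| <= M) ->
  exists2 u : X1 R, X1_fun u = v & `|u| <= M.
Proof.
move=> rv cv vM.
have vX : v \in @X1_pred R.
  by rewrite inE; split => //; exists M => _ [x _ <-].
by exists (MkX1 vX) => //; exact: X1_norm_le.
Qed.

Lemma radial_axis v x : radial v -> v x = v (enorm x, 0, 0).
Proof. by move=> rv; apply: rv; rewrite enorm_axis ger0_norm// enorm_ge0. Qed.

Lemma continuous_axis v : continuous v -> continuous (fun r : R => v (r, 0, 0)).
Proof.
move=> cv r; apply: (@continuous_comp _ _ _ (fun r : R => (r, 0, 0) : R3 R) v).
  have -> : (fun r : R => (r, 0, 0) : R3 R) = fun r => r *: ((1, 0, 0) : R3 R).
    apply/funext => t; congr (_, _, _); rewrite /= -?[_ *: _]/(_ * _) ?mulr1 ?mulr0//.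
  by apply: cvgZ; [exact: cvg_id|exact: cvg_cst].
exact: cv.
Qed.

Lemma X1_weight_axis (r : R) : weight (r, 0, 0) ^+ 2 = 1 + r ^+ 2.
Proof. by rewrite X1_weight_sqr enorm_axis real_normK// num_real. Qed.

(** [B] bounds the norm in [X1]; the derivatives may grow with [q], which stands for
    the square of a frequency. *)
Definition radial_mode (q B : R) v := exists d1 d2,
  [/\ is_C2 v d1 d2, radial v, forall x, weight x * `|v x| <= B &
    forall X, 0 <= X -> C2_bound v d1 d2 X ((1 + q) * (1 + X) * B)].

Lemma radial_mode_le (q B q' B' : R) v : 0 <= q -> q <= q' -> B <= B' ->
  radial_mode q B v -> radial_mode q' B' v.
Proof.
move=> q0 qq BB [d1 [d2 [vC rv vB vX]]]; exists d1, d2; split => //.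
  by move=> x; exact: le_trans BB.
have B0 : 0 <= B.
  by apply: le_trans (vB 0); rewrite mulr_ge0// ltW// X1_weight_gt0.
move=> X X0 x xX; have [b0 b1 b2] := vX X X0 x xX.
have le : (1 + q) * (1 + X) * B <= (1 + q') * (1 + X) * B'.
  by rewrite ler_pM ?mulr_ge0 ?addr_ge0// ler_wpM2r ?addr_ge0// lerD2l.
split; first exact: le_trans le.
- by move=> z; apply: (le_trans (b1 z)); rewrite ler_wpM2r.
- by move=> z w; apply: (le_trans (b2 z w)); rewrite ler_wpM2r// mulr_ge0.
Qed.

(** Boundedness of [y] gives decay like [1 / r] of [v = y / r], and boundedness of [dy]
    gives [|y r| <= M * r], which controls [v] near the origin. *)
Lemma radial_solution (Q f y dy : R -> R) (M q P : R) :
  continuous Q -> continuous f -> y 0 = 0 ->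
  (forall r : R, is_derive r (1:R) y (dy r)) ->
  (forall r : R, is_derive r (1:R) dy (Q r * y r + - (r * f r))) ->
  (forall r, 0 <= r -> `|y r| <= M /\ `|dy r| <= M) ->
  (forall r, 0 <= r -> `|Q r| <= q) -> (forall r, 0 <= r -> `|f r| <= P) ->
  exists v, [/\ radial_mode q (20 * (2 * M + P)) v, v 0 = dy 0,
    forall r : R, 0 < r -> v (r, 0, 0) = y r / r &
    forall x, laplacian v x = Q (enorm x) * v x - f (enorm x)].
Proof.
move=> cQ cf y0 ydy dyddy yM Qq fP.
pose p := profile y dy.
have cdy : continuous dy by exact: is_derive_continuous dyddy.
have cy : continuous y by exact: is_derive_continuous ydy.
have pE r : y r = r * p r.
  rewrite /p /profile; case: eqVneq => [->|r0]; first by rewrite y0 mul0r.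
  by field.
have cp : continuous p.
  move=> r; have [->|r0] := eqVneq r 0; last first.
    exact: is_derive1_continuous_at (is_derive_profile (cst 0) ydy r0).
  apply/cvgrPdist_le => e e0.
  have /cvgrPdist_le/(_ _ e0)[d /= d0 Hd] := cdy 0.
  exists d => //= s; rewrite /ball_/= sub0r normrN => sd.
  rewrite distrC /p /profile eqxx; have [s0|s0] := eqVneq s 0.
    by rewrite subrr normr0 ltW.
  pose K t := y t - t * dy 0.
  have dK (t : R) : is_derive t (1:R) K (dy t - dy 0).
    rewrite /K; have h1 := ydy t.
    by apply: is_derive_eq; rewrite -![_ *: _]/(_ * _); ring.
  have := @derive_bound0 _ K _ e s dK; rewrite /K y0 mul0r !subr0 => H.
  have -> : y s / s - dy 0 = (y s - s * dy 0) / s by field.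
  rewrite normrM normfV ler_pdivrMr ?normr_gt0// H// => t _ ts.
  rewrite distrC; apply: Hd => /=.
  by rewrite /ball_/= sub0r normrN (le_lt_trans ts).
pose F r := Q r * p r - f r.
have cF : continuous F.
  by move=> r; apply: cvgB; [apply: cvgM; [exact: cQ|exact: cp]|exact: cf].
have dyF (r : R) : is_derive r (1:R) dy (r * F r).
  have -> : r * F r = Q r * y r + - (r * f r) by rewrite /F pE; ring.
  exact: dyddy.
have M0 : 0 <= M by rewrite (le_trans _ (yM 0 _).1).
have q0 : 0 <= q by rewrite (le_trans _ (Qq 0 _)).
have P0 : 0 <= P by rewrite (le_trans _ (fP 0 _)).
have py r : 0 <= r -> `|p r| <= M.
  move=> r0; rewrite /p /profile; case: eqVneq => [_|rn0]; first exact: (yM 0 _).2.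
  rewrite normrM normfV ler_pdivrMr ?normr_gt0// (ger0_norm r0).
  have := @derive_bound _ y dy 0 r M ydy r0; rewrite y0 !subr0; apply => s /andP[s0 _].
  by have [] := yM _ s0.
have pM r : 0 <= r -> (1 + r) * `|p r| <= 2 * M.
  move=> r0; rewrite mulrDl mul1r mulrDl mul1r lerD ?py//.
  by rewrite -{1}(ger0_norm r0) -normrM -pE; have [] := yM _ r0.
have FP r : 0 <= r -> `|F r| <= q * (2 * M) + P.
  move=> r0; rewrite /F (le_trans (ler_normB _ _))// lerD ?fP//.
  rewrite normrM ler_pM ?Qq// (le_trans (py _ r0))//.
  by rewrite mulr_natl mulr2n lerDl.
have vw x : weight x * `|p (enorm x)| <= 2 * M.
  apply: le_trans (pM _ (enorm_ge0 x)).
  by rewrite ler_wpM2r// X1_weight_le.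
exists (fun x => p (enorm x)); split.
- exists (radial_d1 y dy F), (radial_d2 y dy F); split.
  + exact: radial_is_C2.
  + by move=> x z ->.
  + by move=> x; apply: (le_trans (vw x)); lra.
  move=> X X0.
  have B := @radial_C2_bound _ y dy F y0 ydy dyF X (q * (2 * M) + P) M X0 M0 py.
  have le : M + 20 * (1 + X) * (q * (2 * M) + P) <=
      (1 + q) * (1 + X) * (20 * (2 * M + P)).
    have a1 : 0 <= X * M by rewrite mulr_ge0.
    have a2 : 0 <= q * P by rewrite mulr_ge0.
    have a3 : 0 <= X * (q * P) by rewrite mulr_ge0.
    nra.
  move=> x xX; have [|b0 b1 b2] := B _ x xX; first by move=> r /andP[r0 _]; exact: FP.
  split; first exact: le_trans le.
  + by move=> v; apply: (le_trans (b1 v)); rewrite ler_wpM2r.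
  + by move=> v w; apply: (le_trans (b2 v w)); rewrite ler_wpM2r// mulr_ge0.
- have -> : enorm (0 : R3 R) = 0 by apply/eqP; rewrite enorm_eq0.
  by rewrite /p /profile eqxx.
- by move=> r r0; rewrite enorm_axis gtr0_norm// /p /profile gt_eqF.
- by move=> x; rewrite (laplacian_radial y0 ydy dyF cF).
Qed.

(** For [mu] bounded away from zero every solution of the initial value problem at
    the origin decays like [1 / r], so that its value [p] there may be prescribed. *)
Lemma oscillatory_modes (mu1 CV : R) : 0 < mu1 -> 0 <= CV ->
  exists2 C : R, 0 <= C & forall (mu p B : R) V f,
  mu1 <= mu -> 0 <= B -> radial V -> continuous V -> radial f -> continuous f ->
  (forall x, weight x ^+ 2 * `|V x| <= CV) ->
  (forall x, weight x ^+ 3 * `|f x| <= B) ->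
  exists v, [/\ radial_mode (mu ^+ 2 + CV) (C * (B + `|p|)) v, v 0 = p &
    forall x, laplacian v x = - (mu ^+ 2 + V x) * v x - f x].
Proof.
move=> mu10 CV0; have [K K0 HK] := oscillatory_bound mu10 CV0.
pose M0 := K * (1 + mu1^-1).
have M00 : 0 <= M0 by rewrite mulr_ge0// addr_ge0// invr_ge0 ltW.
exists (20 * (2 * M0 + 1)); first by rewrite mulr_ge0// addr_ge0// mulr_ge0.
move=> mu p B V f mumu B0 rV cV rf cf VC fB.
have mu0 : 0 < mu by exact: lt_le_trans mumu.
pose V0 r := V (r, 0, 0); pose f0 r := f (r, 0, 0).
have cV0 : continuous V0 by exact: continuous_axis.
have cf0 : continuous f0 by exact: continuous_axis.
pose Q r := - (mu ^+ 2 + V0 r).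
have cQ : continuous Q.
  by move=> r; apply: cvgN; apply: cvgD; [exact: cvg_cst|exact: cV0].
have cg : continuous (fun r : R => - (r * f0 r)).
  by move=> r; apply: cvgN; apply: cvgM; [exact: cvg_id|exact: cf0].
have [y [dy [y0 dy0 ydy dyddy]]] := linear_ivp 0 0 p cQ cg.
have V0C r : `|V0 r| <= CV / (1 + r ^+ 2).
  by rewrite ler_pdivlMr ?ltr_pwDl ?sqr_ge0// mulrC -X1_weight_axis.
have V0C' r : `|V0 r| <= CV.
  rewrite (le_trans (V0C r))// ler_pdivrMr ?ltr_pwDl ?sqr_ge0// ler_peMr//.
  by rewrite lerDl sqr_ge0.
have f0B' r : `|f0 r| <= B.
  apply: le_trans (fB (r, 0, 0)); rewrite ler_peMl// -/weight exprn_ege1//.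
  exact: X1_weight_ge1.
have f0B r : 0 <= r -> `|r * f0 r| <= B / (1 + r ^+ 2).
  move=> r0; rewrite ler_pdivlMr ?ltr_pwDl ?sqr_ge0// mulrC -X1_weight_axis.
  apply: le_trans (fB (r, 0, 0)); rewrite normrM [_ ^+ 3]exprSr -mulrA.
  rewrite ler_wpM2l ?sqr_ge0// ler_wpM2r//.
  by apply: le_trans (enorm_le_weight _); rewrite enorm_axis.
have b := HK mu p B V0 (fun r => r * f0 r) y dy mumu B0 (fun r _ => V0C r) f0B y0 dy0 ydy dyddy.
have Bp0 : 0 <= B + `|p| by rewrite addr_ge0.
have yM r : 0 <= r -> `|y r| <= M0 * (B + `|p|) /\ `|dy r| <= M0 * (B + `|p|).
  move=> r0; have [b1 b2] := b r r0.
  have k1 : 0 <= K * (B + `|p|) by rewrite mulr_ge0.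
  have i1 : 0 <= mu1^-1 by rewrite invr_ge0 ltW.
  have -> : M0 * (B + `|p|) = K * (B + `|p|) * (1 + mu1^-1) by rewrite /M0; ring.
  split; last by rewrite (le_trans b2)// ler_peMr// lerDl.
  apply: (@le_trans _ _ (K * (B + `|p|) * mu1^-1)); last by rewrite ler_wpM2l// lerDr.
  rewrite ler_pdivlMr// mulrC; apply: le_trans b1.
  by rewrite ler_wpM2r.
have Qq r : `|Q r| <= mu ^+ 2 + CV.
  rewrite /Q normrN (le_trans (ler_normD _ _))// lerD ?V0C'//.
  by rewrite ger0_norm// sqr_ge0.
have [v [vm v0 _ lv]] := @radial_solution Q f0 y dy (M0 * (B + `|p|)) (mu ^+ 2 + CV) B
  cQ cf0 y0 ydy dyddy yM (fun r _ => Qq r) (fun r _ => f0B' r).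
have le : 20 * (2 * (M0 * (B + `|p|)) + B) <= 20 * (2 * M0 + 1) * (B + `|p|).
  have := normr_ge0 p; nra.
have q0 : 0 <= mu ^+ 2 + CV by rewrite addr_ge0// sqr_ge0.
exists v; split; first exact: radial_mode_le vm.
  by rewrite v0.
by move=> x; rewrite lv /Q /f0 /V0 -(radial_axis x rV) -(radial_axis x rf).
Qed.


(** At frequency zero the bounded solutions on a half line form a line spanned by
    some [y1]; if the kernel is trivial then [y1 0 != 0], so that a multiple of
    [y1] corrects the value at the origin of any bounded solution. *)
Lemma zero_modes (m CV : R) V : 0 < m -> 0 <= CV -> radial V -> continuous V ->
  (forall x, weight x ^+ 2 * `|V x| <= CV) ->
  (forall B v, radial_mode (m ^+ 2 + CV) B v ->
     (forall x, laplacian v x = (m ^+ 2 - V x) * v x) -> forall x, v x = 0) ->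
  exists2 C : R, 0 <= C & forall (B : R) f,
  0 <= B -> radial f -> continuous f -> (forall x, weight x ^+ 3 * `|f x| <= B) ->
  exists v, radial_mode (m ^+ 2 + CV) (C * B) v /\
    forall x, laplacian v x = (m ^+ 2 - V x) * v x - f x.
Proof.
move=> m0 CV0 rV cV VC ker.
pose V0 r := V (r, 0, 0).
have cV0 : continuous V0 by exact: continuous_axis.
have m20 : 0 < m ^+ 2 by rewrite exprn_gt0.
have V0C r : `|V0 r| * (1 + r ^+ 2) <= CV by rewrite mulrC -X1_weight_axis.
have V0C' r : `|V0 r| <= CV.
  by rewrite (le_trans _ (V0C r))// ler_peMr// lerDl sqr_ge0.
pose Q r := m ^+ 2 - V0 r.
have cQ : continuous Q.
  by move=> r; apply: cvgB; [exact: cvg_cst|exact: cV0].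
have Qq r : `|Q r| <= m ^+ 2 + CV.
  by rewrite (le_trans (ler_normB _ _))// lerD// ger0_norm// ltW.
have q0 : 0 <= m ^+ 2 + CV by rewrite addr_ge0// ltW.
pose r0 := CV / (m ^+ 2 / 2) + 1.
have r01 : 1 <= r0 by rewrite lerDr divr_ge0// divr_ge0// ltW.
have r0_gt0 : 0 < r0 by exact: lt_le_trans r01.
have Qr0 r : r0 <= r -> m ^+ 2 / 2 <= Q r.
  move=> rr; have r1 : 1 <= r by exact: le_trans rr.
  have : `|V0 r| <= m ^+ 2 / 2.
    have m22 : 0 < m ^+ 2 / 2 by rewrite divr_gt0.
    have : CV <= m ^+ 2 / 2 * r.
      rewrite mulrC -ler_pdivrMr// (le_trans _ rr)// lerDl//.
    have : `|V0 r| * r <= `|V0 r| * (1 + r ^+ 2) by rewrite ler_wpM2l//; nra.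
    have := V0C r => a b c; have : `|V0 r| * r <= m ^+ 2 / 2 * r by lra.
    by rewrite ler_pM2r// (lt_le_trans _ r1).
  by move=> /(le_trans (ler_norm _)); rewrite /Q; lra.
have [K K0 HK] := bounded_solution cQ (ltW r0_gt0) (divr_gt0 m20 (@ltr0Sn R 1)) q0 Qr0 (fun r _ => Qq r).
have c0 : continuous (fun _ : R => (0 : R)) by exact: cst_continuous.
have [|y1 [dy1 [y1r0 y1D dy1D y1B]]] := HK (fun _ => 0) 1 0 c0 (lexx 0).
  by move=> r _; rewrite normr0.
have y10 : y1 0 != 0.
  apply/eqP => y10.
  have dy1D' (r : R) : is_derive r (1:R) dy1 (Q r * y1 r + - (r * 0)).
    by rewrite mulr0; exact: dy1D.
  have [|v [vm _ vE lv]] := @radial_solution Q (fun _ => 0) y1 dy1 (K * (`|1| + 0)) (m ^+ 2 + CV) 0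
    cQ c0 y10 y1D dy1D' y1B (fun r _ => Qq r).
    by move=> r _; rewrite normr0.
  have v0 x : v x = 0.
    apply: (ker _ _ vm) => {}x; rewrite lv subr0 /Q /V0 -(radial_axis x rV)//.
  have := vE _ r0_gt0; rewrite v0 y1r0 => /esym/eqP.
  by rewrite mulf_eq0 oner_eq0 invr_eq0 gt_eqF.
pose a0 := `|y1 0|; have a00 : 0 < a0 by rewrite normr_gt0.
pose K2 := K + K / a0 * K.
have K20 : 0 <= K2 by rewrite addr_ge0// mulr_ge0// divr_ge0// ltW.
exists (20 * (2 * K2 + 1)); first by rewrite mulr_ge0// addr_ge0// mulr_ge0.
move=> B f B0 rf cf fB.
pose f0 r := f (r, 0, 0).
have cf0 : continuous f0 by exact: continuous_axis.
have f0B' r : `|f0 r| <= B.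
  apply: le_trans (fB (r, 0, 0)); rewrite ler_peMl// -/weight exprn_ege1//.
  exact: X1_weight_ge1.
have cg : continuous (fun r : R => r * f0 r).
  by move=> r; apply: cvgM; [exact: cvg_id|exact: cf0].
have gB r : 0 <= r -> `|r * f0 r| <= B.
  move=> r0'; apply: le_trans (fB (r, 0, 0)); rewrite normrM.
  rewrite ler_wpM2r// ger0_norm//.
  apply: (@le_trans _ _ (weight (r, 0, 0))).
    by apply: le_trans (enorm_le_weight _); rewrite enorm_axis ger0_norm.
  by rewrite exprS ler_peMr ?exprn_ege1 ?X1_weight_ge1// ltW// X1_weight_gt0.
have [yg [dyg [_ ygD dygD ygB]]] := HK _ 0 B cg B0 gB.
pose c := yg 0 / y1 0.
have cK : `|c| <= K / a0 * B.
  rewrite /c normrM normfV -/a0 ler_pdivrMr// mulrAC divfK ?gt_eqF//.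
  by have [+ _] := ygB 0 (lexx 0); rewrite normr0 add0r.
pose y r := yg r - c * y1 r; pose dy r := dyg r - c * dy1 r.
have y0 : y 0 = 0 by rewrite /y /c divfK// subrr.
have yD (r : R) : is_derive r (1:R) y (dy r).
  have A := ygD r; have A' := y1D r.
  by rewrite /y; apply: is_derive_eq; rewrite -![_ *: _]/(_ * _) /dy; ring.
have dyD (r : R) : is_derive r (1:R) dy (Q r * y r + - (r * f0 r)).
  have A := dygD r; have A' := dy1D r.
  by rewrite /dy; apply: is_derive_eq; rewrite -![_ *: _]/(_ * _) /y; ring.
have yM r : 0 <= r -> `|y r| <= K2 * B /\ `|dy r| <= K2 * B.
  move=> r0'; have [g1 g2] := ygB r r0'; have [h1 h2] := y1B r r0'.
  rewrite normr1 addr0 mulr1 in h1 h2; rewrite normr0 add0r in g1 g2.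
  have -> : K2 * B = K * B + K / a0 * B * K by rewrite /K2; ring.
  by split; rewrite (le_trans (ler_normB _ _))// lerD// normrM ler_pM.
have [v [vm _ _ lv]] := @radial_solution Q f0 y dy (K2 * B) (m ^+ 2 + CV) B
  cQ cf0 y0 yD dyD yM (fun r _ => Qq r) (fun r _ => f0B' r).
exists v; split.
  apply: radial_mode_le vm => //; rewrite le_eqVlt; apply/orP; left; apply/eqP; ring.
by move=> x; rewrite lv /Q /V0 /f0 -(radial_axis x rV) -(radial_axis x rf).
Qed.

(** Both [v] and [- v] are bounded weak solutions, so [weak_solution_le0] applies to
    both. *)
Lemma free_kernel (m q B : R) v : 0 < m -> radial_mode q B v ->
  (forall x, laplacian v x = m ^+ 2 * v x) -> forall x, v x = 0.
Proof.
move=> m0 [d1 [d2 [vC rv vB _]]] lv x.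
have [_ _ cv _ _] := vC.
have bd x' : `|v x'| <= B.
  by apply: le_trans (vB x'); rewrite ler_peMl// X1_weight_ge1.
have v_le0 : v x <= 0.
  apply: (weak_solution_le0 m0 cv); first by exists B.
  by apply: (distributional_of_classical vC) => z; rewrite lv addNr.
have nC := is_C2Z (-1) vC.
have : -1 * v x <= 0.
  apply: (weak_solution_le0 m0 (h := fun x => -1 * v x)).
  - by move=> z; apply: cvgM; [exact: cvg_cst|exact: cv].
  - by exists B => z; rewrite mulN1r normrN.
  apply: (distributional_of_classical nC) => z.
  by rewrite (laplacian_C2 _ nC) -!mulrDr -(laplacian_C2 _ vC) lv; ring.
by move=> h; apply/eqP; rewrite eq_le v_le0/=; lra.
Qed.

(** The decaying classical solution [W] of the linear equation with right-hand side
    [Gamma * w0^3] differs from [w0] by a bounded weak solution of the homogeneous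
    equation, that is, by zero. *)
Lemma stationary_regularity (m MG : R) (Gamma : R3 R -> R) (w0 : X1 R) : 0 < m ->
  radial Gamma -> continuous Gamma -> (forall x, `|Gamma x| <= MG) ->
  distributional_solution m w0 (fun x => Gamma x * w0 x ^+ 3) ->
  (exists B, radial_mode (m ^+ 2) B w0) /\
  forall x, laplacian w0 x = m ^+ 2 * w0 x - Gamma x * w0 x ^+ 3.
Proof.
move=> m0 rG cG GM weak.
have MG0 : 0 <= MG by exact: le_trans (GM 0).
have rw := X1_radial w0; have cw : continuous w0 by exact: X1_continuous.
have c0 : continuous (fun _ : R3 R => (0 : R)) by exact: cst_continuous.
have z0 (x : R3 R) : weight x ^+ 2 * `|0 : R| <= 0 by rewrite normr0 mulr0.
have [|C C0 HC] := @zero_modes m 0 (fun _ => 0) m0 (lexx 0) (fun _ _ _ => erefl) c0 z0.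
  move=> B v; rewrite addr0 => vm lv x; apply: (free_kernel m0 vm) => z.
  by rewrite lv subr0.
pose f x := Gamma x * w0 x ^+ 3.
have rf : radial f by move=> x z xz; rewrite /f (rG x z xz) (rw x z xz).
have cf : continuous f.
  by move=> x; apply: cvgM; [exact: cG|apply: cvgM; [exact: cw|apply: cvgM; exact: cw]].
have fB x : weight x ^+ 3 * `|f x| <= MG * `|w0| ^+ 3.
  have w1 : 0 <= weight x * `|w0 x| by rewrite mulr_ge0// ltW// X1_weight_gt0.
  have w2 := X1_norm_ub w0 x.
  rewrite /f normrM normrX mulrCA -exprMn; apply: ler_pM => //; first exact: exprn_ge0.
  by apply: lerXn2r; rewrite ?nnegrE.
have [] := HC (MG * `|w0| ^+ 3) f _ rf cf fB; first by rewrite mulr_ge0// exprn_ge0.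
move=> W; rewrite addr0 => -[[d1 [d2 [WC rW WB WX]]]] lW'.
have lW x : laplacian W x = m ^+ 2 * W x - f x by rewrite lW' subr0.
have [_ _ cW _ _] := WC.
have weakW : distributional_solution m W f.
  by apply: (distributional_of_classical WC) => x; rewrite lW; ring.
have WE x : W x = w0 x.
  have H (s : R) : s * (w0 x - W x) <= 0.
    have cws y : {for y, continuous (fun x => s * (w0 x - W x))}.
      by apply: cvgM; [exact: cvg_cst|apply: cvgB; [exact: cw|exact: cW]].
    apply: (weak_solution_le0 m0 (h := fun x => s * (w0 x - W x))) => //.
      exists (`|s| * (`|w0| + C * (MG * `|w0| ^+ 3))) => y.
      rewrite normrM ler_wpM2l// (le_trans (ler_normB _ _))// lerD//.
        by apply: le_trans (X1_norm_ub w0 y); rewrite ler_peMl// X1_weight_ge1.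
      by apply: le_trans (WB y); rewrite ler_peMl// X1_weight_ge1.
    move=> phi tp; have [e1 [e2 [N [N0 pC pN]]]] := test_function_C2 tp.
    have [pD pDD cp cp1 cp2] := pC.
    pose P y := - laplacian phi y + m ^+ 2 * phi y.
    have nP : csupp N P.
      split.
        rewrite /P => y.
        have -> : (fun y => - laplacian phi y + m ^+ 2 * phi y) = fun y =>
          - (e2 (1, 0, 0) (1, 0, 0) y + e2 (0, 1, 0) (0, 1, 0) y +
             e2 (0, 0, 1) (0, 0, 1) y) + m ^+ 2 * phi y.
          by apply/funext => z; rewrite (laplacian_C2 _ pC).
        apply: cvgD; last by apply: cvgM; [exact: cvg_cst|exact: cp].
        by apply: cvgN; apply: cvgD; [apply: cvgD|]; exact: cp2.
      move=> y Ny; have [p0 _ p2] := pN y Ny.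
      by rewrite /P (laplacian_C2 _ pC) !p2 p0; ring.
    have nw : csupp N (fun y => w0 y * P y) by exact: csuppMr.
    have nW : csupp N (fun y => W y * P y) by exact: csuppMr.
    transitivity (\int[@lebesgue3 R]_y (s * (w0 y * P y) + - s * (W y * P y))).
      by apply: eq_Rintegral => y _; rewrite /P; ring.
    rewrite (csupp_integralD N0 (csuppZ s nw) (csuppZ (- s) nW)).
    rewrite (csupp_integralZ _ N0 nw) (csupp_integralZ _ N0 nW).
    rewrite (weak _ tp) (weakW _ tp) -mulrDl subrr mul0r.
    under eq_Rintegral do rewrite mul0r.
    by rewrite /Rintegral integral0.
  have := H 1; have := H (-1); rewrite mulN1r mul1r => h1 h2.
  by apply/eqP; rewrite eq_le; apply/andP; split; lra.
have WE' : W = w0 by apply/funext.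
split; last by move=> x; rewrite -WE' lW /f WE.
by exists (C * (MG * `|w0| ^+ 3)); rewrite -WE'; exists d1, d2.
Qed.

End decaying_modes.

(** * Banach spaces and power series *)

Section bounded_linear_maps.
Context {R : realType}.

(** Bounded linear maps commute with convergent series; coordinates of [ell1] and
    point evaluations on [X1] are the instances. *)
Definition bounded_linear {V W : normedModType R} (p : V -> W) (K : R) :=
  (forall a u v, p (a *: u + v) = a *: p u + p v) /\
  forall v, `|p v| <= K * `|v|.

Variables (V W : normedModType R) (p : V -> W) (K : R).
Hypothesis pK : bounded_linear p K.

Lemma bounded_linear0 : p 0 = 0.
Proof. by have := pK.1 (-1) 0 0; rewrite scaler0 addr0 scaleN1r addNr. Qed.

Lemma bounded_linearD u v : p (u + v) = p u + p v.
Proof. by have := pK.1 1 u v; rewrite !scale1r. Qed.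

Lemma bounded_linearZ a u : p (a *: u) = a *: p u.
Proof. by have := pK.1 a u 0; rewrite !addr0 bounded_linear0 addr0. Qed.

Lemma bounded_linearB u v : p (u - v) = p u - p v.
Proof. by rewrite bounded_linearD -scaleN1r bounded_linearZ scaleN1r. Qed.

Lemma bounded_linear_series (f : nat -> V) N :
  p (series f N) = series (fun n => p (f n)) N.
Proof.
elim: N => [|N IH]; first by rewrite /series/= !big_geq// bounded_linear0.
by rewrite !seriesSr bounded_linearD IH.
Qed.

Lemma bounded_linear_cvg {T : Type} (F : set_system T) {FF : ProperFilter F}
  (f : T -> V) (l : V) : f @ F --> l -> (fun x => p (f x)) @ F --> p l.
Proof.
move=> fl; apply/cvgrPdist_le => e e0.
have K1 : 0 < `|K| + 1 by rewrite ltr_wpDl.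
have /cvgrPdist_le/(_ _ (divr_gt0 e0 K1)) := fl; apply: filterS => x h.
rewrite -bounded_linearB (le_trans (pK.2 _))//.
apply: (@le_trans _ _ ((`|K| + 1) * `|l - f x|)).
  by rewrite ler_wpM2r// (le_trans (ler_norm K))// lerDl.
by rewrite mulrC -ler_pdivlMr.
Qed.

Lemma bounded_linear_limn (f : nat -> V) : cvgn (series f) ->
  series (fun n => p (f n)) @ \oo --> p (limn (series f)).
Proof.
move=> cf; have -> : series (fun n => p (f n)) = fun N => p (series f N).
  by apply/funext => N; rewrite bounded_linear_series.
exact: bounded_linear_cvg.
Qed.

Lemma bounded_linear_derive {U : normedModType R} (f : U -> V) x v d :
  is_derive x v f d -> is_derive x v (fun y => p (f y)) (p d).
Proof.
move=> [/cvg_ex[l fl] <-]; rewrite /derive (cvg_lim _ fl)//.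
have key : (fun h : R => p (h^-1 *: ((f \o shift x) (h *: v) - f x))) @ 0^' --> p l.
  exact: bounded_linear_cvg fl.
have E : (fun h : R => p (h^-1 *: ((f \o shift x) (h *: v) - f x))) =
    (fun h : R => h^-1 *: (((fun y => p (f y)) \o shift x) (h *: v) - p (f x))).
  by apply/funext => h; rewrite bounded_linearZ bounded_linearB.
rewrite E in key.
by apply: DeriveDef; [apply/cvg_ex; exists (p l)|exact/cvg_lim].
Qed.

End bounded_linear_maps.

Section shifted_series.
Context {R : realType} {W : normedModType R}.
Implicit Types u : nat -> W.

Lemma series_shift u N : series u N.+1 = u 0%N + series (fun n => u n.+1) N.
Proof. by rewrite /series/= big_nat_recl. Qed.

Lemma cvg_series_shift u : cvgn (series (fun n => u n.+1)) ->
  series u @ \oo --> u 0%N + limn (series (fun n => u n.+1)).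
Proof.
move=> cu; rewrite -cvg_shiftS /=.
under eq_fun do rewrite series_shift.
by apply: cvgD => //; exact: cvg_cst.
Qed.

Lemma limn_series_shift u : cvgn (series (fun n => u n.+1)) ->
  limn (series u) = u 0%N + limn (series (fun n => u n.+1)).
Proof. by move=> /cvg_series_shift/cvg_lim => ->. Qed.

Lemma is_cvg_series_shift u : cvgn (series u) -> cvgn (series (fun n => u n.+1)).
Proof.
move=> cu; apply/cvg_ex; exists (limn (series u) - u 0%N).
have -> : series (fun n => u n.+1) = (fun N => series u N.+1 - u 0%N).
  by apply/funext => N; rewrite series_shift addrAC subrr add0r.
by apply: cvgB; [rewrite cvg_shiftS|exact: cvg_cst].
Qed.

Lemma limn_seriesZ (c : R) u : cvgn (series u) ->
  limn (series (fun n => c *: u n)) = c *: limn (series u).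
Proof.
move=> cu; apply/cvg_lim => //.
have -> : series (fun n => c *: u n) = (fun N => c *: series u N).
  by apply/funext => N; rewrite /series/= scaler_sumr.
by apply: cvgZr.
Qed.

Lemma is_cvg_seriesZ (c : R) u : cvgn (series u) -> cvgn (series (fun n => c *: u n)).
Proof.
move=> cu; have -> : series (fun n => c *: u n) = (fun N => c *: series u N).
  by apply/funext => N; rewrite /series/= scaler_sumr.
by apply: is_cvgZr.
Qed.

End shifted_series.

Section banach_spaces.
Context {R : realType}.

Lemma evaluation_bounded (x : R3 R) :
  bounded_linear (fun u : X1 R => X1_fun u x : R) 1.
Proof.
split=> [a u v|u]; first by [].
by rewrite mul1r; apply: le_trans (X1_norm_ub u x); rewrite ler_peMl// X1_weight_ge1.
Qed.

Lemma summable_complete_X1 : summable_complete (X1 R).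
Proof.
move=> f cf; pose M := Num.norm \o f.
have fx x := evaluation_bounded x.
have fM n x : `|f n x : R| <= M n by have := (fx x).2 (f n); rewrite mul1r.
have cfx x : cvgn (series (fun n => f n x : R)).
  exact: (@cvg_dominated_series _ _ summable_complete_real _ M).
pose v x : R := limn (series (fun n => f n x)).
have tail N x : X1_weight x * `|v x - series (fun n => f n x) N| <=
    limn (series M) - series M N.
  have w0 : 0 <= X1_weight x by exact/ltW/X1_weight_gt0.
  have := @series_tail _ _ summable_complete_real
    (fun n => X1_weight x *: (f n x : R)) M N; rewrite limn_seriesZ//.
  have -> : series (fun n => X1_weight x *: (f n x : R)) N =
      X1_weight x *: series (fun n => f n x : R) N.
    by rewrite /series/= scaler_sumr.
  rewrite -scalerBr normrZ (ger0_norm w0); apply => // n.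
  by rewrite normrZ ger0_norm//; exact: X1_norm_ub.
have rv : radial v.
  move=> x y xy; rewrite /v; congr (limn (series _)); apply/funext => n.
  exact: X1_radial.
have cv : continuous v.
  move=> x; apply: (@continuous_series _ _ summable_complete_real _ (fun n x => f n x : R) x M) => //.
    by move=> n; exact: X1_continuous.
  by apply: (@filterE _ (nbhs x)) => y n; exact: fM.
have [] := @X1_exists R v (limn (series M)) rv cv.
  move=> x; have := tail 0%N x.
  by rewrite /series/= !big_geq// !subr0.
move=> u uv _; apply/cvg_ex; exists u.
apply/cvgrPdist_le => e e0.
have /cvgrPdist_le/(_ _ e0) := cf; apply: filterS => N h.
apply: le_trans (le_trans (ler_norm _) h).
apply: X1_norm_le => x; have -> : (u - series f N) x = (u x - series f N x : R) by [].
have -> : X1_fun (series f N) x = series (fun n => f n x : R) N.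
  exact: (bounded_linear_series (fx x)).
by rewrite uv; exact: tail.
Qed.

Variable V : normedModType R.

Lemma ell1_cvg (u : ell1 V) : cvgn (series (Num.norm \o u)).
Proof. by have := ell1_seqP u; rewrite inE. Qed.

Lemma ell1_normE (u : ell1 V) : `|u| = limn (series (Num.norm \o u)).
Proof. by []. Qed.

Lemma ell1_partial (u : ell1 V) K : series (Num.norm \o u) K <= `|u|.
Proof. by apply: partial_le_limn; [move=> n; exact: normr_ge0|exact: ell1_cvg]. Qed.

Lemma ell1_norm_le (u : ell1 V) (M : R) :
  (forall K, series (Num.norm \o u) K <= M) -> `|u| <= M.
Proof.
by move=> uM; apply: limr_le; [exact: ell1_cvg|exact: nearW].
Qed.

Lemma ell1_exists (u : nat -> V) (M : R) :
  (forall K, series (Num.norm \o u) K <= M) -> exists U : ell1 V, ell1_seq U = u.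
Proof.
move=> uM; have uX : u \in ell1_pred V.
  rewrite inE; apply: nondecreasing_is_cvgn.
    by apply: nondecreasing_series => n _ _; exact: normr_ge0.
  by exists M => _ [K _ <-].
by exists (MkEll1 uX).
Qed.

Lemma coordinate_bounded k : bounded_linear (fun u : ell1 V => ell1_seq u k : V) 1.
Proof.
split=> [a u v|u]; first by [].
rewrite mul1r; apply: le_trans (ell1_partial u k.+1).
rewrite seriesSr lerDr; apply: sumr_ge0 => i _; exact: normr_ge0.
Qed.

Lemma limn_series_sum (M : nat -> nat -> R) K : (forall k, cvgn (series (M k))) ->
  cvgn (series (fun n => \sum_(0 <= k < K) M k n)) /\
  limn (series (fun n => \sum_(0 <= k < K) M k n)) =
    \sum_(0 <= k < K) limn (series (M k)).
Proof.
move=> cM; suff H : series (fun n => \sum_(0 <= k < K) M k n) @ \oo -->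
    \sum_(0 <= k < K) limn (series (M k)).
  by split; [apply/cvg_ex; eexists; exact: H|exact/cvg_lim].
elim: K => [|K IH].
  rewrite big_geq//; apply: cvg_near_cst; apply: nearW => N.
  by rewrite /series/= big1// => i _; rewrite big_geq.
rewrite big_nat_recr//=.
have -> : series (fun n => \sum_(0 <= k < K.+1) M k n) =
    series (fun n => \sum_(0 <= k < K) M k n) \+ series (M K).
  apply/funext => N; rewrite /series/= -big_split/=.
  by apply: eq_bigr => i _; rewrite big_nat_recr.
by apply: cvgD => //; exact: cM.
Qed.

Lemma summable_complete_ell1 : summable_complete V -> summable_complete (ell1 V).
Proof.
move=> cV f cf; pose M := Num.norm \o f.
have fk k := coordinate_bounded k.
have fM n k : `|f n k : V| <= M n by have := (fk k).2 (f n); rewrite mul1r.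
have cMk k : cvgn (series (fun n => `|f n k : V|)).
  apply: (@cvg_dominated_series _ _ summable_complete_real _ M) => // n.
  by rewrite normr_id.
pose u k : V := limn (series (fun n => f n k)).
have tail N K : \sum_(0 <= k < K) `|u k - series (fun n => f n k) N| <=
    limn (series M) - series M N.
  pose MK n := \sum_(0 <= k < K) `|f n k|.
  have [cMK lMK] := limn_series_sum K cMk.
  apply: (@le_trans _ _ (limn (series MK) - series MK N)).
    have -> : series MK N = \sum_(0 <= k < K) series (fun n => `|f n k|) N.
      by rewrite /series/= exchange_big.
    rewrite lMK -sumrB; apply: ler_sum => k _.
    exact: (@series_tail _ _ cV).
  apply: le_trans (ler_norm _) _.
  apply: (@series_tail _ _ summable_complete_real) => // n.
  rewrite ger0_norm; last by apply: sumr_ge0.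
  exact: ell1_partial.
have [U Uu] : exists U : ell1 V, ell1_seq U = u.
  apply: (@ell1_exists _ (limn (series M))) => K; have := tail 0%N K.
  have -> : series M 0%N = 0 by rewrite /series/= big_geq.
  rewrite subr0; apply: le_trans.
  by apply: ler_sum => k _; rewrite /series/= big_geq// subr0.
apply/cvg_ex; exists U.
apply/cvgrPdist_le => e e0.
have /cvgrPdist_le/(_ _ e0) := cf; apply: filterS => N h.
apply: le_trans (le_trans (ler_norm _) h).
apply: ell1_norm_le => K; apply: le_trans (tail N K); apply: ler_sum => k _.
rewrite /= [X in `|X|](_ : _ = (U k - series f N k : V))//.
have -> : ell1_seq (series f N) k = series (fun n => f n k : V) N.
  exact: (bounded_linear_series (fk k)).
by rewrite Uu.
Qed.

End banach_spaces.
Section power_series.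
Context {R : realType} {W : normedModType R}.
Implicit Types (c : nat -> W) (a r rho : R).

Lemma is_derive_direction (f : R -> W) (x v : R) d :
  is_derive x (1:R) f d -> is_derive x v f (v *: d).
Proof.
move=> [dx <-]; have df : differentiable f x by exact/derivable1_diffP.
apply: DeriveDef; first exact: diff_derivable.
rewrite !deriveE//.
have {1}-> : v = v *: (1:R) by rewrite -[_ *: _]/(_ * _) mulr1.
by rewrite linearZ.
Qed.

Lemma Ck_congr {V : normedModType R} (D : set V) n (f g : V -> W) : open D ->
  (forall x, D x -> f x = g x) -> Ck D n g -> Ck D n f.
Proof.
move=> oD; have near_eq (f' g' : V -> W) x : (forall x, D x -> f' x = g' x) -> D x ->
    \forall y \near x, f' y = g' y.
  by move=> fg Dx; apply: filterS (open_nbhs_nbhs (conj oD Dx)) => y; exact: fg.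
have cont (f' g' : V -> W) : (forall x, D x -> f' x = g' x) ->
    (forall x, D x -> {for x, continuous g'}) -> forall x, D x -> {for x, continuous f'}.
  move=> fg cg x Dx; rewrite /prop_for /continuous_at fg//.
  apply: cvg_trans (cg x Dx); apply: near_eq_cvg.
  by apply: filterS (near_eq _ _ x fg Dx) => y ->.
elim: n f g => [|n IH] f g fg [cg H]; split => //; try exact: cont cg.
move=> v; have [dg Cg] := H v; split.
  move=> x Dx; apply: near_eq_derivable (dg x Dx).
  by apply: filterS (near_eq _ _ x fg Dx) => y ->.
apply: IH Cg => x Dx; apply: near_eq_derive; exact: near_eq.
Qed.

Lemma CkS_intro_on {V : normedModType R} (D : set V) n (f : V -> W) : open D ->
  (forall x, D x -> {for x, continuous f}) ->
  (forall v, exists2 df : V -> W, forall x, D x -> is_derive x v f (df x) &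
     Ck D n df) -> Ck D n.+1 f.
Proof.
move=> oD cf H; split => // v; have [df fdf cdf] := H v.
split; first by move=> x Dx; have [] := fdf x Dx.
by apply: Ck_congr cdf => // x Dx; have [_ ->] := fdf x Dx.
Qed.

Lemma Ck_scale {V : normedModType R} (D : set V) n (s : R) (f : V -> W) : open D ->
  Ck D n f -> Ck D n (fun x => s *: f x).
Proof.
move=> oD; elim: n f => [|n IH] f [cf H].
  by split => // x Dx; apply: cvgZr; exact: cf.
apply: CkS_intro_on => // [x Dx|v]; first by apply: cvgZr; exact: cf.
have [df Cf] := H v; exists (fun x => s *: 'D_v f x); last exact: IH.
move=> x Dx; have h : is_derive x v f ('D_v f x) by apply: DeriveDef => //; exact: df.
exact: is_deriveZ.
Qed.

Definition psummable c rho := forall r, 0 <= r -> r < rho ->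
  cvgn (series (fun n => r ^+ n * `|c n|)).

Definition psum c a : W := limn (series (fun n => a ^+ n *: c n)).

Definition pderiv c n : W := n.+1%:R *: c n.+1.

(** This is why the termwise derivative of a power series converges on the same
    disc. *)
Lemma power_difference_le (r r' : R) n : 0 <= r -> r <= r' ->
  n.+1%:R * r ^+ n * (r' - r) <= r' ^+ n.+1.
Proof.
move=> r0 rr; have r'0 : 0 <= r' by exact: le_trans rr.
elim: n => [|n IH]; first by rewrite expr0 !mul1r expr1; lra.
have : r * (n.+1%:R * r ^+ n * (r' - r)) <= r * r' ^+ n.+1 by rewrite ler_wpM2l.
have : r ^+ n.+1 * (r' - r) <= r' ^+ n.+1 * (r' - r).
  by rewrite ler_wpM2r ?subr_ge0// lerXn2r.
rewrite -(natr1 n.+1) [r' ^+ n.+2]exprS [r ^+ n.+1]exprS.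
move: (n.+1%:R) (r ^+ n) (r' ^+ n.+1) => k q Q h1 h2; lra.
Qed.

Lemma power_lipschitz (r x y : R) n : `|x| <= r -> `|y| <= r ->
  `|x ^+ n.+1 - y ^+ n.+1| <= `|x - y| * (n.+1%:R * r ^+ n).
Proof.
move=> xr yr; rewrite subrXX normrM ler_wpM2l//.
apply: (le_trans (ler_norm_sum _ _ _)).
rewrite -[n.+1 in leRHS]card_ord mulr_natl -sumr_const; apply: ler_sum => i _.
rewrite normrM !normrX.
have -> : r ^+ n = r ^+ (n.+1.-1 - i) * r ^+ i.
  by rewrite -exprD subnK// -ltnS.
rewrite ler_pM ?exprn_ge0// lerXn2r// nnegrE//.
- exact: le_trans xr.
- exact: le_trans xr.
Qed.

Lemma psummable_cvg c rho (cW : summable_complete W) a : psummable c rho ->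
  `|a| < rho -> cvgn (series (fun n => a ^+ n *: c n)).
Proof.
move=> cs ar; apply: (cvg_dominated_series cW _ (cs _ (normr_ge0 a) ar)) => n.
by rewrite normrZ normrX.
Qed.

Lemma psummable_deriv c rho : psummable c rho -> psummable (pderiv c) rho.
Proof.
move=> cs r r0 rr; pose r' := (r + rho) / 2.
have [r1 r2] : r < r' /\ r' < rho by rewrite /r'; split; lra.
have r'0 : 0 <= r' by exact: le_trans (ltW r1).
have d0 : 0 < r' - r by rewrite subr_gt0.
apply: (@cvg_dominated_series _ _ summable_complete_real _
  (fun n => (r' - r)^-1 *: (r' ^+ n.+1 * `|c n.+1|))); last first.
  apply: is_cvg_seriesZ.
  exact: (@is_cvg_series_shift _ R^o (fun n => r' ^+ n * `|c n|) (cs r' r'0 r2)).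
move=> n; rewrite normrM normr_id normrX ger0_norm// /pderiv normrZ normr_nat.
rewrite -[_ *: _]/(_ * _) mulrA [leRHS]mulrA ler_wpM2r//.
have H := power_difference_le n r0 (ltW r1).
rewrite ler_pdivlMl//; apply: le_trans H; rewrite le_eqVlt; apply/orP; left.
by apply/eqP; ring.
Qed.

Lemma psum_is_derive c rho (cW : summable_complete W) a : psummable c rho ->
  `|a| < rho -> is_derive a (1:R) (psum c) (psum (pderiv c) a).
Proof.
move=> cs ar.
have dcs := psummable_deriv cs.
pose r := (`|a| + rho) / 2; pose d := r - `|a|.
have d0 : 0 < d by rewrite /d /r; lra.
have r0 : 0 <= r by rewrite /r; have := normr_ge0 a; lra.
have rr : r < rho by rewrite /r; lra.
pose g n : W := if n is k.+1 then a ^+ k *: pderiv c k else 0.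
pose M n : R := if n is k.+1 then r ^+ k * `|pderiv c k| else 0.
have cg := psummable_cvg cW dcs ar.
have gE : limn (series g) = psum (pderiv c) a.
  by rewrite (limn_series_shift (u := g)) ?add0r.
have cM : cvgn (series M).
  apply/cvg_ex; eexists; apply: (@cvg_series_shift _ R^o M).
  exact: dcs.
rewrite -gE.
have line h : `|h| < d -> `|h *: (1:R) + a| <= r.
  move=> hd; rewrite -[h *: _]/(h * 1) mulr1 (le_trans (ler_normD _ _))//.
  by move: hd; rewrite /d; lra.
apply: (@is_derive_series _ _ cW R (fun n x => x ^+ n *: c n) g a 1 M d) => //.
- case=> [|n].
    rewrite /g; have -> : (fun x : R => x ^+ 0 *: c 0%N) = cst (c 0%N).
      by apply/funext => x; rewrite expr0 scale1r.
    exact: is_derive_cst.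
  have D : is_derive a (1:R) (fun x : R => x ^+ n.+1) (n.+1%:R * a ^+ n).
    have -> : (fun x : R => x ^+ n.+1) = (id : R -> R) ^+ n.+1.
      by apply/funext => x; rewrite exprfctE.
    have /is_derive_eq := is_deriveX n.+1 (is_derive_id a (1:R)); apply.
    by rewrite -[_ *: _]/(_ * _) mulr1.
  rewrite /g /pderiv scalerA.
  have [dD eD] := D.
  have df : differentiable (fun x : R => x ^+ n.+1) a by exact/derivable1_diffP.
  rewrite mulrC -eD.
  have bl : bounded_linear (fun x : R => x *: c n.+1) `|c n.+1|.
    by split => [s u v|v]; rewrite ?scalerDl ?scalerA// normrZ mulrC.
  rewrite eD; exact: (bounded_linear_derive bl D).
- case=> [|n] h hd; first by rewrite !expr0 subrr normr0 mulr0.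
  rewrite -scalerBl normrZ.
  have ra : `|a| <= r by rewrite /r; lra.
  have := power_lipschitz n (line h hd) ra.
  rewrite addrK -[h *: _]/(h * 1) mulr1 => H.
  rewrite /M /pderiv normrZ normr_nat.
  apply: le_trans (ler_wpM2r (normr_ge0 _) H) _.
  rewrite le_eqVlt; apply/orP; left; apply/eqP; ring.
- by move=> h hd; apply: (psummable_cvg cW cs); exact: le_lt_trans (line h hd) rr.
Qed.

Lemma open_disc rho : open [set a : R | `|a| < rho].
Proof.
rewrite openE => a /= ar.
have cn : {for a, continuous (fun y : R => `|y|)} by exact: norm_continuous.
exact: (cvgr_lt _ cn _ ar).
Qed.

Lemma psum_smooth c rho : summable_complete W -> psummable c rho ->
  smooth [set a : R | `|a| < rho] (psum c).
Proof.
move=> cW cs n; elim: n c cs => [|n IH] c cs.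
  split => // a ar; have [D _] := psum_is_derive cW cs ar.
  by apply: differentiable_continuous; exact/derivable1_diffP.
apply: CkS_intro_on; first exact: open_disc.
  move=> a ar; have [D _] := psum_is_derive cW cs ar.
  by apply: differentiable_continuous; exact/derivable1_diffP.
move=> v; exists (fun a => v *: psum (pderiv c) a).
  by move=> a ar; apply: is_derive_direction; exact: psum_is_derive ar.
by apply: Ck_scale; [exact: open_disc|apply: IH; exact: psummable_deriv].
Qed.

Lemma psum0 c : psum c 0 = c 0%N.
Proof.
rewrite /psum limn_series_shift.
  rewrite expr0 scale1r; have -> : series (fun n => (0:R) ^+ n.+1 *: c n.+1) = cst 0.
    by apply/funext => N; rewrite /series/= big1// => i _; rewrite expr0n scale0r.
  by rewrite lim_cst// addr0.
have -> : series (fun n => (0:R) ^+ n.+1 *: c n.+1) = cst 0.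
  by apply/funext => N; rewrite /series/= big1// => i _; rewrite expr0n scale0r.
exact: is_cvg_cst.
Qed.

Lemma psum_first_order c rho r a : summable_complete W -> psummable c rho ->
  0 < r -> r < rho -> `|a| <= r ->
  `|psum c a - c 0%N - a *: c 1%N| <=
    a ^+ 2 * (r ^- 2 * limn (series (fun n => r ^+ n * `|c n|))).
Proof.
move=> cW cs r0 rr ar.
have cr := cs r (ltW r0) rr.
have ca := psummable_cvg cW cs (le_lt_trans ar rr).
have c1 := is_cvg_series_shift ca; have c2 := is_cvg_series_shift c1.
have -> : psum c a - c 0%N - a *: c 1%N =
    limn (series (fun n => a ^+ n.+2 *: c n.+2)).
  rewrite /psum limn_series_shift// limn_series_shift// expr0 scale1r expr1.
  by rewrite [X in X - a *: c 1%N]addrAC subrr add0r addrAC subrr add0r.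
have cr2 := is_cvg_series_shift (is_cvg_series_shift (W := R^o) cr).
pose M n : R := (a ^+ 2 * r ^- 2) *: (r ^+ n.+2 * `|c n.+2|).
have cM : cvgn (series M) by apply: (@is_cvg_seriesZ _ R^o).
apply: (le_trans (norm_limn_series cW (M := M) _ cM)).
  move=> n; rewrite /M normrZ normrX -[_ *: _]/(_ * _) mulrA ler_wpM2r//.
  rewrite -[n.+2]addn2 !exprD -(real_normK (num_real a)).
  have -> : `|a| ^+ 2 * r ^- 2 * (r ^+ n * r ^+ 2) = r ^+ n * `|a| ^+ 2.
    by move: (`|a| ^+ 2) (r ^+ n) => p q; field; rewrite gt_eqF.
  by rewrite ler_wpM2r ?exprn_ge0// lerXn2r// nnegrE// ltW.
rewrite /M (@limn_seriesZ _ R^o)// -[_ *: _]/(_ * _) -mulrA ler_wpM2l ?sqr_ge0//.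
rewrite ler_wpM2l ?invr_ge0 ?sqr_ge0//.
have p0 n : 0 <= r ^+ n * `|c n| by rewrite mulr_ge0// exprn_ge0// ltW.
rewrite [leRHS](@limn_series_shift _ R^o); last exact: (is_cvg_series_shift (W := R^o) cr).
rewrite [X in _ <= _ + X](@limn_series_shift _ R^o)//.
by rewrite addrA lerDr addr_ge0.
Qed.

End power_series.

(** * Convolutions and the majorant *)

Section convolution.
Context {R : realType}.
Implicit Types (a b : nat -> R).

Definition conv a b n := \sum_(0 <= i < n.+1) a i * b (n - i)%N.

Definition truncated {T : Type} (d : T) (F : nat -> T) n i := if (i < n)%N then F i else d.

Lemma conv_ge0 a b n : (forall i, 0 <= a i) -> (forall i, 0 <= b i) -> 0 <= conv a b n.
Proof. by move=> a0 b0; apply: sumr_ge0 => i _; exact: mulr_ge0. Qed.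

Lemma conv_le (c : R) a b a' b' n :
  (forall i, (i <= n)%N -> a i * b (n - i)%N <= c * (a' i * b' (n - i)%N)) ->
  conv a b n <= c * conv a' b' n.
Proof.
move=> H; rewrite /conv mulr_sumr !big_nat.
by apply: ler_sum => i /andP[_]; exact: H.
Qed.

(** Splitting off of [p * p * p] the three terms that contain [p n]. *)
Lemma conv3_split a n : (0 < n)%N -> let b := truncated 0 a n in
  conv (conv a a) a n = 3 * a 0%N ^+ 2 * a n + conv (conv b b) b n.
Proof.
case: n => // n _ b.
have bE i : (i <= n)%N -> b i = a i by rewrite /b /truncated ltnS => ->.
have bn : b n.+1 = 0 by rewrite /b /truncated ltnn.
have c_lt i : (i <= n)%N -> conv a a i = conv b b i.
  move=> ni; rewrite /conv; apply: eq_big_nat => j /andP[_ ji].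
  rewrite !bE// ?(leq_trans (leq_subr _ _))//.
  exact: leq_trans ni.
have split2 u v : conv u v n.+1 = u 0%N * v n.+1 +
    \sum_(1 <= i < n.+1) u i * v (n.+1 - i)%N + u n.+1 * v 0%N.
  by rewrite /conv big_nat_recr//= subnn big_ltn// subn0.
have mid u u' : (forall i, (i <= n)%N -> u i = u' i) ->
    \sum_(1 <= i < n.+1) u i * a (n.+1 - i)%N =
    \sum_(1 <= i < n.+1) u' i * b (n.+1 - i)%N.
  move=> uu; apply: eq_big_nat => i /andP[i1 ni].
  by rewrite uu// bE// leq_subLR -add1n leq_add.
have cn : conv a a n.+1 = conv b b n.+1 + 2 * a 0%N * a n.+1.
  by rewrite (split2 a a) (split2 b b) bn (mid _ b)// => [|i /bE//]; ring.
rewrite split2 [conv (conv b b) b _]split2 cn bn (mid _ _ c_lt) bE//.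
rewrite {1}/conv big_nat1 subnn; ring.
Qed.

Lemma triangular_sum (x y : nat -> R) N :
  series (conv x y) N = \sum_(0 <= i < N) x i * series y (N - i)%N.
Proof.
elim: N => [|N IH]; first by rewrite /series/= !big_geq.
rewrite seriesSr IH [RHS]big_nat_recr//= /conv big_nat_recr//= addrA; congr (_ + _).
  rewrite -big_split/=; apply: eq_big_nat => i /andP[_ iN].
  by rewrite subSn ?(ltnW iN)// seriesSr mulrDr.
by rewrite subnn subSnn seriesSr [series y 0]/series/= big_geq// add0r.
Qed.

(** Cauchy products, by Tannery's theorem. *)
Lemma cauchy_product (x y : nat -> R) : cvgn (series (Num.norm \o x)) ->
  cvgn (series (Num.norm \o y)) ->
  series (conv x y) @ \oo --> limn (series x) * limn (series y).
Proof.
move=> cx cy; have cy' := summable_complete_real cy.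
have cx' := summable_complete_real cx.
pose f n N : R := if (n < N)%N then x n * series y (N - n)%N else 0.
have fE N : series (conv x y) N = limn (series (f^~ N)).
  rewrite triangular_sum; apply/esym/cvg_lim => //.
  apply: cvg_near_cst; exists N => // K /= NK.
  rewrite /series/= (big_cat_nat (leq0n N) NK)//=.
  rewrite [X in _ + X]big1_seq ?addr0; last first.
    by move=> i; rewrite mem_index_iota => /andP[_ /andP[Ni _]]; rewrite /f ltnNge Ni.
  by apply: eq_big_nat => i /andP[_ iN]; rewrite /f iN.
have -> : series (conv x y) = fun N => limn (series (f^~ N)) by apply/funext.
have -> : limn (series x) * limn (series y) =
    limn (series (fun n => x n * limn (series y))).
  have := @limn_seriesZ _ R^o (limn (series y)) x cx'.
  rewrite -[_ *: _]/(_ * _) mulrC => <-.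
  by congr (limn (series _)); apply/funext => n; rewrite -[_ *: _]/(_ * _) mulrC.
apply: (@tannery _ _ summable_complete_real _ _ _ f
  (fun n => x n * limn (series y)) (fun n => `|x n| * limn (series (Num.norm \o y)))).
- move=> n; rewrite -(cvg_shiftn n.+1)/=.
  have -> : (fun N => f n (N + n.+1)%N) = (fun N => x n * series y N.+1).
    apply/funext => N; rewrite /f ltn_addl// addnS subSn ?leq_addl// addnK//.
  by apply: cvgM; [exact: cvg_cst|rewrite (cvg_shiftS (series y))].
- apply: nearW => N n; rewrite /f; case: ifP => _.
    rewrite normrM ler_wpM2l//; apply: (@le_trans _ _ (series (Num.norm \o y) (N - n)%N)).
      exact: ler_norm_sum.
    by apply: partial_le_limn => // k; exact: normr_ge0.
  rewrite normr0 mulr_ge0//; apply: le_trans (partial_le_limn 0 _ cy); last first.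
    by move=> k; exact: normr_ge0.
  by rewrite /series/= big_geq.
- have := @is_cvg_seriesZ _ R^o (limn (series (Num.norm \o y))) _ cx.
  by congr (cvgn (series _)); apply/funext => n; rewrite -[_ *: _]/(_ * _) mulrC.
Qed.

Lemma dominated_conv (x y : nat -> R) : cvgn (series (Num.norm \o x)) ->
  cvgn (series (Num.norm \o y)) -> cvgn (series (Num.norm \o conv x y)).
Proof.
move=> cx cy.
apply: (@cvg_dominated_series _ _ summable_complete_real _
  (conv (Num.norm \o x) (Num.norm \o y))).
  move=> n; rewrite normr_id; apply: (le_trans (ler_norm_sum _ _ _)).
  by apply: ler_sum => i _; rewrite normrM.
have nn (z : nat -> R) : Num.norm \o (Num.norm \o z) = Num.norm \o z.
  by apply/funext => n /=; rewrite normr_id.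
by apply/cvg_ex; eexists; apply: cauchy_product; rewrite nn.
Qed.

Let w n : R := n.+1%:R ^- 2.

Let w_gt0 n : 0 < w n. Proof. by rewrite invr_gt0 exprn_gt0. Qed.

Let sum_w n : \sum_(0 <= i < n.+1) w i <= 2 - n.+1%:R^-1.
Proof.
elim: n => [|n IH]; first by rewrite big_nat1 /w expr1n invr1; lra.
rewrite big_nat_recr//=; apply: (le_trans (lerD IH (lexx _))).
rewrite /w -[n.+2%:R]natr1; set k := n.+1%:R : R.
have k0 : 0 < k by rewrite ltr0n.
rewrite -subr_ge0.
have -> : 2 - (k + 1)^-1 - (2 - k^-1 + (k + 1) ^- 2) = (k * (k + 1) ^+ 2)^-1.
  by field; rewrite !gt_eqF// addr_gt0.
by rewrite invr_ge0 mulr_ge0 ?exprn_ge0 ?addr_ge0// ltW.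
Qed.

(* from [1 / (a * b) = (1 / a + 1 / b) / (a + b)] with [a + b = n + 2] *)
Let conv_w n : conv w w n <= 8 * w n.
Proof.
have n0 : 0 < n.+1%:R :> R by rewrite ltr0n.
apply: (@le_trans _ _ (\sum_(0 <= i < n.+1) (2 * w n * w i + 2 * w n * w (n - i)%N))).
  rewrite /conv !big_nat; apply: ler_sum => i /andP[_ iN].
  have iN' : (i <= n)%N by [].
  rewrite /w; set a := i.+1%:R : R; set b := (n - i).+1%:R : R; set c := n.+1%:R : R.
  have a0 : 0 < a by rewrite ltr0n.
  have b0 : 0 < b by rewrite ltr0n.
  have abc : a + b = c + 1.
    by rewrite /a /b /c natr1 -natrD addSn addnS subnKC// -addn2 natrD.
  have -> : a ^- 2 * b ^- 2 = ((a + b) ^- 2) * (a^-1 + b^-1) ^+ 2.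
    by field; rewrite !gt_eqF// addr_gt0.
  rewrite abc.
  apply: (@le_trans _ _ (c ^- 2 * (a^-1 + b^-1) ^+ 2)).
    rewrite ler_wpM2r ?sqr_ge0// lef_pV2 ?posrE ?exprn_gt0 ?addr_gt0//.
    by rewrite lerXn2r ?nnegrE ?addr_ge0 ?(ltW n0)// lerDl.
  have -> : 2 * c ^- 2 * a ^- 2 + 2 * c ^- 2 * b ^- 2 =
      c ^- 2 * (2 * (a^-1 ^+ 2 + b^-1 ^+ 2)) by rewrite -!exprVn; ring.
  rewrite ler_wpM2l ?invr_ge0 ?sqr_ge0//.
  have := sqr_ge0 (a^-1 - b^-1); move: (a^-1) (b^-1) => p q; lra.
rewrite big_split/= -!mulr_sumr.
have -> : \sum_(0 <= i < n.+1) w (n - i)%N = \sum_(0 <= i < n.+1) w i.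
  by rewrite [RHS]big_nat_rev/=; apply: eq_bigr => i _; rewrite add0n subSS.
have : \sum_(0 <= i < n.+1) w i <= 2.
  by apply: (le_trans (sum_w n)); rewrite gerBl invr_ge0 ltW.
have := w_gt0 n; move: (w n) (\sum_(0 <= i < n.+1) w i) => p q p0 q2; nra.
Qed.

(** The recursion is dominated by a geometric sequence: the weights [1 / (n+1)^2]
    reproduce themselves under convolution, and as every triple of indices below
    [n] with sum [n] has at least two nonzero entries, the constant in front of
    the weights for positive indices may be taken small. *)
Lemma majorant (N : nat -> R) (C : R) : (forall n, 0 <= N n) -> 0 <= C ->
  (forall n, (1 < n)%N -> let b := truncated 0 N n in
    N n <= C * conv (conv b b) b n) ->
  exists2 ka : R, 0 < ka & exists2 B : R, 0 <= B & forall n, N n <= B * ka ^+ n.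
Proof.
move=> N0 C0 Nrec.
pose B := N 0%N + 1.
have B1 : 1 <= B by rewrite lerDr.
have B0 : 0 <= B by exact: le_trans B1.
pose D := 64 * C * B + 1.
have D1 : 1 <= D by rewrite lerDr !mulr_ge0.
have D0 : 0 < D by exact: lt_le_trans D1.
pose ep := D^-1.
have ep0 : 0 < ep by rewrite invr_gt0.
have ep0' := ltW ep0.
have ep1 : ep <= 1 by rewrite invf_le1.
have epB : ep <= B by exact: le_trans B1.
have epC : 64 * C * B * ep <= 1.
  by rewrite /ep ler_pdivrMr// mul1r /D lerDl.
pose ka := 4 * N 1%N / ep + 1.
have ka0 : 0 < ka by rewrite ltr_wpDl// divr_ge0 ?mulr_ge0// ltW.
exists ka => //; exists B => //.
pose g n := ka ^+ n * w n.
have g0 n : 0 <= g n by rewrite mulr_ge0 ?exprn_ge0// ltW.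
have g_0 : g 0%N = 1 by rewrite /g /w expr0 expr1n invr1 mulr1.
have conv_g n : conv g g n <= 8 * g n.
  have -> : conv g g n = ka ^+ n * conv w w n.
    rewrite /conv mulr_sumr !big_nat; apply: eq_bigr => i /andP[_ iN].
    by rewrite /g -{3}(subnKC (m := i) (n := n))// exprD; ring.
  by rewrite /g mulrCA ler_wpM2l// exprn_ge0// ltW.
have bound n : (0 < n)%N -> N n <= ep * g n.
  elim/ltn_ind: n => n IH n0.
  have [n1|n1] := leqP n 1.
    have -> : n = 1%N by apply/eqP; rewrite eqn_leq n1.
    rewrite /g /w expr1 /ka.
    have -> : ep * ((4 * N 1%N / ep + 1) * 2 ^- 2) = N 1%N + ep / 4.
      by field; rewrite gt_eqF.
    by rewrite lerDl divr_ge0// ltW.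
  have := Nrec n n1; set b := truncated 0 N n => /= H; apply: (le_trans H).
  have b0 i : 0 <= b i by rewrite /b /truncated; case: ifP.
  have bn : b n = 0 by rewrite /b /truncated ltnn.
  have b_ep i : (0 < i)%N -> b i <= ep * g i.
    move=> i0; rewrite /b /truncated; case: ifP => [iN|_]; first exact: IH.
    by rewrite mulr_ge0// ltW.
  have b_B i : b i <= B * g i.
    case: i => [|i]; last by rewrite (le_trans (b_ep _ _))// ler_wpM2r.
    by rewrite /b /truncated n0 g_0 mulr1 lerDl.
  have c0 i : 0 <= conv b b i by exact: conv_ge0.
  have c_le i : (0 < i)%N -> conv b b i <= 8 * (ep * B) * g i.
    move=> i0; apply: (@le_trans _ _ (ep * B * conv g g i)); last first.
      have -> : 8 * (ep * B) * g i = ep * B * (8 * g i) by ring.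
      by rewrite ler_wpM2l// mulr_ge0// ltW.
    apply: conv_le => j ji.
    have -> : ep * B * (g j * g (i - j)%N) = (ep * g j) * (B * g (i - j)%N) by ring.
    case: j ji => [|j] ji; last by apply: ler_pM => //; exact: b_ep.
    rewrite subn0; have -> : ep * g 0%N * (B * g i) = (B * g 0%N) * (ep * g i) by ring.
    by apply: ler_pM => //; exact: b_ep.
  have c_n : conv b b n <= 8 * (ep * ep) * g n.
    apply: (@le_trans _ _ (ep * ep * conv g g n)); last first.
      have -> : 8 * (ep * ep) * g n = ep * ep * (8 * g n) by ring.
      by rewrite ler_wpM2l// mulr_ge0// ltW.
    apply: conv_le => j ji.
    have -> : ep * ep * (g j * g (n - j)%N) = (ep * g j) * (ep * g (n - j)%N) by ring.
    have gg : 0 <= ep * g j * (ep * g (n - j)%N) by apply: mulr_ge0; apply: mulr_ge0.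
    case: j ji gg => [|j] ji gg; first by rewrite subn0 bn mulr0; rewrite subn0 in gg.
    have [jn|jn] := eqVneq j.+1 n; first by rewrite [in b j.+1]jn bn mul0r.
    apply: ler_pM => //; apply: b_ep => //.
    by rewrite subn_gt0 ltn_neqAle jn.
  have T : conv (conv b b) b n <= 64 * (ep * ep * B) * g n.
    apply: (@le_trans _ _ (8 * (ep * ep * B) * conv g g n)); last first.
      have -> : 64 * (ep * ep * B) * g n = 8 * (ep * ep * B) * (8 * g n) by ring.
      rewrite ler_wpM2l//; apply: mulr_ge0 => //; apply: mulr_ge0 => //.
      by apply: mulr_ge0.
    apply: conv_le => j ji.
    have gg : 0 <= 8 * (ep * ep * B) * (g j * g (n - j)%N) 
      by apply: mulr_ge0; apply: mulr_ge0 => //; apply: mulr_ge0 => //; apply: mulr_ge0.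
    case: j ji gg => [|j] ji gg; first by rewrite subn0 bn mulr0; rewrite subn0 in gg.
    have [jn|jn] := eqVneq j.+1 n.
      rewrite jn subnn; have -> : 8 * (ep * ep * B) * (g n * g 0%N) =
        (8 * (ep * ep) * g n) * (B * g 0%N) by ring.
      by apply: ler_pM.
    have -> : 8 * (ep * ep * B) * (g j.+1 * g (n - j.+1)%N) =
      (8 * (ep * B) * g j.+1) * (ep * g (n - j.+1)%N) by ring.
    apply: ler_pM => //; first exact: c_le.
    by apply: b_ep; rewrite subn_gt0 ltn_neqAle jn.
  apply: (le_trans (ler_wpM2l C0 T)).
  have -> : C * (64 * (ep * ep * B) * g n) = (64 * C * B * ep) * (ep * g n) by ring.
  by rewrite ler_piMl// mulr_ge0// ltW.
move=> n; have gk : g n <= ka ^+ n.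
  rewrite /g ler_piMr ?exprn_ge0 ?(ltW ka0)// /w invf_le1 ?exprn_gt0//.
  by rewrite exprn_ege1// ler1n.
case: n gk => [|n] gk; first by rewrite expr0 mulr1 lerDl.
apply: (le_trans (bound n.+1 isT)); apply: ler_pM => //; exact: ltW.
Qed.

End convolution.

Lemma course_of_values (T : Type) (d : T) (step : nat -> (nat -> T) -> T) :
  (forall n F G, (forall i, (i < n)%N -> F i = G i) -> step n F = step n G) ->
  exists L : nat -> T, forall n, L n = step n L.
Proof.
move=> ext; pose Phi F n := step n F.
pose H m := iter m Phi (fun _ => d).
have stable m n : (n < m)%N -> H m.+1 n = H m n.
  elim: m n => // m IH n nm; rewrite /H iterS [in RHS]iterS; apply: ext => i ni.
  by apply: IH; exact: leq_trans ni nm.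
have stable' k n : H (n.+1 + k)%N n = H n.+1 n.
  elim: k => [|k IH]; first by rewrite addn0.
  by rewrite addnS stable// ltn_addr.
exists (fun n => H n.+1 n) => n; rewrite /H iterS; apply: ext => i ni.
by rewrite -[RHS]/(H i.+1 i) -(stable' (n - i.+1)%N i) subnKC.
Qed.
(** * Standing waves and the Lindstedt recursion *)

Section waves.
Context {R : realType}.
Variable omega : R.
Implicit Types (x : R3 R) (t : R).

(** A standing wave [cos (omega k t) v x], stored with its wave number [k], its
    amplitude [v] and a number controlling the size of [v]. *)
Local Notation wave := (nat * (R3 R -> R) * R)%type.

Definition freq (e : wave) := e.1.1.
Definition amplitude (e : wave) := e.1.2.
Definition size_bound (e : wave) := e.2.

Implicit Types (e : wave) (L : seq wave) (F : nat -> seq wave).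

Definition superpose L t x :=
  \sum_(e <- L) cos (omega * (freq e)%:R * t) * amplitude e x.

Definition mass L := \sum_(e <- L) size_bound e.

(** The product formula for cosines, the difference of the wave numbers being taken
    in absolute value. *)
Definition wave_mul e e' : seq wave :=
  let v := fun x => amplitude e x * amplitude e' x / 2 in
  let B := size_bound e * size_bound e' / 2 in
  [:: ((freq e + freq e')%N, v, B);
      ((freq e - freq e' + (freq e' - freq e))%N, v, B)].

Definition waves_mul L L' := flatten [seq wave_mul e e' | e <- L, e' <- L'].

Definition waves_conv F G n :=
  flatten [seq waves_mul (F i) (G (n - i)%N) | i <- index_iota 0 n.+1].

Definition waves_scale (g : R3 R -> R) (M : R) L : seq wave :=
  [seq (freq e, (fun x => g x * amplitude e x), M * size_bound e) | e <- L].

Lemma cos_mul (a b : R) : cos a * cos b = (cos (a + b) + cos (a - b)) / 2.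
Proof. by rewrite cosD cosB; field. Qed.

Lemma superpose_mul L L' t x :
  superpose (waves_mul L L') t x = superpose L t x * superpose L' t x.
Proof.
rewrite /superpose /waves_mul big_flatten/= big_allpairs_dep mulr_suml.
apply: eq_bigr => e _; rewrite mulr_sumr; apply: eq_bigr => e' _.
rewrite !big_cons big_nil /freq /amplitude /= addr0.
set k := e.1.1; set k' := e'.1.1.
have -> : cos (omega * (k - k' + (k' - k))%N%:R * t) =
    cos (omega * k%:R * t - omega * k'%:R * t).
  have [kk|kk] := leqP k k'.
    rewrite (eqP kk) add0n natrB// -cosN; congr (cos _); ring.
  rewrite (eqP (ltnW kk)) addn0 natrB ?(ltnW kk)//; congr (cos _); ring.
have -> : omega * (k + k')%N%:R * t = omega * k%:R * t + omega * k'%:R * t.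
  by rewrite natrD; ring.
by rewrite [RHS]mulrACA cos_mul; field.
Qed.

Lemma mass_mul L L' : mass (waves_mul L L') = mass L * mass L'.
Proof.
rewrite /mass /waves_mul big_flatten/= big_allpairs_dep mulr_suml.
apply: eq_bigr => e _; rewrite mulr_sumr; apply: eq_bigr => e' _.
by rewrite !big_cons big_nil /size_bound /= addr0; field.
Qed.

Lemma superpose_conv F G n t x : superpose (waves_conv F G n) t x =
  conv (fun i => superpose (F i) t x) (fun i => superpose (G i) t x) n.
Proof.
rewrite {1}/superpose /waves_conv big_flatten big_map /conv.
by apply: eq_bigr => i _; rewrite -superpose_mul.
Qed.

Lemma mass_conv F G n : mass (waves_conv F G n) =
  conv (fun i => mass (F i)) (fun i => mass (G i)) n.
Proof.
rewrite {1}/mass /waves_conv big_flatten big_map /conv.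
by apply: eq_bigr => i _; rewrite -mass_mul.
Qed.

Lemma superpose_scale g M L t x :
  superpose (waves_scale g M L) t x = g x * superpose L t x.
Proof.
rewrite /superpose /waves_scale big_map mulr_sumr; apply: eq_bigr => e _.
by rewrite /freq /amplitude/= mulrCA.
Qed.

Lemma mass_scale g M L : mass (waves_scale g M L) = M * mass L.
Proof. by rewrite /mass /waves_scale big_map mulr_sumr. Qed.

(** Products of three waves with [p = 1] satisfy this with [p = 3], the decay for which
    the linearized operators can be inverted. *)
Definition decays p K e := [/\ (freq e <= K)%N, radial (amplitude e),
  continuous (amplitude e) &
  forall x, X1_weight x ^+ p * `|amplitude e x| <= size_bound e].

Lemma decays_ge0 p K e : decays p K e -> 0 <= size_bound e.
Proof.
move=> [_ _ _ /(_ 0)]; apply: le_trans.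
by rewrite mulr_ge0// exprn_ge0// ltW// X1_weight_gt0.
Qed.

Lemma mass_ge0 p K L : {in L, forall e, decays p K e} -> 0 <= mass L.
Proof.
move=> H; rewrite /mass big_seq; apply: sumr_ge0 => e /H; exact: decays_ge0.
Qed.

Lemma decays_mul p q K K' L L' : {in L, forall e, decays p K e} ->
  {in L', forall e, decays q K' e} ->
  {in waves_mul L L', forall e, decays (p + q) (K + K') e}.
Proof.
move=> HL HL' e /flattenP[l /allpairsP[[e1 e2]/= [/HL[k1 r1 c1 b1] /HL'[k2 r2 c2 b2] ->]]].
have rv : radial (fun x => amplitude e1 x * amplitude e2 x / 2).
  by move=> x y xy; rewrite (r1 x y xy) (r2 x y xy).
have cv : continuous (fun x => amplitude e1 x * amplitude e2 x / 2).
  move=> x; apply: cvgM; last exact: cvg_cst.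
  by apply: cvgM; [exact: c1|exact: c2].
have bv x : X1_weight x ^+ (p + q) * `|amplitude e1 x * amplitude e2 x / 2| <=
    size_bound e1 * size_bound e2 / 2.
  rewrite 2!normrM (ger0_norm (x := 2^-1)) ?invr_ge0// mulrA ler_wpM2r ?invr_ge0//.
  rewrite exprD mulrACA ler_pM// ?mulr_ge0// ?exprn_ge0// ltW// X1_weight_gt0//.
by rewrite !inE => /orP[] /eqP ->; split => //; rewrite /freq/=;
  move: k1 k2; rewrite /freq; lia.
Qed.

Lemma decays_conv p q F G n s : (forall i, {in F i, forall e, decays p (s * i) e}) ->
  (forall i, {in G i, forall e, decays q (s * i) e}) ->
  {in waves_conv F G n, forall e, decays (p + q) (s * n) e}.
Proof.
move=> HF HG e /flattenP[l /mapP[i + ->]]; rewrite mem_index_iota => /andP[_ iN] eL.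
rewrite -[n in decays _ (s * n) e](subnKC (m := i))// mulnDr.
exact: (decays_mul (HF i) (HG (n - i)%N)).
Qed.

Lemma decays_scale p K (g : R3 R -> R) M L : radial g -> continuous g ->
  (forall x, `|g x| <= M) -> {in L, forall e, decays p K e} ->
  {in waves_scale g M L, forall e, decays p K e}.
Proof.
move=> rg cg gM HL e /mapP[e' /HL[k1 r1 c1 b1] ->]; split => //.
- by move=> x y xy; rewrite /amplitude/= (rg x y xy) -!/(amplitude e' _) (r1 x y xy).
- by move=> x; apply: cvgM; [exact: cg|exact: c1].
- move=> x; rewrite /amplitude /size_bound/= normrM mulrCA ler_pM// ?mulr_ge0//.
  by rewrite exprn_ge0// ltW// X1_weight_gt0.
Qed.

Variables (m MG q0 C0 : R) (Gamma w0 : R3 R -> R).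
Hypotheses (rG : radial Gamma) (cG : continuous Gamma) (q0_ge0 : 0 <= q0).
Hypothesis GM : forall x, `|Gamma x| <= MG.
Hypothesis C0_ge0 : 0 <= C0.

Definition stationary_operator k v x :=
  - laplacian v x + (m ^+ 2 - (omega * k%:R) ^+ 2) * v x.

Local Notation mode e :=
  (radial_mode (q0 * (1 + (freq e)%:R ^+ 2)) (size_bound e) (amplitude e)).

Variable S : wave -> R3 R -> R.
Hypothesis S_mode : forall K e, decays 3 K e ->
  radial_mode (q0 * (1 + (freq e)%:R ^+ 2)) (C0 * size_bound e) (S e).
Hypothesis S_inverse : forall K e x, decays 3 K e ->
  stationary_operator (freq e) (S e) x =
  3 * Gamma x * w0 x ^+ 2 * S e x + amplitude e x.

Variables (B0 B1 : R) (s : nat) (phi : R3 R -> R).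
Hypothesis w0_mode : radial_mode q0 B0 w0.
Hypothesis w0_eq : forall x, stationary_operator 0 w0 x = Gamma x * w0 x ^+ 3.
Hypothesis phi_mode : radial_mode (q0 * (1 + s%:R ^+ 2)) B1 phi.
Hypothesis phi_eq : forall x,
  stationary_operator s phi x = 3 * Gamma x * w0 x ^+ 2 * phi x.

Lemma mode_decays K e : (freq e <= K)%N -> mode e -> decays 1 K e.
Proof.
by move=> eK [d1 [d2 [[_ _ cv _ _] rv vB _]]]; split => // x; rewrite expr1.
Qed.

Let solve L : seq wave := [seq (freq e, S e, C0 * size_bound e) | e <- L].

Let step n F : seq wave :=
  if n is 0 then [:: (0%N, w0, B0)] else
  if n is 1 then [:: (s, phi, B1)] else
  let G := truncated [::] F n in
  solve (waves_scale Gamma MG (waves_conv (waves_conv G G) G n)).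

(** Lindstedt series: at order [n] the linearized equation is solved with the
    source produced by the lower orders. *)
Lemma formal_solution : exists L : nat -> seq wave,
  [/\ L 0%N = [:: (0%N, w0, B0)], L 1%N = [:: (s, phi, B1)],
    forall n, {in L n, forall e, (freq e <= s * n)%N /\ mode e},
    exists2 ka : R, 0 < ka & exists2 B : R, 0 <= B & forall n, mass (L n) <= B * ka ^+ n &
    forall n t x, let p i := superpose (L i) t x in
      \sum_(e <- L n) cos (omega * (freq e)%:R * t) *
        stationary_operator (freq e) (amplitude e) x =
      Gamma x * conv (conv p p) p n].
Proof.
have [|L LE] := @course_of_values (seq wave) [::] step.
  move=> [|[|n]] F G FG //=; congr (solve (waves_scale _ _ _)).
  have -> // : truncated [::] F n.+2 = truncated [::] G n.+2.
  by apply/funext => i; rewrite /truncated; case: ifP => // /FG.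
have L0 : L 0%N = [:: (0%N, w0, B0)] by rewrite LE.
have L1 : L 1%N = [:: (s, phi, B1)] by rewrite LE.
have LS n : let G := truncated [::] L n.+2 in
  L n.+2 = solve (waves_scale Gamma MG (waves_conv (waves_conv G G) G n.+2)).
  by rewrite LE.
have Lmode n : {in L n, forall e, (freq e <= s * n)%N /\ mode e}.
  elim/ltn_ind: n => -[|[|n]] IH.
  - rewrite L0 => e; rewrite inE => /eqP ->; split => //.
    by rewrite /freq /amplitude/= expr0n addr0 mulr1.
  - by rewrite L1 => e; rewrite inE => /eqP ->; rewrite muln1.
  pose G := truncated [::] L n.+2.
  have HG i : {in G i, forall e, decays 1 (s * i) e}.
    rewrite /G /truncated; case: ifP => // iN e eL.
    by have [h1 h2] := IH i iN e eL; exact: mode_decays.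
  have H := decays_scale rG cG GM (decays_conv (n := n.+2) (fun i => decays_conv (n := i) HG HG) HG).
  rewrite LS => e /mapP[e' /H De' ->]; split; first by have [] := De'.
  exact: S_mode De'.
have Ldec n : {in L n, forall e, decays 1 (s * n) e}.
  by move=> e eL; have [h1 h2] := Lmode n e eL; exact: mode_decays.
have Gdec n i : {in truncated [::] L n i, forall e, decays 1 (s * i) e}.
  by rewrite /truncated; case: ifP => // _; exact: Ldec.
have Sdec n := decays_scale rG cG GM
  (decays_conv (n := n) (fun i => decays_conv (n := i) (Gdec n) (Gdec n)) (Gdec n)).
have MG0 : 0 <= MG by exact: le_trans (GM 0).
have truncE (f : seq wave -> R) n : f [::] = 0 ->
    (fun i => f (truncated [::] L n i)) = truncated 0 (fun i => f (L i)) n.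
  by move=> f0; apply/funext => i; rewrite /truncated; case: ifP.
exists L; split => //.
  apply: (@majorant _ (fun n => mass (L n)) (C0 * MG)).
  - by move=> n; exact: mass_ge0 (Ldec n).
  - exact: mulr_ge0.
  move=> [|[|n]]// _ /=; set b := truncated _ _ _; rewrite LS.
  rewrite /mass big_map -mulr_sumr -/(mass _) mass_scale mass_conv.
  have -> : (fun i => mass (waves_conv (truncated [::] L n.+2) (truncated [::] L n.+2) i))
      = conv b b.
    by apply/funext => i; rewrite mass_conv (truncE mass)// /mass big_nil.
  by rewrite (truncE mass) ?mulrA// /mass big_nil.
move=> n t x p.
have p0 : p 0%N = w0 x.
  by rewrite /p L0 /superpose big_seq1 /freq /amplitude/= mulr0 mul0r cos0 mul1r.
case: n => [|[|n]].
- rewrite L0 big_seq1 /freq /amplitude/= mulr0 mul0r cos0 mul1r w0_eq.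
  by rewrite /conv !big_nat1 subnn p0; ring.
- rewrite conv3_split// p0 L1 big_seq1 /freq /amplitude/= phi_eq.
  rewrite [p 1%N]/p L1 /superpose big_seq1 /freq /amplitude/=.
  have -> : conv (conv (truncated 0 p 1) (truncated 0 p 1)) (truncated 0 p 1) 1 = 0.
    by rewrite /conv !big_nat_recr//= !big_geq//= /truncated/= !(mulr0, mul0r, addr0).
  ring.
rewrite conv3_split// p0.
have -> : conv (conv (truncated 0 p n.+2) (truncated 0 p n.+2)) (truncated 0 p n.+2) n.+2 =
    superpose (waves_conv (waves_conv (truncated [::] L n.+2) (truncated [::] L n.+2))
      (truncated [::] L n.+2) n.+2) t x.
  rewrite superpose_conv; congr (conv _ _ _).
    apply/funext => i; rewrite superpose_conv.
    by rewrite (truncE (fun l => superpose l t x)) // /superpose big_nil.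
  by rewrite (truncE (fun l => superpose l t x)) // /superpose big_nil.
have -> : p n.+2 = \sum_(e <- waves_scale Gamma MG (waves_conv (waves_conv
    (truncated [::] L n.+2) (truncated [::] L n.+2)) (truncated [::] L n.+2) n.+2))
    cos (omega * (freq e)%:R * t) * S e x.
  by rewrite /p LS /superpose big_map.
rewrite mulrDr -(superpose_scale _ MG) (LS n) big_map.
rewrite [X in _ = _ + X]/superpose.
rewrite -!mulrA [in Gamma x * _]mulrCA !mulrA !mulr_sumr -big_split/= big_seq [RHS]big_seq; apply: eq_bigr => e /Sdec De.
by rewrite /freq /amplitude/= (S_inverse _ De) /freq /amplitude; ring.
Qed.

End waves.

(** * The linearized operators *)

Section linearization.
Context {R : realType}.
Implicit Types (x : R3 R).
Local Notation wave := (nat * (R3 R -> R) * R)%type.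
Variables (Gamma : R3 R -> R) (omega m MG : R) (w0 : X1 R).
Hypotheses (rG : radial Gamma) (cG : continuous Gamma).
Hypothesis GM : forall x, `|Gamma x| <= MG.
Hypotheses (m_gt0 : 0 < m) (m_lt_omega : m < omega).
Hypothesis w0_nondegenerate : forall q0 : X1 R,
  distributional_solution m q0 (fun x => 3 * Gamma x * w0 x ^+ 2 * q0 x) -> q0 = 0.

Let V x := 3 * Gamma x * w0 x ^+ 2.
Let CV := 3 * MG * `|w0| ^+ 2.
Let q0 := omega ^+ 2 + m ^+ 2 + CV.
Let mu k := Num.sqrt ((omega * k%:R) ^+ 2 - m ^+ 2).

Let MG_ge0 : 0 <= MG. Proof. exact: le_trans (GM 0). Qed.

Let CV_ge0 : 0 <= CV. Proof. by rewrite !mulr_ge0// exprn_ge0. Qed.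

Let rV : radial V.
Proof. by move=> x y xy; rewrite /V (rG xy) (X1_radial w0 xy). Qed.

Let cV : continuous V.
Proof.
move=> x; have cw : {for x, continuous w0} by exact: X1_continuous.
by apply: cvgM; [apply: cvgM; [exact: cvg_cst|exact: cG]|apply: cvgM; exact: cw].
Qed.

Let VC x : X1_weight x ^+ 2 * `|V x| <= CV.
Proof.
rewrite /V 2!normrM (normr_nat _ 3) normrX mulrCA -exprMn.
have h0 : 0 <= X1_weight x * `|w0 x| by rewrite mulr_ge0// ltW// X1_weight_gt0.
have h1 : 3 * `|Gamma x| <= 3 * MG by rewrite ler_pM2l.
have h2 : (X1_weight x * `|w0 x|) ^+ 2 <= `|w0| ^+ 2.
  by rewrite lerXn2r ?nnegrE// X1_norm_ub.
have h3 : 0 <= (X1_weight x * `|w0 x|) ^+ 2 by exact: exprn_ge0.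
have h4 : 0 <= 3 * `|Gamma x| by exact: mulr_ge0.
exact: ler_pM.
Qed.

Let omega_gt0 : 0 < omega. Proof. exact: lt_trans m_lt_omega. Qed.

Let mu_sqr k : (0 < k)%N -> mu k ^+ 2 = (omega * k%:R) ^+ 2 - m ^+ 2.
Proof.
move=> k0; rewrite sqr_sqrtr// subr_ge0 lerXn2r ?nnegrE ?mulr_ge0 ?(ltW omega_gt0) ?(ltW m_gt0)//.
by apply: (le_trans (ltW m_lt_omega)); rewrite ler_peMr ?(ltW omega_gt0)// ler1n.
Qed.

Let mu1_gt0 : 0 < mu 1.
Proof. by rewrite sqrtr_gt0 mulr1 subr_gt0 ltrXn2r// ?nnegrE ltW. Qed.

Let mu_ge k : (0 < k)%N -> mu 1 <= mu k.
Proof.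
move=> k0; rewrite ler_wsqrtr// lerD2r lerXn2r ?nnegrE ?mulr_ge0 ?(ltW omega_gt0)//.
by rewrite ler_wpM2l ?(ltW omega_gt0)// ler_nat.
Qed.

Let q_le k : (0 < k)%N -> mu k ^+ 2 + CV <= q0 * (1 + k%:R ^+ 2).
Proof.
move=> k0; rewrite mu_sqr// /q0 exprMn.
have k2 : 0 <= k%:R ^+ 2 :> R by rewrite sqr_ge0.
have := mulr_ge0 CV_ge0 k2; have := mulr_ge0 (sqr_ge0 m) k2.
have := sqr_ge0 m; have := sqr_ge0 omega; lra.
Qed.

Lemma frequency_bound_ge0 : 0 <= q0.
Proof. by rewrite !addr_ge0// sqr_ge0. Qed.

(** At wave number zero this is [zero_modes], where the kernel is trivial by
    nondegeneracy; at the others it is [oscillatory_modes], where among the many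
    solutions the one with value 0 at the origin is taken. *)
Lemma right_inverse : exists2 C : R, 0 <= C & exists S : wave -> R3 R -> R,
  forall K e, decays 3 K e ->
    radial_mode (q0 * (1 + (freq e)%:R ^+ 2)) (C * size_bound e) (S e) /\
    forall x, stationary_operator omega m (freq e) (S e) x =
      3 * Gamma x * w0 x ^+ 2 * S e x + amplitude e x.
Proof.
have [Co Co0 Ho] := oscillatory_modes mu1_gt0 CV_ge0.
have [|Cz Cz0 Hz] := zero_modes m_gt0 CV_ge0 rV cV VC.
  move=> B v [d1 [d2 [vC rv vB _]]] lv x; have [_ _ cv _ _] := vC.
  have [q qv _] := X1_exists rv cv vB.
  suff -> : v = X1_fun (0 : X1 R) by [].
  rewrite -(w0_nondegenerate (q0 := q)) -?qv// qv.
  by apply: (distributional_of_classical vC) => z; rewrite lv /V; ring.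
exists (Co + Cz); first exact: addr_ge0.
suff H e : exists v, forall K, decays 3 K e ->
    radial_mode (q0 * (1 + (freq e)%:R ^+ 2)) ((Co + Cz) * size_bound e) v /\
    forall x, stationary_operator omega m (freq e) v x =
      3 * Gamma x * w0 x ^+ 2 * v x + amplitude e x.
  by have [S HS] := choice H; exists S => K e; exact: HS.
have [[K De]|nD] := pselect (exists K, decays 3 K e); last first.
  by exists (fun _ => 0) => K De; case: nD; exists K.
have B0 := decays_ge0 De; have [_ rf cf fB] := De.
have [k0|k0] := posnP (freq e).
  have [v [vm lv]] := Hz _ _ B0 rf cf fB; exists v => _ _; split.
    apply: radial_mode_le vm.
    - by rewrite addr_ge0// sqr_ge0.
    - by rewrite k0 expr0n addr0 mulr1 /q0 -addrA lerDr sqr_ge0.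
    - by rewrite ler_wpM2r// lerDr.
  by move=> x; rewrite /stationary_operator lv k0 /V; ring.
have [v [vm _ lv]] := Ho (mu (freq e)) 0 _ V _ (mu_ge k0) B0 rV cV rf cf VC fB.
exists v => _ _; split.
  rewrite normr0 addr0 in vm; apply: radial_mode_le vm.
  - by rewrite addr_ge0// sqr_ge0.
  - exact: q_le.
  - by rewrite ler_wpM2r// lerDl.
by move=> x; rewrite /stationary_operator lv mu_sqr// /V; ring.
Qed.

(** Above the threshold every radial solution decays, in particular the one with
    value 1 at the origin: the kernel is never trivial. *)
Lemma resonant_mode s : (0 < s)%N -> exists B phi,
  [/\ radial_mode (q0 * (1 + s%:R ^+ 2)) B phi, phi 0 = 1 &
    forall x, stationary_operator omega m s phi x =
      3 * Gamma x * w0 x ^+ 2 * phi x].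
Proof.
move=> s0; have [Co Co0 Ho] := oscillatory_modes mu1_gt0 CV_ge0.
have c0 : continuous (fun _ : R3 R => (0 : R)) by exact: cst_continuous.
have r0 : radial (fun _ : R3 R => (0 : R)) by [].
have [|v [vm v0 lv]] := Ho (mu s) 1 0 V _ (mu_ge s0) (lexx 0) rV cV r0 c0 VC.
  by move=> x; rewrite normr0 mulr0.
exists (Co * (0 + `|1|)), v; split => //.
  apply: radial_mode_le vm => //; last exact: q_le.
  by rewrite addr_ge0// sqr_ge0.
by move=> x; rewrite /stationary_operator lv mu_sqr// /V; ring.
Qed.

End linearization.

(** * Regularity of superpositions *)

Section mode_superposition.
Context {R : realType}.
Implicit Types (x : R3 R) (t a : R).
Local Notation wave := (nat * (R3 R -> R) * R)%type.
Variables (omega m q0 : R).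
Hypotheses (omega_gt0 : 0 < omega) (q0_ge0 : 0 <= q0).
Implicit Types (e : wave) (L : seq wave).

Local Notation mode e :=
  (radial_mode (q0 * (1 + (freq e)%:R ^+ 2)) (size_bound e) (amplitude e)).
Local Notation modes K L := {in L, forall e, (freq e <= K)%N /\ mode e}.

Definition X1_of (v : R3 R -> R) : X1 R := insubd (0 : X1 R) v.

Lemma X1_ofE q (B : R) v : radial_mode q B v -> X1_fun (X1_of v) = v /\ `|X1_of v| <= B.
Proof.
move=> [d1 [d2 [[_ _ cv _ _] rv vB _]]].
have E : X1_fun (X1_of v) = v.
  rewrite /X1_of -[X1_fun _]/(val _) val_insubd ifT//.
  by rewrite inE; split => //; exists B => _ [x _ <-].
by split => //; apply: X1_norm_le => x; rewrite E.
Qed.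

Lemma mode_bound_ge0 q (B : R) v : radial_mode q B v -> 0 <= B.
Proof. by move=> /X1_ofE[_]; exact: le_trans. Qed.

(** [j]-th time derivative of a superposition, with values in [X1]: every
    differentiation multiplies by the frequency and shifts the phase by [pi / 2]. *)
Definition harmonic j L t : X1 R := \sum_(e <- L)
  ((omega * (freq e)%:R) ^+ j * cos (omega * (freq e)%:R * t + j%:R * (pi / 2)))
    *: X1_of (amplitude e).

Let freq_ge0 e : 0 <= omega * (freq e)%:R.
Proof. by rewrite mulr_ge0// ltW. Qed.

Let freq_le j K e : (freq e <= K)%N ->
  (omega * (freq e)%:R) ^+ j <= (omega * K%:R) ^+ j.
Proof.
move=> eK; rewrite lerXn2r ?nnegrE// ?mulr_ge0 ?(ltW omega_gt0)//.
by rewrite ler_wpM2l ?(ltW omega_gt0)// ler_nat.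
Qed.

Lemma harmonic_le j K L t : modes K L ->
  `|harmonic j L t| <= (omega * K%:R) ^+ j * mass L.
Proof.
move=> HL; rewrite /harmonic /mass mulr_sumr; apply: (le_trans (ler_norm_sum _ _ _)).
rewrite big_seq [leRHS]big_seq; apply: ler_sum => e /HL[eK em].
have [_ eB] := X1_ofE em.
rewrite normrZ normrM; apply: ler_pM => //.
rewrite -[leRHS]mulr1; apply: ler_pM => //.
  by rewrite ger0_norm ?exprn_ge0// freq_le.
by rewrite ler_norml cos_geN1 cos_le1.
Qed.

Lemma cos_lipschitz (x y : R) : `|cos x - cos y| <= `|x - y|.
Proof.
wlog yx : x y / y <= x.
  move=> H; have [|xy] := leP y x; first exact: H.
  by rewrite distrC [leRHS]distrC; apply: H; exact: ltW.
rewrite [leRHS]ger0_norm ?subr_ge0// -[leRHS]mul1r.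
apply: (@derive_bound _ cos (fun z => - sin z)) => // z _.
by rewrite normrN ler_norml sin_geN1 sin_le1.
Qed.

Lemma harmonic_lipschitz j K L t h : modes K L ->
  `|harmonic j L (h + t) - harmonic j L t| <= `|h| * ((omega * K%:R) ^+ j.+1 * mass L).
Proof.
move=> HL; rewrite /harmonic /mass -sumrB [leRHS]mulrA mulr_sumr.
apply: (le_trans (ler_norm_sum _ _ _)).
rewrite big_seq [leRHS]big_seq; apply: ler_sum => e /HL[eK em].
have [_ eB] := X1_ofE em.
rewrite -scalerBl normrZ; apply: ler_pM => //.
rewrite -mulrBr normrM ger0_norm ?exprn_ge0//.
apply: (le_trans (ler_wpM2l _ (cos_lipschitz _ _))); first exact: exprn_ge0.
have -> : omega * (freq e)%:R * (h + t) + j%:R * (pi / 2) -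
    (omega * (freq e)%:R * t + j%:R * (pi / 2)) = omega * (freq e)%:R * h by ring.
by rewrite normrM (ger0_norm (freq_ge0 e)) mulrA -exprSr mulrC ler_wpM2l// freq_le.
Qed.

Lemma harmonic_derive j L t :
  is_derive t (1:R) (harmonic j L) (harmonic j.+1 L t).
Proof.
have D e : is_derive t (1:R) (fun t : R => ((omega * (freq e)%:R) ^+ j *
      cos (omega * (freq e)%:R * t + j%:R * (pi / 2))) *: X1_of (amplitude e))
    (((omega * (freq e)%:R) ^+ j.+1 *
      cos (omega * (freq e)%:R * t + j.+1%:R * (pi / 2))) *: X1_of (amplitude e)).
  set ka := omega * (freq e)%:R; set v := X1_of (amplitude e).
  have bl : bounded_linear (fun c : R => c *: v) `|v|.
    by split => [c d d'|d]; rewrite ?scalerDl ?scalerA// normrZ mulrC.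
  have Dl : is_derive t (1:R) (fun t : R => ka * t + j%:R * (pi / 2)) ka.
    by apply: is_derive_eq; rewrite -![_ *: _]/(_ * _); ring.
  have Dc : is_derive t (1:R) (fun t : R => cos (ka * t + j%:R * (pi / 2)))
      (- sin (ka * t + j%:R * (pi / 2)) * ka).
    exact: (@is_derive1_comp _ cos (fun t : R => ka * t + j%:R * (pi / 2))).
  have Dm : is_derive t (1:R) (fun t : R => ka ^+ j * cos (ka * t + j%:R * (pi / 2)))
      (ka ^+ j.+1 * cos (ka * t + j.+1%:R * (pi / 2))).
    apply: is_derive_eq.
    have -> : ka * t + j.+1%:R * (pi / 2) = ka * t + j%:R * (pi / 2) + pi / 2.
      by rewrite -natr1; ring.
    rewrite cosDpihalf exprSr -![_ *: _]/(_ * _); ring.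
  exact: (bounded_linear_derive bl Dm).
rewrite /harmonic; elim: L => [|e L IH].
  rewrite big_nil; have -> : (fun t : R => \sum_(e <- [::])
      ((omega * (freq e)%:R) ^+ j * cos (omega * (freq e)%:R * t + j%:R * (pi / 2)))
      *: X1_of (amplitude e)) = cst 0 by apply/funext => u; rewrite big_nil.
  exact: is_derive_cst.
rewrite big_cons; under eq_fun do rewrite big_cons.
by apply: is_deriveD.
Qed.

Lemma harmonic_superpose K L t x : modes K L ->
  X1_fun (harmonic 0 L t) x = superpose omega L t x.
Proof.
move=> HL; rewrite /harmonic /superpose.
have ev := evaluation_bounded x.
have -> : forall F : wave -> X1 R, X1_fun (\sum_(e <- L) F e) x = \sum_(e <- L) X1_fun (F e) x.
  move=> F; elim: L {HL} => [|e L IH]; first by rewrite !big_nil.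
  by rewrite !big_cons -IH.
rewrite big_seq [RHS]big_seq; apply: eq_bigr => e /HL[_ em].
have [E _] := X1_ofE em.
by rewrite (bounded_linearZ ev) E expr0 mul1r mul0r addr0.
Qed.

Lemma superpose_le K L t x : modes K L -> `|superpose omega L t x| <= mass L.
Proof.
move=> HL; rewrite -(harmonic_superpose _ _ HL).
have := (evaluation_bounded x).2 (harmonic 0 L t); rewrite mul1r => /le_trans; apply.
by have := harmonic_le 0 t HL; rewrite expr0 mul1r.
Qed.

(** The amplitude of [cos (omega k t)], in the normalization of a cosine series
    whose nonconstant terms carry a factor 2. *)
Definition coef L k : X1 R := \sum_(e <- L)
  (if freq e == k then (if k == 0%N then 1 else 2^-1) else 0) *: X1_of (amplitude e).

Lemma coef_partial K L N : modes K L ->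
  series (Num.norm \o coef L) N <= mass L.
Proof.
move=> HL; pose c e k : R := if freq e == k then (if k == 0%N then 1 else 2^-1) else 0.
have c0 e k : 0 <= c e k by rewrite /c; case: ifP => // _; case: ifP.
apply: (@le_trans _ _ (\sum_(0 <= k < N) \sum_(e <- L) c e k * size_bound e)).
  apply: ler_sum => k _; apply: (le_trans (ler_norm_sum _ _ _)).
  rewrite big_seq [leRHS]big_seq; apply: ler_sum => e /HL[_ em].
  have [_ eB] := X1_ofE em.
  by rewrite normrZ ger0_norm ?ler_wpM2l// c0.
rewrite exchange_big/= /mass big_seq [leRHS]big_seq; apply: ler_sum => e /HL[_ em].
rewrite -mulr_suml ler_piMl ?(mode_bound_ge0 em)//.
apply: (@le_trans _ _ (\sum_(0 <= k < N | k == freq e) 1)).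
  rewrite [leRHS]big_mkcond; apply: ler_sum => k _; rewrite /c eq_sym.
  by case: ifP => // _; case: ifP => // _; rewrite invf_le1// ler1n.
by rewrite big_nat1_eq; case: ifP.
Qed.

End mode_superposition.
Section joint_regularity.
Context {R : realType}.
Implicit Types (x : R3 R) (p V W : R * R3 R).

Lemma is_derive_time (f df : R -> R) p V : (forall t : R, is_derive t (1:R) f (df t)) ->
  is_derive p V (fun p => f p.1) (V.1 * df p.1).
Proof.
move=> fD; apply: (is_derive_line0 _ _ _ _).2 => /=.
have Dl : is_derive (0:R) (1:R) (fun h : R => h * V.1 + p.1) V.1.
  by apply: is_derive_eq; rewrite -![_ *: _]/(_ * _); ring.
have Df : is_derive (0 * V.1 + p.1) (1:R) f (df p.1) by rewrite mul0r add0r.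
by rewrite mulrC; exact: (@is_derive1_comp _ f _ 0 _ _ Df Dl).
Qed.

Lemma is_derive_space (g : R3 R -> R) p V d :
  is_derive p.2 V.2 g d -> is_derive p V (fun p => g p.2) d.
Proof. by move=> /(is_derive_line0 _ _ _ _).1 H; apply: (is_derive_line0 _ _ _ _).2. Qed.

Definition wave_d1 (ka : R) (v : R3 R -> R) d1 V p : R :=
  V.1 * (- ka * sin (ka * p.1)) * v p.2 + cos (ka * p.1) * d1 V.2 p.2.

Definition wave_d2 (ka : R) (v : R3 R -> R) d1 d2 V W p : R :=
  V.1 * W.1 * (- ka ^+ 2 * cos (ka * p.1)) * v p.2
  + V.1 * (- ka * sin (ka * p.1)) * d1 W.2 p.2
  + (W.1 * (- ka * sin (ka * p.1)) * d1 V.2 p.2 + cos (ka * p.1) * d2 V.2 W.2 p.2).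

Lemma wave_is_C2 (ka : R) v d1 d2 : is_C2 v d1 d2 ->
  is_C2 (fun p => cos (ka * p.1) * v p.2) (wave_d1 ka v d1) (wave_d2 ka v d1 d2).
Proof.
move=> [v1 v2 cv c1 c2].
have Dl (t : R) : is_derive t (1:R) (fun t : R => ka * t) ka.
  by apply: is_derive_eq; rewrite -![_ *: _]/(_ * _); ring.
have Dcos (t : R) : is_derive t (1:R) (fun t : R => cos (ka * t)) (- ka * sin (ka * t)).
  by rewrite mulNr mulrC -mulNr; exact: (@is_derive1_comp _ cos (fun t : R => ka * t)).
have Dsin (t : R) : is_derive t (1:R) (fun t : R => - ka * sin (ka * t))
    (- ka ^+ 2 * cos (ka * t)).
  have H : is_derive t (1:R) (fun t : R => sin (ka * t)) (cos (ka * t) * ka).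
    exact: (@is_derive1_comp _ sin (fun t : R => ka * t)).
  by apply: is_derive_eq; rewrite -![_ *: _]/(_ * _); ring.
have ct (f df : R -> R) : (forall t : R, is_derive t (1:R) f (df t)) ->
    continuous (fun p : R * R3 R => f p.1).
  move=> fD p; apply: (@continuous_comp _ _ _ (fun p : R * R3 R => p.1) f).
    exact: cvg_fst.
  exact: (is_derive_continuous fD).
have cs (g : R3 R -> R) : continuous g -> continuous (fun p : R * R3 R => g p.2).
  move=> cg p; apply: (@continuous_comp _ _ _ (fun p : R * R3 R => p.2) g).
    exact: cvg_snd.
  exact: cg.
have cC := ct _ _ Dcos; have cS := ct _ _ Dsin.
split.
- move=> p V; have A := is_derive_time p V Dcos.
  have Bv := is_derive_space (v1 p.2 V.2).
  have /is_derive_eq := is_deriveM A Bv; apply.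
  by rewrite /wave_d1 -![_ *: _]/(_ * _); ring.
- move=> p V W; rewrite /wave_d1.
  have A := is_derive_time p W Dcos; have A' := is_derive_time p W Dsin.
  have Bv := is_derive_space (v1 p.2 W.2).
  have B1 := is_derive_space (v2 p.2 V.2 W.2).
  have cV := is_derive_cst V.1 p W.
  have P1 := is_deriveM (is_deriveM cV A') Bv; have P2 := is_deriveM A B1.
  have /is_derive_eq := is_deriveD P1 P2; apply.
  by rewrite /wave_d2 /GRing.mul/= -![_ *: _]/(_ * _) -!/(GRing.mul _ _); ring.
- by move=> p; apply: cvgM; [exact: cC|exact: cs].
- move=> V p; apply: cvgD; apply: cvgM; try exact: cC; try exact: cs.
  by apply: cvgM; [exact: cvg_cst|exact: cS].
- move=> V W p; apply: cvgD; apply: cvgD; apply: cvgM; try exact: cC; try exact: cs.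
  + apply: cvgM; first exact: cvg_cst.
    by apply: cvgM; [exact: cvg_cst|exact: cC].
  + by apply: cvgM; [exact: cvg_cst|exact: cS].
  + by apply: cvgM; [exact: cvg_cst|exact: cS].
Qed.

Lemma wave_C2_bound (ka X B : R) v d1 d2 : 0 <= ka -> 0 <= B ->
  C2_bound v d1 d2 X B ->
  C2_bound (fun p => cos (ka * p.1) * v p.2) (wave_d1 ka v d1) (wave_d2 ka v d1 d2)
    X ((1 + ka) ^+ 2 * B).
Proof.
move=> ka0 B0 HB p pX.
have [p1 p2] : `|p.1| <= `|p| /\ `|p.2| <= `|p|.
  by rewrite [`|p|]prod_normE; split; rewrite le_max lexx ?orbT.
have [b0 b1 b2] := HB p.2 (le_trans p2 pX).
have cos1 : `|cos (ka * p.1)| <= 1 by rewrite ler_norml cos_geN1 cos_le1.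
have sin1 : `|sin (ka * p.1)| <= 1 by rewrite ler_norml sin_geN1 sin_le1.
have n12 V : `|V.1| <= `|V| /\ `|V.2| <= `|V|.
  by rewrite [`|V|]prod_normE; split; rewrite le_max lexx ?orbT.
have kaB : 0 <= ka * B by rewrite mulr_ge0.
have ka2B : 0 <= ka * (ka * B) by rewrite mulr_ge0.
have prod3 (a b c A A' C : R) : `|a| <= A -> `|b| <= A' -> `|c| <= C ->
    `|a * b * c| <= A * A' * C.
  by move=> h1 h2 h3; rewrite !normrM !ler_pM ?mulr_ge0.
have kas : `|- ka * sin (ka * p.1)| <= ka.
  by rewrite mulNr normrN normrM (ger0_norm ka0) ler_piMr.
split.
- rewrite normrM; apply: (@le_trans _ _ (1 * B)); first by rewrite ler_pM.
  lra.
- move=> V; have [V1 V2] := n12 V; rewrite /wave_d1.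
  apply: (@le_trans _ _ (`|V| * ka * B + 1 * (B * `|V|))).
    rewrite (le_trans (ler_normD _ _))// lerD//; first exact: prod3.
    by rewrite normrM ler_pM// (le_trans (b1 _))// ler_wpM2l.
  have -> : `|V| * ka * B + 1 * (B * `|V|) = (ka * B + B) * `|V| by ring.
  by rewrite ler_wpM2r//; lra.
- move=> V W; have [V1 V2] := n12 V; have [W1 W2] := n12 W; rewrite /wave_d2.
  have VW : 0 <= `|V| * `|W| by rewrite mulr_ge0.
  have -> : (1 + ka) ^+ 2 * B * (`|V| * `|W|) =
    (`|V| * `|W|) * (ka * ka) * B + `|V| * ka * (B * `|W|)
    + (`|W| * ka * (B * `|V|) + 1 * (B * (`|V| * `|W|))) by ring.
  rewrite (le_trans (ler_normD _ _))// lerD// (le_trans (ler_normD _ _))// lerD//.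
  + apply: prod3 => //; first by rewrite normrM ler_pM.
    by rewrite mulNr normrN normrM normrX (ger0_norm ka0) expr2 ler_piMr ?mulr_ge0.
  + by apply: prod3 => //; rewrite (le_trans (b1 _))// ler_wpM2l.
  + by apply: prod3 => //; rewrite (le_trans (b1 _))// ler_wpM2l.
  + by rewrite normrM ler_pM// (le_trans (b2 _ _))// ler_wpM2l// ler_pM.
Qed.

Lemma C2_bound_le {E : normedModType R} (f : E -> R) d1 d2 (X B B' : R) : B <= B' ->
  C2_bound f d1 d2 X B -> C2_bound f d1 d2 X B'.
Proof.
move=> BB H x xX; have [h0 h1 h2] := H x xX; split; first exact: le_trans BB.
- by move=> v; rewrite (le_trans (h1 v))// ler_wpM2r.
- by move=> v w; rewrite (le_trans (h2 v w))// ler_wpM2r// mulr_ge0.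
Qed.

Lemma C2_boundD {E : normedModType R} (f g : E -> R) d1 d2 e1 e2 (X B B' : R) :
  C2_bound f d1 d2 X B -> C2_bound g e1 e2 X B' ->
  C2_bound (fun y => f y + g y) (fun v y => d1 v y + e1 v y)
    (fun v w y => d2 v w y + e2 v w y) X (B + B').
Proof.
move=> H H' x xX; have [h0 h1 h2] := H x xX; have [k0 k1 k2] := H' x xX.
by split=> [|v|v w]; rewrite (le_trans (ler_normD _ _))// ?mulrDl lerD.
Qed.

Lemma C2_boundZ {E : normedModType R} (c : R) (f : E -> R) d1 d2 (X B : R) :
  C2_bound f d1 d2 X B ->
  C2_bound (fun y => c * f y) (fun v y => c * d1 v y) (fun v w y => c * d2 v w y)
    X (`|c| * B).
Proof.
move=> H x xX; have [h0 h1 h2] := H x xX.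
by split=> [|v|v w]; rewrite normrM -?mulrA ler_wpM2l.
Qed.

Lemma is_C2_time (f : R * R3 R -> R) d1 d2 x : is_C2 f d1 d2 ->
  is_C2 (fun t : R => f (t, x)) (fun v t => d1 (v, 0) (t, x))
    (fun v w t => d2 (v, 0) (w, 0) (t, x)).
Proof.
move=> [f1 f2 cf c1 c2].
have line (g : R * R3 R -> R) (t v d : R) : is_derive (t, x) (v, 0) g d ->
    is_derive t v (fun t => g (t, x)) d.
  move=> /(is_derive_line0 _ _ _ _).1 H; apply: (is_derive_line0 _ _ _ _).2.
  rewrite (_ : (fun h : R => g (h *: v + t, x)) =
    (fun h : R => g (h *: (v, 0) + (t, x))))//.
  by apply/funext => h; congr (g (_, _)) => /=; rewrite scaler0 add0r.
have cnt (g : R * R3 R -> R) : continuous g -> continuous (fun t : R => g (t, x)).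
  move=> cg t; apply: (@continuous_comp _ _ _ (fun t : R => (t, x)) g).
    apply/cvgrPdist_le => e e0; have /cvgrPdist_le/(_ e e0) := @cvg_id _ (nbhs t).
    apply: filterS => y ty; rewrite prod_normE ge_max ty/=.
    by rewrite subrr normr0 ltW.
  exact: cg.
split=> [t v|t v w||v|v w]; [|exact: line|exact: cnt..].
exact: line.
Qed.

Lemma is_C2_space (f : R * R3 R -> R) d1 d2 (t : R) : is_C2 f d1 d2 ->
  is_C2 (fun x => f (t, x)) (fun v x => d1 (0, v) (t, x))
    (fun v w x => d2 (0, v) (0, w) (t, x)).
Proof.
move=> [f1 f2 cf c1 c2].
have line (g : R * R3 R -> R) (x v : R3 R) (d : R) : is_derive (t, x) (0, v) g d ->
    is_derive x v (fun x => g (t, x)) d.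
  move=> /(is_derive_line0 _ _ _ _).1 H; apply: (is_derive_line0 _ _ _ _).2.
  rewrite (_ : (fun h : R => g (t, h *: v + x)) =
    (fun h : R => g (h *: (0, v) + (t, x))))//.
  by apply/funext => h; congr (g (_, _)) => /=; rewrite scaler0 add0r.
have cnt (g : R * R3 R -> R) : continuous g -> continuous (fun x => g (t, x)).
  move=> cg x; apply: (@continuous_comp _ _ _ (fun x => (t, x)) g).
    apply/cvgrPdist_le => e e0; have /cvgrPdist_le/(_ e e0) := @cvg_id _ (nbhs x).
    apply: filterS => y xy; rewrite prod_normE ge_max xy andbT/=.
    by rewrite subrr normr0 ltW.
  exact: cg.
split=> [x v|x v w||v|v w]; [|exact: line|exact: cnt..].
exact: line.
Qed.

Definition kg_operator (m : R) (f : R * R3 R -> R)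
    (d2 : R * R3 R -> R * R3 R -> R * R3 R -> R) p :=
  d2 (1, 0) (1, 0) p
  - (d2 (0, (1, 0, 0)) (0, (1, 0, 0)) p + d2 (0, (0, 1, 0)) (0, (0, 1, 0)) p
     + d2 (0, (0, 0, 1)) (0, (0, 0, 1)) p)
  + m ^+ 2 * f p.

Lemma kg_operatorE (m : R) (f : R * R3 R -> R) d1 d2 t x : is_C2 f d1 d2 ->
  derive1n 2 (fun t' => f (t', x)) t - laplacian (fun x => f (t, x)) x
    + m ^+ 2 * f (t, x) = kg_operator m f d2 (t, x).
Proof.
move=> fC; rewrite /kg_operator (laplacian_C2 _ (is_C2_space t fC)).
congr (_ - _ + _); rewrite -(is_C2_derive (1:R) (1:R) t (is_C2_time x fC)).
rewrite /derive1n/= derive1E.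
by congr ('D_1 _ t); apply/funext => u; rewrite derive1E.
Qed.

Variables (omega m q0 : R).
Hypotheses (omega_gt0 : 0 < omega) (q0_ge0 : 0 <= q0).
Local Notation wave := (nat * (R3 R -> R) * R)%type.
Local Notation mode e :=
  (radial_mode (q0 * (1 + (freq e)%:R ^+ 2)) (size_bound e) (amplitude e)).
Local Notation modes K L :=
  {in L, forall e : wave, (freq e <= K)%N /\ mode e}.

Definition C2_growth K (X : R) :=
  (1 + omega * K%:R) ^+ 2 * ((1 + q0 * (1 + K%:R ^+ 2)) * (1 + X)).

Lemma superpose_is_C2 K (L : seq wave) : modes K L -> exists d1 d2,
  [/\ is_C2 (fun p => superpose omega L p.1 p.2) d1 d2,
    forall X, 0 <= X -> C2_bound (fun p => superpose omega L p.1 p.2) d1 d2 X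
      (C2_growth K X * mass L) &
    forall p, kg_operator m (fun p => superpose omega L p.1 p.2) d2 p =
      \sum_(e <- L) cos (omega * (freq e)%:R * p.1) *
        stationary_operator omega m (freq e) (amplitude e) p.2].
Proof.
elim: L => [_|e L IH HL].
  have E : (fun p : R * R3 R => superpose omega [::] p.1 p.2) = fun _ => 0.
    by apply/funext => p; rewrite /superpose big_nil.
  exists (fun _ _ => 0), (fun _ _ _ => 0); rewrite E; split.
  - exact: is_C2_0.
  - by move=> X X0 p _; rewrite /mass big_nil mulr0; split=> *; rewrite normr0 ?mul0r.
  - by move=> p; rewrite /kg_operator big_nil; ring.
have [|d1 [d2 [LC LB LE]]] := IH; first by move=> e' e'L; apply: HL; rewrite inE e'L orbT.
have [eK em] := HL e (mem_head _ _).
have B0 := mode_bound_ge0 em.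
have [e1 [e2 [vC rv vB vX]]] := em.
set ka := omega * (freq e)%:R; have ka0 : 0 <= ka by rewrite mulr_ge0// ltW.
have E : (fun p : R * R3 R => superpose omega (e :: L) p.1 p.2) =
    fun p => cos (ka * p.1) * amplitude e p.2 + superpose omega L p.1 p.2.
  by apply/funext => p; rewrite /superpose big_cons.
have wC := wave_is_C2 ka vC.
exists (fun v p => wave_d1 ka (amplitude e) e1 v p + d1 v p),
  (fun v w p => wave_d2 ka (amplitude e) e1 e2 v w p + d2 v w p); rewrite E; split.
- exact: is_C2D wC LC.
- move=> X X0; rewrite /mass big_cons mulrDr -/(mass L).
  apply: C2_boundD (LB X X0).
  have q1 : 0 <= 1 + q0 * (1 + (freq e)%:R ^+ 2).
    by rewrite addr_ge0// mulr_ge0// addr_ge0// sqr_ge0.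
  have X1 : 0 <= 1 + X by rewrite addr_ge0.
  have := wave_C2_bound ka0 _ (vX X X0); rewrite !mulr_ge0// => /(_ isT).
  apply: C2_bound_le; rewrite /C2_growth -[leRHS]mulrA; apply: ler_pM.
  + exact: sqr_ge0.
  + by rewrite !mulr_ge0.
  + have kaK : ka <= omega * K%:R by rewrite ler_wpM2l ?ler_nat// ltW.
    by rewrite lerXn2r ?nnegrE ?addr_ge0// ?lerD2l// (le_trans ka0).
  + rewrite ler_wpM2r// ler_wpM2r// lerD2l ler_wpM2l// lerD2l lerXn2r ?nnegrE//.
    by rewrite ler_nat.
- move=> p; rewrite big_cons -LE /kg_operator /wave_d2 /=.
  rewrite /stationary_operator (laplacian_C2 _ vC) -/ka.
  have z1 : e1 0 p.2 = 0.
    have [h _ _ _ _] := vC; have [_ <-] := h p.2 0; exact: derive0.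
  have z2 : e2 0 0 p.2 = 0.
    have [_ h _ _ _] := vC; have [_ <-] := h p.2 0 0; exact: derive0.
  rewrite z1 z2 !mulr0 !mul0r !addr0 !add0r; ring.
Qed.

End joint_regularity.

(** * The Lindstedt series *)

Section cosine_synthesis.
Context {R : realType}.
Variables (omega t : R) (x : R3 R).

Let c k : R := if k == 0%N then 1 else 2 * cos (omega * k%:R * t).

Let term (u : ell1 (X1 R)) k : R := c k * X1_fun (ell1_seq u k) x.

(** The value at [(t, x)] of the cosine series with coefficients [u]. As a bounded
    functional on [ell1] it may be applied to a power series term by term, so that
    double series never have to be rearranged. *)
Definition synthesis (u : ell1 (X1 R)) : R := limn (series (term u)).

Let c_le k : `|c k| <= 2.
Proof.
rewrite /c; case: ifP => _; first by rewrite normr1 ler1n.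
rewrite normrM (normr_nat _ 2) ler_piMr// ler_norml cos_geN1 cos_le1//.
Qed.

Let term_le u k : `|term u k| <= 2 * `|u k : X1 R|.
Proof.
rewrite normrM ler_pM//.
by have := (evaluation_bounded x).2 (ell1_seq u k); rewrite mul1r.
Qed.

Let cvg_term u : cvgn (series (term u)).
Proof.
apply: (cvg_dominated_series summable_complete_real (term_le u)).
have := @is_cvg_seriesZ _ R^o 2 _ (@ell1_cvg R _ u).
by congr (cvgn (series _)); apply/funext.
Qed.

Lemma synthesis_bounded : bounded_linear synthesis 2.
Proof.
split=> [a u v|u].
  rewrite /synthesis; apply/cvg_lim => //.
  have -> : series (term (a *: u + v)) = (fun N => a *: series (term u) N + series (term v) N).
    apply/funext => N; rewrite /series/= scaler_sumr -big_split/=.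
    apply: eq_bigr => k _; rewrite /term.
    have E1 : ell1_seq (a *: u + v) k = a *: ell1_seq u k + ell1_seq v k :=
      (coordinate_bounded _ k).1 a u v.
    have E2 : X1_fun (a *: ell1_seq u k + ell1_seq v k) x =
        a *: (X1_fun (ell1_seq u k) x : R^o) + X1_fun (ell1_seq v k) x :=
      (evaluation_bounded x).1 a _ _.
    rewrite E1 E2.
    by rewrite -![_ *: _]/(_ * _); ring.
  by apply: cvgD; [apply: cvgZr; exact: cvg_term|exact: cvg_term].
rewrite ell1_normE.
have c2 := @is_cvg_seriesZ _ R^o 2 _ (@ell1_cvg R _ u).
apply: le_trans (norm_limn_series summable_complete_real (term_le u) c2) _.
by have -> := @limn_seriesZ _ R^o 2 _ (@ell1_cvg R _ u).
Qed.

Lemma synthesis_cvg (u : ell1 (X1 R)) :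
  (fun n => X1_fun (ell1_seq u 0%N) x + \sum_(1 <= k < n)
     2 * cos (omega * k%:R * t) * X1_fun (ell1_seq u k) x) @ \oo --> synthesis u.
Proof.
have cu : series (term u) @ \oo --> synthesis u by exact: cvg_term.
apply: cvg_trans cu; apply: near_eq_cvg; exists 1%N => // n /= n1.
rewrite /series/= [LHS]big_ltn// {1}/term /c eqxx mul1r; congr (_ + _).
rewrite !big_nat; apply: eq_bigr => k /andP[k0 _].
by rewrite /term /c gtn_eqF.
Qed.

Lemma synthesis_coef q0 K (L : seq (nat * (R3 R -> R) * R)) (u : ell1 (X1 R)) :
  {in L, forall e, (freq e <= K)%N /\
    radial_mode (q0 * (1 + (freq e)%:R ^+ 2)) (size_bound e) (amplitude e)} ->
  ell1_seq u = coef L -> synthesis u = superpose omega L t x.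
Proof.
move=> HL uL; apply/cvg_lim => //; apply: cvg_near_cst; exists K.+1 => // N /= KN.
rewrite /series/= /term uL.
have ev := evaluation_bounded x.
pose d (e : nat * (R3 R -> R) * R) k : R := if freq e == k then (if k == 0%N then 1 else 2^-1) else 0.
have E k : c k * X1_fun (coef L k) x = \sum_(e <- L) c k * d e k * amplitude e x.
  have -> : X1_fun (coef L k) x = \sum_(e <- L) d e k * amplitude e x.
    transitivity (\sum_(e <- L) X1_fun (d e k *: X1_of (amplitude e)) x).
      rewrite /coef -/(d _ _); elim: (L) => [|e l IH]; first by rewrite !big_nil.
      by rewrite !big_cons -IH.
    rewrite big_seq [RHS]big_seq; apply: eq_bigr => e /HL[_ em].
    by rewrite (bounded_linearZ ev) (X1_ofE em).1.
  by rewrite mulr_sumr; apply: eq_bigr => e _; rewrite mulrA.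
under eq_bigr do rewrite E.
rewrite exchange_big/= /superpose big_seq [RHS]big_seq; apply: eq_bigr => e /HL[eK _].
rewrite -mulr_suml; congr (_ * _).
rewrite (bigD1_seq (freq e))/= ?iota_uniq ?mem_index_iota//; last first.
  by rewrite (leq_ltn_trans eK).
rewrite big1 ?addr0; last by move=> k ke; rewrite /d eq_sym (negbTE ke) mulr0.
rewrite /d /c eqxx; case: eqVneq => [->|_]; first by rewrite mulr0 mul0r cos0 mulr1.
by field.
Qed.

End cosine_synthesis.

Section lindstedt_series.
Context {R : realType}.
Implicit Types (x : R3 R) (t a : R).
Local Notation wave := (nat * (R3 R -> R) * R)%type.
Variables (omega m q0 ka B : R) (s : nat) (Gamma : R3 R -> R) (L : nat -> seq wave).
Hypotheses (omega_gt0 : 0 < omega) (q0_ge0 : 0 <= q0) (ka_gt0 : 0 < ka).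
Hypothesis Lmode : forall n, {in L n, forall e, (freq e <= s * n)%N /\
  radial_mode (q0 * (1 + (freq e)%:R ^+ 2)) (size_bound e) (amplitude e)}.
Hypothesis massB : forall n, mass (L n) <= B * ka ^+ n.

Let p n t x := superpose omega (L n) t x.

Hypothesis Leq : forall n t x,
  \sum_(e <- L n) cos (omega * (freq e)%:R * t) *
    stationary_operator omega m (freq e) (amplitude e) x =
  Gamma x * conv (conv (p^~ t ^~ x) (p^~ t ^~ x)) (p^~ t ^~ x) n.

Let rho := ka^-1.

Lemma psummable_dominated {W : normedModType R} (c : nat -> W) (M : nat -> R) r :
  (forall n, `|c n| <= M n) -> psummable M r -> psummable c r.
Proof.
move=> cM sM r' r0 rr.
apply: (cvg_dominated_series summable_complete_real _ (sM r' r0 rr)) => n.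
rewrite normrM normr_id normrX ger0_norm// ler_wpM2l ?exprn_ge0//.
exact: le_trans (ler_norm _).
Qed.

Lemma psummable_poly {W : normedModType R} j (c : nat -> W) r : psummable c r ->
  psummable (fun n => n.+1%:R ^+ j *: c n) r.
Proof.
move=> sc; elim: j => [|j IH].
  by under eq_fun do rewrite expr0 scale1r.
move=> r1 r10 r1r; pose r' := (r1 + r) / 2.
have [h1 h2] : r1 < r' /\ r' < r by rewrite /r'; split; lra.
have r'0 : 0 <= r' by exact: le_trans (ltW h1).
have d0 : 0 < r' - r1 by rewrite subr_gt0.
apply: (@cvg_dominated_series _ _ summable_complete_real _
  (fun n => (r' / (r' - r1)) *: (r' ^+ n * `|n.+1%:R ^+ j *: c n|))); last first.
  by apply: (@is_cvg_seriesZ _ R^o); exact: IH.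
move=> n; rewrite normrM normr_id normrX (ger0_norm r10) exprS -scalerA normrZ normr_nat.
rewrite -[_ *: (_ * _)]/(_ * _) mulrA [leRHS]mulrA ler_wpM2r//.
have := power_difference_le n r10 (ltW h1); rewrite exprS => H.
have -> : r' / (r' - r1) * r' ^+ n = (r' * r' ^+ n) / (r' - r1) by field; rewrite gt_eqF.
by rewrite ler_pdivlMr// [r1 ^+ n * _]mulrC.
Qed.

Lemma mass_psummable : psummable (fun n => mass (L n) : R) rho.
Proof.
apply: (@psummable_dominated _ _ (fun n => B * ka ^+ n)).
  move=> n; rewrite ger0_norm//; apply: (@mass_ge0 _ 1 (s * n)%N) => e /Lmode[h1 h2].
  exact: (mode_decays h1 h2).
move=> r r0 rr.
have rk : `|r * ka| < 1.
  by rewrite ger0_norm ?mulr_ge0 ?(ltW ka_gt0)// -ltr_pdivlMr// mul1r.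
apply: (cvg_dominated_series summable_complete_real _
  (is_cvg_geometric_series (a := `|B|) rk)) => n.
by rewrite normrM normr_id !normrM !normrX (ger0_norm r0) (gtr0_norm ka_gt0) /geometric/= exprMn mulrCA.
Qed.

Lemma superpose_psummable t x : psummable (fun n => p n t x : R) rho.
Proof.
apply: psummable_dominated mass_psummable => n.
exact: (superpose_le omega_gt0 t x (@Lmode n)).
Qed.

Lemma harmonic_psummable j t : psummable (fun n => harmonic omega j (L n) t) rho.
Proof.
apply: (@psummable_dominated _ _ (fun n => (omega * s%:R) ^+ j * (n.+1%:R ^+ j * mass (L n)))).
  move=> n; apply: (le_trans (harmonic_le omega_gt0 j t (@Lmode n))).
  rewrite mulrA -exprMn -mulrA ler_wpM2r//.
    by apply: (@mass_ge0 _ 1 (s * n)%N) => e /Lmode[h1 h2]; exact: (mode_decays h1 h2).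
  rewrite lerXn2r ?nnegrE ?mulr_ge0 ?(ltW omega_gt0)// ler_wpM2l ?(ltW omega_gt0)//.
  by rewrite -natrM ler_nat leq_mul.
move=> r r0 rr.
have := @is_cvg_seriesZ _ R^o (`|(omega * s%:R) ^+ j|) _
  (@psummable_poly R^o j _ _ mass_psummable _ r0 rr).
by congr (cvgn (series _)); apply/funext => n;
  rewrite -![_ *: _]/(_ * _) [in RHS]normrM mulrCA.
Qed.

(** [j]-th time derivative of the Lindstedt series. *)
Definition lindstedt j a t : X1 R :=
  limn (series (fun n => a ^+ n *: harmonic omega j (L n) t)).

Lemma lindstedt_derive j a t : `|a| < rho ->
  is_derive t (1:R) (lindstedt j a) (lindstedt j.+1 a t).
Proof.
move=> ar.
pose M n : R := (omega * s%:R) ^+ j.+1 *: (`|a| ^+ n * `|n.+1%:R ^+ j.+1 *: (mass (L n) : R^o)|).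
apply: (@is_derive_series _ _ summable_complete_X1 R
  (fun n t => a ^+ n *: harmonic omega j (L n) t) _ t 1 M 1) => //.
- by move=> n; apply: is_deriveZ; exact: harmonic_derive.
- move=> n h _; rewrite -scalerBr normrZ normrX -[h *: _]/(h * 1) mulr1.
  apply: (le_trans (ler_wpM2l _ (harmonic_lipschitz omega_gt0 j t h (@Lmode n)))).
    exact: exprn_ge0.
  have mL : 0 <= mass (L n).
    by apply: (@mass_ge0 _ 1 (s * n)%N) => e /Lmode[h1 h2]; exact: (mode_decays h1 h2).
  rewrite mulrCA; apply: ler_wpM2l => //; rewrite /M -[_ *: (_ * _)]/(_ * _).
  rewrite [leRHS]mulrCA; apply: ler_wpM2l; first exact: exprn_ge0.
  rewrite normrZ normrX normr_nat (ger0_norm mL) mulrA -exprMn ler_wpM2r//.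
  rewrite lerXn2r ?nnegrE ?mulr_ge0 ?(ltW omega_gt0)// -mulrA ler_wpM2l ?(ltW omega_gt0)//.
  by rewrite -natrM ler_nat leq_mul.
- apply: (@is_cvg_seriesZ _ R^o).
  exact: (@psummable_poly R^o j.+1 _ _ mass_psummable _ (normr_ge0 a) ar).
- move=> h _; have H := psummable_cvg (@summable_complete_X1 R) (@harmonic_psummable j (h *: (1:R) + t)) ar.
  exact: H.
Qed.

Lemma lindstedt_Ck n j a : `|a| < rho -> Ck setT n (lindstedt j a).
Proof.
move=> ar.
have cl i (t : R) : {for t, continuous (lindstedt i a)}.
  have [D _] := lindstedt_derive i t ar.
  by apply: differentiable_continuous; exact/derivable1_diffP.
elim: n j => [|n IH] j; first by split => // t _; exact: cl.
apply: CkS_intro_on; first exact: openT.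
  by move=> t _; exact: cl.
move=> v; exists (fun t => v *: lindstedt j.+1 a t).
  by move=> t _; apply: is_derive_direction; exact: lindstedt_derive.
by apply: Ck_scale; [exact: openT|exact: IH].
Qed.

Lemma lindstedtE a t x : `|a| < rho ->
  X1_fun (lindstedt 0 a t) x = psum (fun n => p n t x : R) a.
Proof.
move=> ar; apply/esym/cvg_lim => //.
have := bounded_linear_limn (evaluation_bounded x)
  (psummable_cvg (@summable_complete_X1 R) (@harmonic_psummable 0%N t) ar).
have -> // : (fun n => X1_fun (a ^+ n *: harmonic omega 0 (L n) t) x) =
    (fun n => a ^+ n *: p n t x).
apply/funext => n.
have -> : X1_fun (a ^+ n *: harmonic omega 0 (L n) t) x =
  a ^+ n * X1_fun (harmonic omega 0 (L n) t) x by [].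
by rewrite (harmonic_superpose _ _ _ (@Lmode n)).
Qed.

Lemma lindstedt_periodic a t :
  lindstedt 0 a (t + 2 * pi / omega) = lindstedt 0 a t.
Proof.
have per k (y : R) : cos (y + pi *+ 2 *+ k) = cos y.
  by elim: k => [|k IH]; rewrite ?mulr0n ?addr0// mulrSr addrA cosD2pi.
rewrite /lindstedt; congr (limn (series _)); apply/funext => n; congr (_ *: _).
rewrite /harmonic; apply: eq_bigr => e _; congr (_ *: _); rewrite !expr0 !mul1r !mul0r !addr0.
have -> : omega * (freq e)%:R * (t + 2 * pi / omega) =
    omega * (freq e)%:R * t + pi *+ 2 *+ freq e.
  rewrite -(mulr_natr (pi *+ 2)) -(mulr_natr pi 2).
  by move: ((freq e)%:R) (pi : R) => k q; field; rewrite gt_eqF.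
exact: per.
Qed.

Lemma conv_powers (y z : nat -> R) a n :
  conv (fun i => a ^+ i * y i) (fun i => a ^+ i * z i) n = a ^+ n * conv y z n.
Proof.
rewrite /conv mulr_sumr !big_nat; apply: eq_bigr => i /andP[_ iN].
by rewrite -{3}(subnKC (m := i) (n := n))// exprD; ring.
Qed.

Lemma lindstedt_cube t x a : `|a| < rho ->
  limn (series (fun n => a ^+ n * conv (conv (p^~ t ^~ x) (p^~ t ^~ x)) (p^~ t ^~ x) n)) =
  psum (fun n => p n t x : R) a ^+ 3.
Proof.
move=> ar; pose y n : R := a ^+ n * p n t x.
have cy : cvgn (series (Num.norm \o y)).
  have := @superpose_psummable t x _ (normr_ge0 a) ar.
  by congr (cvgn (series _)); apply/funext => n /=; rewrite normrM normrX.
have cyy := dominated_conv cy cy.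
have -> : (fun n => a ^+ n * conv (conv (p^~ t ^~ x) (p^~ t ^~ x)) (p^~ t ^~ x) n) =
    conv (conv y y) y.
  apply/funext => n; rewrite -conv_powers; congr (conv _ _ _).
  by apply/funext => i; rewrite -conv_powers.
rewrite (cvg_lim _ (cauchy_product cyy cy))// (cvg_lim _ (cauchy_product cy cy))//.
by rewrite !exprS expr0 mulr1 mulrA.
Qed.

(** The series may be differentiated twice term by term because the wave numbers at
    order [n] are at most [s * n], so that derivatives cost only powers of [n]. *)
Lemma lindstedt_KG a : `|a| < rho ->
  KG_classical_solution m Gamma (fun t x => X1_fun (lindstedt 0 a t) x).
Proof.
move=> ar.
have UE : (fun t x => X1_fun (lindstedt 0 a t) x) =
    (fun t x => limn (series (fun n => a ^+ n * p n t x))).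
  by apply/funext => t; apply/funext => x; rewrite lindstedtE.
rewrite UE {UE}.
pose f n (P : R * R3 R) := a ^+ n * superpose omega (L n) P.1 P.2.
have [D HD] := choice (fun n => superpose_is_C2 m omega_gt0 q0_ge0 (@Lmode n)).
have [D' HD'] := choice HD.
pose f1 n V P := a ^+ n * D n V P; pose f2 n V W P := a ^+ n * D' n V W P.
have fC n : is_C2 (f n) (f1 n) (f2 n).
  by have [h _ _] := HD' n; exact: is_C2Z.
pose G (X : R) := (1 + omega * s%:R) ^+ 2 * ((1 + q0) * (1 + s%:R ^+ 2) * (1 + X)).
have growth X n : 0 <= X -> C2_growth omega q0 (s * n) X <= G X * n.+1%:R ^+ 4.
  move=> X0; rewrite /C2_growth /G natrM.
  have n1 : 1 <= n.+1%:R :> R by rewrite ler1n.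
  have nn : n%:R <= n.+1%:R :> R by rewrite ler_nat.
  have os : 0 <= omega * s%:R by rewrite mulr_ge0// ltW.
  have h1 : 1 + omega * (s%:R * n%:R) <= (1 + omega * s%:R) * n.+1%:R.
    by rewrite mulrA mulrDl mul1r lerD// ler_wpM2l.
  have h2 : 1 + q0 * (1 + (s%:R * n%:R) ^+ 2) <=
      (1 + q0) * (1 + s%:R ^+ 2) * n.+1%:R ^+ 2.
    have n21 : 1 <= n.+1%:R ^+ 2 :> R by rewrite exprn_ege1.
    have nn2 : n%:R ^+ 2 <= n.+1%:R ^+ 2 :> R by rewrite lerXn2r ?nnegrE.
    have s2 : 0 <= s%:R ^+ 2 :> R by rewrite sqr_ge0.
    have k1 : (1:R) + (s%:R * n%:R) ^+ 2 <= (1 + s%:R ^+ 2) * n.+1%:R ^+ 2.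
      by rewrite exprMn mulrDl mul1r lerD// ler_wpM2l.
    have k2 : (1:R) <= (1 + s%:R ^+ 2) * n.+1%:R ^+ 2.
      by apply: le_trans k1; rewrite lerDl sqr_ge0.
    by rewrite -mulrA [leRHS]mulrDl mul1r lerD// ler_wpM2l.
  have -> : (1 + omega * s%:R) ^+ 2 * ((1 + q0) * (1 + s%:R ^+ 2) * (1 + X)) * n.+1%:R ^+ 4 =
      ((1 + omega * s%:R) * n.+1%:R) ^+ 2 *
      (((1 + q0) * (1 + s%:R ^+ 2) * n.+1%:R ^+ 2) * (1 + X)) by ring.
  have z1 : 0 <= 1 + omega * (s%:R * n%:R) by rewrite mulrA addr_ge0// mulr_ge0.
  have z2 : 0 <= 1 + q0 * (1 + (s%:R * n%:R) ^+ 2).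
    by rewrite addr_ge0// mulr_ge0// addr_ge0// sqr_ge0.
  have X1 : 0 <= 1 + X by rewrite addr_ge0.
  apply: ler_pM; [exact: sqr_ge0|exact: mulr_ge0| |exact: ler_wpM2r].
  by rewrite lerXn2r ?nnegrE// (le_trans z1).
have fM (X : R) : exists2 M : nat -> R, cvgn (series M) &
    forall n, C2_bound (f n) (f1 n) (f2 n) X (M n).
  pose X' := Num.max X 0.
  have X'0 : 0 <= X' by rewrite /X' le_max lexx orbT.
  exists (fun n => G X' *: (`|a| ^+ n * `|n.+1%:R ^+ 4 *: (mass (L n) : R^o)|)).
    apply: (@is_cvg_seriesZ _ R^o).
    exact: (@psummable_poly R^o 4 _ _ mass_psummable _ (normr_ge0 a) ar).
  move=> n P PX; have PX' : `|P| <= X' by rewrite /X' le_max PX.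
  have [_ hb _] := HD' n; have := C2_boundZ (a ^+ n) (hb X' X'0).
  have mL : 0 <= mass (L n).
    by apply: (@mass_ge0 _ 1 (s * n)%N) => e /Lmode[h1 h2]; exact: (mode_decays h1 h2).
  move=> /(C2_bound_le (B' := G X' *: (`|a| ^+ n * `|n.+1%:R ^+ 4 *: (mass (L n) : R^o)|))).
  apply => //.
  rewrite normrX normrZ normrX normr_nat (ger0_norm mL) -[_ *: _]/(_ * _).
  rewrite [leRHS]mulrCA; apply: ler_wpM2l; first exact: exprn_ge0.
  by rewrite [leRHS]mulrA ler_wpM2r// growth.
have FC := is_C2_series fC fM.
split; first exact: is_C2_Ck FC.
move=> t x; rewrite (kg_operatorE m t x FC) /kg_operator.
have [M cM HM] := fM `|(t, x)|.
have c0 : cvgn (series (fun n => f n (t, x))).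
  by apply: (cvg_dominated_series summable_complete_real _ cM) => n; have [] := HM n _ (lexx _).
have c2 V W : cvgn (series (fun n => f2 n V W (t, x))).
  apply: (@cvg_dominated_series _ _ summable_complete_real _
    (fun n => (`|V| * `|W|) *: M n)); last exact: (@is_cvg_seriesZ _ R^o).
  by move=> n; have [_ _ h] := HM n _ (lexx _); rewrite -[_ *: _]/(_ * _) mulrC.
rewrite -(lindstedt_cube t x ar).
have cG : cvgn (series (fun n => a ^+ n *
    conv (conv (p^~ t ^~ x) (p^~ t ^~ x)) (p^~ t ^~ x) n)).
  pose y n : R := a ^+ n * p n t x.
  have cy : cvgn (series (Num.norm \o y)).
    have := @superpose_psummable t x _ (normr_ge0 a) ar.
    by congr (cvgn (series _)); apply/funext => n /=; rewrite normrM normrX.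
  have := summable_complete_real (dominated_conv (dominated_conv cy cy) cy).
  by congr (cvgn (series _)); apply/funext => n; rewrite -conv_powers;
    congr (conv _ _ _); apply/funext => i; rewrite -conv_powers.
rewrite -[RHS](@limn_seriesZ _ R^o (Gamma x) _ cG).
apply/esym/cvg_lim => //.
have E : series (fun n => Gamma x *: (a ^+ n *
    conv (conv (p^~ t ^~ x) (p^~ t ^~ x)) (p^~ t ^~ x) n) : R^o) =
  (fun N => series (fun n => f2 n (1, 0) (1, 0) (t, x)) N -
    (series (fun n => f2 n (0, (1, 0, 0)) (0, (1, 0, 0)) (t, x)) N
     + series (fun n => f2 n (0, (0, 1, 0)) (0, (0, 1, 0)) (t, x)) N
     + series (fun n => f2 n (0, (0, 0, 1)) (0, (0, 0, 1)) (t, x)) N)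
    + m ^+ 2 * series (fun n => f n (t, x)) N).
  apply/funext => N; rewrite /series/= mulr_sumr -!big_split/= -sumrB -big_split/=.
  apply: eq_bigr => n _; rewrite -[_ *: _]/(_ * _) mulrCA -Leq.
  have [_ _ h] := HD' n; rewrite -(h (t, x)) /kg_operator /f2 /f /=; ring.
rewrite E; apply: cvgD; last by apply: cvgM; [exact: cvg_cst|exact: c0].
by apply: cvgB; [exact: c2|apply: cvgD; [apply: cvgD|]; exact: c2].
Qed.

Lemma coef_exists n : exists u : ell1 (X1 R), ell1_seq u = coef (L n) /\ `|u| <= mass (L n).
Proof.
have [u uE] := @ell1_exists _ _ (coef (L n)) (mass (L n))
  (fun K => coef_partial K (@Lmode n)).
by exists u; split => //; apply: ell1_norm_le => K; rewrite uE; exact: coef_partial (@Lmode n).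
Qed.

(** The masses also bound the coefficients in [ell1], which therefore form a power
    series on the same disc. *)
Lemma coefficient_series : exists c : nat -> ell1 (X1 R),
  [/\ forall n, ell1_seq (c n) = coef (L n), psummable c rho &
    forall a, `|a| < rho -> polychromatic omega (psum c a) (lindstedt 0 a)].
Proof.
have [c Hc] := choice coef_exists.
have cs : psummable c rho.
  by apply: psummable_dominated mass_psummable => n; have [] := Hc n.
have cX := summable_complete_ell1 (@summable_complete_X1 R).
exists c; split => // [n|a ar t x]; first by have [] := Hc n.
rewrite lindstedtE//; have := @synthesis_cvg R omega t x (psum c a).
suff -> : synthesis omega t x (psum c a) = psum (fun n => p n t x : R) a by [].
apply/esym/cvg_lim => //.
have := bounded_linear_limn (synthesis_bounded omega t x) (psummable_cvg cX cs ar).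
have -> // : (fun n => synthesis omega t x (a ^+ n *: c n)) = (fun n => a ^+ n *: p n t x).
apply/funext => n; rewrite (bounded_linearZ (synthesis_bounded omega t x)).
by have [h _] := Hc n; rewrite (synthesis_coef _ t x (@Lmode n) h).
Qed.

(** The constant is uniform in [t] and [x] because every term is bounded by the mass of
    its superposition. *)
Lemma lindstedt_first_order : exists2 C : R, 0 <= C & forall a t x,
  `|a| <= rho / 2 ->
  `|X1_fun (lindstedt 0 a t) x - p 0%N t x - a * p 1%N t x| <= C * a ^+ 2.
Proof.
have rho0 : 0 < rho by rewrite invr_gt0.
have r0 : 0 < rho / 2 by rewrite divr_gt0.
have rr : rho / 2 < rho by rewrite ltr_pdivrMr// mulr_natr mulr2n ltrDl.
have mL n : 0 <= mass (L n).
  by apply: (@mass_ge0 _ 1 (s * n)%N) => e /Lmode[h1 h2]; exact: (mode_decays h1 h2).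
have cm : cvgn (series (fun n => (rho / 2) ^+ n * mass (L n))).
  have := @mass_psummable _ (ltW r0) rr.
  by congr (cvgn (series _)); apply/funext => n; rewrite ger0_norm.
have M0 n : 0 <= (rho / 2) ^+ n * mass (L n) by rewrite mulr_ge0// exprn_ge0// ltW.
exists ((rho / 2) ^- 2 * limn (series (fun n => (rho / 2) ^+ n * mass (L n)))).
  rewrite mulr_ge0 ?invr_ge0 ?sqr_ge0//.
  apply: le_trans (partial_le_limn 0 M0 cm).
  by rewrite /series/= big_geq.
move=> a t x ar; rewrite lindstedtE ?(le_lt_trans ar)//.
have := psum_first_order (@summable_complete_real R) (@superpose_psummable t x) r0 rr ar.
move=> /le_trans; apply; rewrite mulrC ler_wpM2r ?sqr_ge0//.
rewrite ler_wpM2l ?invr_ge0 ?sqr_ge0//.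
apply: ler_lim; [exact: (@superpose_psummable t x _ (ltW r0) rr)|exact: cm|apply: nearW => N].
apply: ler_sum => n _; rewrite ler_wpM2l ?exprn_ge0 ?(ltW r0)//.
exact: (superpose_le omega_gt0 t x (@Lmode n)).
Qed.

End lindstedt_series.

(** * Infinitely many frequencies *)

Section cosine_polynomials.
Context {R : realType}.
Variable omega : R.
Implicit Types (f g : R -> R).

Local Notation mode k := (fun t : R => cos (omega * k%:R * t)).

(** Inductive, so that stability under products and the vanishing of linear
    functionals are proved by induction. *)
Inductive trig (d : nat) : (R -> R) -> Prop :=
| trig0 : trig d (fun _ => 0)
| trig_cons k (c : R) f : (k < d)%N -> trig d f ->
    trig d (fun t => c * mode k t + f t).

Lemma trigD d f g : trig d f -> trig d g -> trig d (fun t => f t + g t).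
Proof.
move=> tf tg; elim: tf => [|k c f' kd _ IH].
  by under eq_fun do rewrite add0r.
have -> : (fun t => c * mode k t + f' t + g t) = fun t => c * mode k t + (f' t + g t).
  by apply/funext => t; rewrite addrA.
exact: trig_cons.
Qed.

Lemma trig_mode d k (c : R) : (k < d)%N -> trig d (fun t => c * mode k t).
Proof.
move=> kd; have := trig_cons c kd (trig0 d).
by under eq_fun do rewrite addr0.
Qed.

Lemma trig_mode_mul a b k (c : R) f : (k < a)%N -> trig b.+1 f ->
  trig (a + b) (fun t => c * mode k t * f t).
Proof.
move=> ka; elim=> [|l c' f' lb _ IH].
  by under eq_fun do rewrite mulr0; exact: trig0.
have -> : (fun t => c * mode k t * (c' * mode l t + f' t)) =
    fun t => (c * c' / 2) * mode (k + l)%N t +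
      ((c * c' / 2) * mode ((k - l) + (l - k))%N t + c * mode k t * f' t).
  apply/funext => t.
  have -> : cos (omega * (k - l + (l - k))%N%:R * t) =
      cos (omega * k%:R * t - omega * l%:R * t).
    have [kl|kl] := leqP k l.
      rewrite (eqP kl) add0n natrB// -cosN; congr (cos _); ring.
    rewrite (eqP (ltnW kl)) addn0 natrB ?(ltnW kl)//; congr (cos _); ring.
  have -> : omega * (k + l)%N%:R * t = omega * k%:R * t + omega * l%:R * t.
    by rewrite natrD; ring.
  rewrite mulrDr mulrACA cos_mul; set p := cos (_ + _); set q := cos (_ - _).
  by field.
by apply: trig_cons; first lia; apply: trig_cons; first lia.
Qed.

Lemma trigM a b f g : trig a f -> trig b.+1 g -> trig (a + b) (fun t => f t * g t).
Proof.
move=> tf tg; elim: tf => [|k c f' ka _ IH].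
  by under eq_fun do rewrite mul0r; exact: trig0.
under eq_fun do rewrite mulrDl.
by apply: trigD => //; exact: trig_mode_mul.
Qed.

Lemma trig_le a b f : (a <= b)%N -> trig a f -> trig b f.
Proof.
move=> ab; elim=> [|k c f' ka _ IH]; first exact: trig0.
by apply: trig_cons => //; exact: leq_trans ab.
Qed.

Definition trig_lead d (c : R) f := trig d (fun t => f t - c * mode d t).

Lemma trig_lead_trig d c f : trig_lead d c f -> trig d.+1 f.
Proof.
move=> /(trig_le (leqnSn d)) tf; have := trigD (trig_mode c (ltnSn d)) tf.
by congr (trig _ _); apply/funext => t; rewrite addrC subrK.
Qed.

Lemma trig_leadM d d' c c' f g : (0 < d)%N -> (0 < d')%N ->
  trig_lead d c f -> trig_lead d' c' g ->
  trig_lead (d + d') (c * c' / 2) (fun t => f t * g t).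
Proof.
move=> d0 d'0 tf tg; rewrite /trig_lead.
have t1 := trigM tf (trig_lead_trig tg).
have t2 := trigM tg (trig_mode c (ltnSn d)); rewrite addnC in t2.
have t3 : trig (d + d') (fun t => (c * c' / 2) * mode ((d - d') + (d' - d))%N t).
  by apply: trig_mode; lia.
have := trigD t1 (trigD t2 t3); congr (trig _ _); apply/funext => t.
have -> : cos (omega * (d - d' + (d' - d))%N%:R * t) =
    cos (omega * d%:R * t - omega * d'%:R * t).
  have [kl|kl] := leqP d d'.
    rewrite (eqP kl) add0n natrB// -cosN; congr (cos _); ring.
  rewrite (eqP (ltnW kl)) addn0 natrB ?(ltnW kl)//; congr (cos _); ring.
have -> : omega * (d + d')%N%:R * t = omega * d%:R * t + omega * d'%:R * t.
  by rewrite natrD; ring.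
have := cos_mul (omega * d%:R * t) (omega * d'%:R * t).
set p := cos (_ + _); set q := cos (_ - _) => /(congr1 (fun z => z * 2)).
rewrite divfK// => /eqP; rewrite -subr_eq => /eqP <-.
by field.
Qed.

Lemma trig_derive2 d f : trig d f -> exists f1 f2,
  [/\ trig d f2, forall t : R, is_derive t (1:R) f (f1 t) &
    forall t : R, is_derive t (1:R) f1 (f2 t)].
Proof.
elim=> [|k c f' kd _ [f1 [f2 [t2 D1 D2]]]].
  by exists (fun _ => 0), (fun _ => 0); split;
    [exact: trig0|move=> t; exact: is_derive_cst..].
pose w := omega * k%:R.
have Dl (t : R) : is_derive t (1:R) (fun t : R => w * t) w.
  by apply: is_derive_eq; rewrite -![_ *: _]/(_ * _); ring.
have Dcos (t : R) : is_derive t (1:R) (fun t : R => cos (w * t)) (- sin (w * t) * w).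
  exact: (@is_derive1_comp _ cos (fun t : R => w * t)).
have Dsin (t : R) : is_derive t (1:R) (fun t : R => sin (w * t)) (cos (w * t) * w).
  exact: (@is_derive1_comp _ sin (fun t : R => w * t)).
exists (fun t => - c * w * sin (w * t) + f1 t),
  (fun t => (- c * w ^+ 2) * mode k t + f2 t); split.
- exact: trig_cons.
- move=> t; have H := D1 t.
  by apply: is_derive_eq; rewrite -![_ *: _]/(_ * _); ring.
- move=> t; have H := D2 t.
  by apply: is_derive_eq; rewrite -![_ *: _]/(_ * _) /w; ring.
Qed.

Hypothesis omega_gt0 : 0 < omega.

(** Discrete Fourier functional: it vanishes on frequencies below [d] and
    detects the frequency [d]. *)
Definition sampling d f :=
  \sum_(0 <= j < 2 * d) (-1) ^+ j * f (j%:R * pi / (omega * d%:R)).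

Lemma cos_addn_pi (y : R) j : cos (y + j%:R * pi) = (-1) ^+ j * cos y.
Proof.
elim: j => [|j IH]; first by rewrite mul0r addr0 expr0 mul1r.
by rewrite -(natr1 j) mulrDl mul1r addrA cosDpi IH exprS mulN1r mulNr.
Qed.

Lemma sum_cos (al : R) N : 2 * sin (al / 2) * \sum_(0 <= j < N) cos (j%:R * al) =
  sin (N%:R * al - al / 2) + sin (al / 2).
Proof.
elim: N => [|N IH].
  by rewrite big_geq// mulr0 mul0r sub0r sinN addNr.
rewrite big_nat_recr//= mulrDr IH -(natr1 N).
have -> : (N%:R + 1) * al - al / 2 = N%:R * al + al / 2 by field.
rewrite sinB sinD; ring.
Qed.

Lemma sampling_mode d k : (k < d)%N -> sampling d (mode k) = 0.
Proof.
move=> kd; have d0 : (0 < d)%N by exact: leq_ltn_trans kd.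
have dn0 : d%:R != 0 :> R by rewrite pnatr_eq0 -lt0n.
pose al : R := (k + d)%N%:R * pi / d%:R.
have -> : sampling d (mode k) = \sum_(0 <= j < 2 * d) cos (j%:R * al).
  apply: eq_bigr => j _; rewrite -cos_addn_pi; congr (cos _).
  rewrite /al natrD; move: (pi : R) (j%:R : R) (k%:R : R) => q u v.
  by field; rewrite dn0 gt_eqF.
have s0 : 0 < sin (al / 2).
  apply: sin_gt0_pi; apply/andP; split.
    by rewrite divr_gt0// divr_gt0 ?mulr_gt0 ?pi_gt0 ?ltr0n ?addn_gt0 ?d0 ?orbT.
  rewrite /al -mulrA -mulrA mulrCA gtr_pMr ?pi_gt0//.
  rewrite -invfM mulrC ltr_pdivrMl ?mulr1; last by rewrite mulr_gt0// ltr0n.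
  by rewrite -natrM ltr_nat; lia.
have := sum_cos al (2 * d)%N.
have -> : (2 * d)%N%:R * al - al / 2 = - (al / 2) + (2 * (k + d))%N%:R * pi.
  rewrite /al !natrM; move: (pi : R) ((k + d)%N%:R : R) => q u.
  by field.
have sinper (y : R) n : sin (y + (2 * n)%N%:R * pi) = sin y.
  elim: n => [|n IH]; first by rewrite muln0 mul0r addr0.
  rewrite -IH; have -> : y + (2 * n.+1)%N%:R * pi = y + (2 * n)%N%:R * pi + pi *+ 2.
    by rewrite mulnS natrD mulrDl -mulr_natl; ring.
  exact: sinD2pi.
rewrite sinper sinN addNr => /eqP; rewrite !mulf_eq0 pnatr_eq0/= gt_eqF//=.
by move=> /eqP.
Qed.

Lemma sampling_top d : (0 < d)%N -> sampling d (mode d) = (2 * d)%N%:R.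
Proof.
move=> d0; have dn0 : d%:R != 0 :> R by rewrite pnatr_eq0 -lt0n.
transitivity (\sum_(0 <= j < 2 * d) (1 : R)).
  apply: eq_bigr => j _.
  have -> : omega * d%:R * (j%:R * pi / (omega * d%:R)) = 0 + j%:R * pi.
    by move: (pi : R) (j%:R : R) => q u; field; rewrite dn0 gt_eqF.
  by rewrite cos_addn_pi cos0 mulr1 -exprD addnn -mul2n exprM sqrrN expr1n expr1n.
by rewrite big_const_nat subn0 iter_addr_0.
Qed.

Lemma samplingD d f g : sampling d (fun t => f t + g t) = sampling d f + sampling d g.
Proof. by rewrite /sampling -big_split/=; apply: eq_bigr => j _; rewrite mulrDr. Qed.

Lemma samplingZ d (c : R) f : sampling d (fun t => c * f t) = c * sampling d f.
Proof. by rewrite /sampling mulr_sumr; apply: eq_bigr => j _; rewrite mulrCA. Qed.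

Lemma sampling_trig d f : trig d f -> sampling d f = 0.
Proof.
elim=> [|k c f' kd _ IH].
  by rewrite /sampling big1// => j _; rewrite mulr0.
by rewrite samplingD samplingZ sampling_mode// IH mulr0 addr0.
Qed.

Lemma sampling_lead d c f : (0 < d)%N -> trig_lead d c f ->
  sampling d f = c * (2 * d)%N%:R.
Proof.
move=> d0 tf; have -> : f = fun t => (f t - c * mode d t) + c * mode d t.
  by apply/funext => t; rewrite subrK.
by rewrite samplingD samplingZ sampling_top// sampling_trig// add0r.
Qed.

End cosine_polynomials.
Section infinitely_many_frequencies.
Context {R : realType}.
Implicit Types (x : R3 R) (t : R).

Lemma is_C2_of_Ck {V : normedModType R} (f : V -> R) : Ck setT 2 f ->
  is_C2 f (fun v => 'D_v f) (fun v w => 'D_w ('D_v f)).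
Proof.
move=> /CkS_elim[cf H]; have H2 v := CkS_elim (H v).2.
split => [x v|x v w||v|v w]; [exact: (H v).1|exact: ((H2 v).2 w).1|exact: cf| |].
- by move=> x; exact: (H2 v).1.
- exact: Ck_continuous ((H2 v).2 w).2.
Qed.

(** Otherwise [g] would vanish on a cube, which has positive measure. *)
Lemma ae_nonzero_dense (g v : R3 R -> R) : {ae lebesgue3, forall x, g x != 0} ->
  continuous v -> (forall x, g x != 0 -> v x = 0) -> forall x, v x = 0.
Proof.
move=> [A [mA A0 gA]] cv gv z; apply/eqP/negPn/negP => vz.
have nz : 0 < `|v z| by rewrite normr_gt0.
have cn : {for z, continuous (fun x => `|v x|)} by apply: cvg_norm; exact: cv.
have [r /= r0 Hr] := (nbhs_ballP _ _).1 (cvgr_gt _ cn _ nz).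
pose d := r / 2; have d0 : 0 < d by rewrite divr_gt0.
have sub : cube z d `<=` A.
  move=> x /cubeP xd; apply: gA => /= gx.
  have : 0 < `|v x|.
    apply: Hr; rewrite -ball_normE /= distrC (le_lt_trans xd)//.
    by rewrite ltr_pdivrMr// mulr_natr mulr2n ltrDl.
  by rewrite gv// normr0 ltxx.
have mc := measurable_cube z d.
have : (lebesgue3 (cube z d) <= lebesgue3 A)%E by apply: le_measure; rewrite ?inE.
have -> : lebesgue3 (cube z d) = ((2 * d) ^+ 3)%:E by apply: lebesgue3_cube; exact: ltW.
by rewrite A0 lee_fin leNgt exprn_gt0// mulr_gt0.
Qed.

Lemma laplacian_sum n (c : nat -> R) (g : nat -> R3 R -> R) x :
  (forall j, exists d1 d2, is_C2 (g j) d1 d2) ->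
  laplacian (fun y => \sum_(0 <= j < n) c j * g j y) x =
  \sum_(0 <= j < n) c j * laplacian (g j) x.
Proof.
move=> gC; have [e1 [e2 [eC eL]]] : exists e1 e2,
    is_C2 (fun y => \sum_(0 <= j < n) c j * g j y) e1 e2 /\
    e2 (1, 0, 0) (1, 0, 0) x + e2 (0, 1, 0) (0, 1, 0) x + e2 (0, 0, 1) (0, 0, 1) x =
    \sum_(0 <= j < n) c j * laplacian (g j) x.
  elim: n => [|n [e1 [e2 [eC eL]]]].
    exists (fun _ _ => 0), (fun _ _ _ => 0); rewrite big_geq// !addr0; split => //.
    by under eq_fun do rewrite big_geq//; exact: is_C2_0.
  have [d1 [d2 dC]] := gC n.
  have C := is_C2D eC (is_C2Z (c n) dC); do 2 eexists; split.
    by under eq_fun do rewrite big_nat_recr//=; exact: C.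
  by rewrite big_nat_recr//= -eL (laplacian_C2 _ dC); ring.
by rewrite -eL (laplacian_C2 _ eC).
Qed.

(** If only the frequencies up to [K > 0] occurred then the cubic term would
    contain [cos (3 K omega t)] while the linear terms would not. *)
Lemma infinitely_many_frequencies (omega m : R) (Gamma : R3 R -> R) (u : nat -> X1 R)
    (U : R -> X1 R) : 0 < omega -> {ae lebesgue3, forall x, Gamma x != 0} ->
  KG_classical_solution m Gamma (fun t x => U t x) -> polychromatic omega u U ->
  ~ stationary U -> infinite_set [set k | u k != 0].
Proof.
move=> omega0 aeG [UC UE] pU nsU finU; apply: nsU.
have [N HN] : exists N, forall k, u k != 0 -> (k < N)%N.
  have [l lE] := (finite_seqP _).1 finU.
  exists (\sum_(k <- l) k).+1 => k uk; rewrite ltnS.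
  have kl : k \in l by have : [set` l] k by rewrite -lE.
  by rewrite (big_rem k)//= leq_addr.
have U_sum M : (forall k, (M < k)%N -> u k = 0) -> forall t x,
    U t x = u 0%N x + \sum_(1 <= k < M.+1) 2 * cos (omega * k%:R * t) * u k x.
  move=> HM t x; rewrite -(cvg_lim _ (pU t x))//; apply/cvg_lim => //.
  apply: cvg_near_cst; exists M.+1 => // n /= Mn.
  rewrite [in LHS](big_cat_nat (n := M.+1))//=; congr (_ + _).
  rewrite [X in _ + X]big1_seq ?addr0// => k.
  rewrite mem_index_iota => /andP[_ /andP[Mk _]]; rewrite HM//.
  by rewrite mulr0.
have [[k0 [k00 uk0]]|none] := pselect (exists k, (0 < k)%N /\ u k != 0); last first.
  have H t x : U t x = u 0%N x.
    rewrite (U_sum 0%N) ?big_geq ?addr0// => k k0.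
    by apply/eqP/negPn/negP => uk; apply: none; exists k.
  by move=> t t'; apply/val_inj/funext => x; rewrite /= !H.
exfalso.
have exK : exists k, (0 < k)%N && (u k != 0) by exists k0; rewrite k00.
have ubK k : (0 < k)%N && (u k != 0) -> (k <= N)%N by move=> /andP[_ /HN/ltnW].
case: (ex_maxnP exK ubK) => K /andP[K0 uK] Kmax.
have HK k : (K < k)%N -> u k = 0.
  move=> Kk; apply/eqP/negPn/negP => uk.
  by have := Kmax k; rewrite uk (leq_ltn_trans _ Kk)// => /(_ isT); rewrite leqNgt Kk.
have {}U_sum := U_sum K HK.
have lead x : trig_lead omega K (2 * u K x) (fun t => U t x).
  rewrite /trig_lead.
  have -> : (fun t => U t x - 2 * u K x * cos (omega * K%:R * t)) =
      fun t => u 0%N x * cos (omega * 0%:R * t) +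
        \sum_(1 <= k < K) (2 * u k x) * cos (omega * k%:R * t).
    apply/funext => t; rewrite U_sum big_nat_recr//= mulr0 mul0r cos0 mulr1.
    rewrite [2 * u K x * _]mulrAC addrA addrK; congr (_ + _).
    by apply: eq_bigr => k _; rewrite mulrAC.
  apply: trig_cons => //; rewrite unlock /=.
  have : all (fun k => (k < K)%N) (index_iota 1 K).
    by apply/allP => k; rewrite mem_index_iota => /andP[].
  elim: (index_iota 1 K) => [|k l IH] /=; first by move=> _; exact: trig0.
  by move=> /andP[kK lK]; apply: trig_cons => //; exact: IH.
pose d := (K + K + K)%N.
have d0 : (0 < d)%N by rewrite /d; lia.
have Kd : (K.+1 <= d)%N by rewrite /d; lia.
have key x : Gamma x * (u K x) ^+ 3 = 0.
  have tU := trig_le Kd (trig_lead_trig (lead x)).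
  have [f1 [f2 [t2 D1 D2]]] := trig_derive2 tU.
  have dU t : derive1n 2 (fun t' => U t' x) t = f2 t.
    rewrite /derive1n/= derive1E.
    have -> : derive1 (fun t' => U t' x : R) = f1.
      by apply/funext => y; rewrite derive1E; have [_ ->] := D1 y.
    by have [_ ->] := D2 t.
  have cube := trig_leadM (leq_trans K0 (leq_addr K K)) K0
    (trig_leadM K0 K0 (lead x) (lead x)) (lead x).
  (* the Laplacian commutes with sampling in time *)
  have lap0 : sampling omega d (fun t => laplacian (U t) x) = 0.
    rewrite /sampling -laplacian_sum; last first.
      by move=> j; do 2 eexists; exact: is_C2_space (is_C2_of_Ck UC).
    have -> : (fun y => \sum_(0 <= j < 2 * d)
        (-1) ^+ j * U (j%:R * pi / (omega * d%:R)) y) = fun _ => 0.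
      apply/funext => y; have := sampling_trig omega0 (trig_le Kd (trig_lead_trig (lead y))).
      by rewrite /sampling.
    by rewrite (laplacian_C2 x (@is_C2_0 _ (R3 R))) !addr0.
  have E : (fun t => Gamma x * (U t x * U t x * U t x)) =
      fun t => f2 t + (-1 * laplacian (U t) x + m ^+ 2 * U t x).
    apply/funext => t; have := UE t x; rewrite dU => H.
    have -> : U t x * U t x * U t x = U t x ^+ 3 by ring.
    by rewrite -H; ring.
  have := congr1 (sampling omega d) E.
  rewrite samplingZ !samplingD !samplingZ lap0 (sampling_trig omega0 t2).
  rewrite (sampling_trig omega0 tU) (sampling_lead omega0 d0 cube) !mulr0 !addr0.
  have dn : (2 * d)%N%:R != 0 :> R by rewrite pnatr_eq0 muln_eq0/= -lt0n.
  move=> /eqP; rewrite mulrA mulf_eq0 (negbTE dn) orbF => /eqP H.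
  have : Gamma x * (2 * u K x * (2 * u K x) / 2 * (2 * u K x) / 2) = 2 * (Gamma x * u K x ^+ 3).
    by field.
  by rewrite H => /esym/eqP; rewrite mulf_eq0 pnatr_eq0/= => /eqP.
move/eqP: uK; apply; apply/val_inj/funext => x.
have cu : continuous (u K) by exact: X1_continuous.
apply: (ae_nonzero_dense aeG cu) => y Gy; have /eqP := key y.
by rewrite mulf_eq0 (negbTE Gy)/= expf_eq0/= => /eqP.
Qed.

End infinitely_many_frequencies.

(** * The families of solutions *)

Section separation.
Context {R : realType}.
Implicit Types (f g : R -> R -> R).

(** At the times [0] and [pi / (omega * s)] the cosine takes the values 1 and -1. *)
Lemma nonstationary_first_order (omega w C r : R) s f : (0 < s)%N -> 0 < omega ->
  0 < r -> 0 <= C ->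
  (forall a t, `|a| <= r -> `|f a t - w - a * cos (omega * s%:R * t)| <= C * a ^+ 2) ->
  exists2 eps : R, 0 < eps & forall a, 0 < `|a| < eps ->
    exists t t', f a t != f a t'.
Proof.
move=> s0 om0 r0 C0 H.
have sn0 : s%:R != 0 :> R by rewrite pnatr_eq0 -lt0n.
have C1 : 0 < C + 1 by rewrite ltr_wpDl.
exists (Num.min r (C + 1)^-1); first by rewrite lt_min r0 invr_gt0.
move=> a /andP[a0]; rewrite lt_min => /andP[/ltW ar aC].
exists 0, (pi / (omega * s%:R)); apply/eqP => E.
have := H a 0 ar; have := H a (pi / (omega * s%:R)) ar; rewrite -E.
have -> : omega * s%:R * (pi / (omega * s%:R)) = pi.
  by move: (pi : R) => q; field; rewrite sn0 gt_eqF.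
rewrite mulr0 cos0 cospi mulrN1 mulr1 opprK => h1 h2.
have h3 : `|a *+ 2| <= 2 * (C * a ^+ 2).
  have -> : a *+ 2 = (f a 0 - w + a) - (f a 0 - w - a) by ring.
  by rewrite (le_trans (ler_normB _ _))//; lra.
move: h3; rewrite normrMn -(real_normK (num_real a)) => h3.
have h4 : `|a| * (C + 1) < 1 by rewrite -ltr_pdivlMr// div1r.
have : `|a| * (`|a| * (C + 1)) < `|a| * 1 by rewrite ltr_pM2l.
nra.
Qed.

(** At time [0] both cosines are 1; at time [pi / (omega * s')] the one with [s'] is -1
    while the slower one is still larger than -1. *)
Lemma separated_first_order (omega w C C' r r' : R) s s' f g : (0 < s)%N ->
  (s < s')%N -> 0 < omega -> 0 < r -> 0 < r' -> 0 <= C -> 0 <= C' ->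
  (forall a t, `|a| <= r -> `|f a t - w - a * cos (omega * s%:R * t)| <= C * a ^+ 2) ->
  (forall a t, `|a| <= r' -> `|g a t - w - a * cos (omega * s'%:R * t)| <= C' * a ^+ 2) ->
  exists2 eps : R, 0 < eps & forall a b, 0 < `|a| < eps -> 0 < `|b| < eps ->
    exists t, f a t != g b t.
Proof.
move=> s0 ss om0 r0 r'0 C0 C'0 Hf Hg.
have sn0 : 0 < s%:R :> R by rewrite ltr0n.
have sn0' : 0 < s'%:R :> R by rewrite ltr0n (leq_ltn_trans _ ss).
pose x : R := s%:R * pi / s'%:R; pose c := cos x.
have c1 : -1 < c.
  have xI : x \in `[0, pi].
    rewrite in_itv/= /x divr_ge0 ?mulr_ge0 ?pi_ge0 ?(ltW sn0')//=.
    by rewrite ler_pdivrMr// mulrC ler_pM2l ?pi_gt0// ler_nat ltnW.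
  have pI : pi \in `[0, pi : R] by rewrite in_itv/= pi_ge0 lexx.
  rewrite /c -cospi ltr_cos// /x ltr_pdivrMr// mulrC ltr_pM2l ?pi_gt0//.
  by rewrite ltr_nat.
have c2 : c <= 1 by exact: cos_le1.
pose D := C + C'; have D0 : 0 <= D by rewrite addr_ge0.
have D1 : 0 < 6 * D + 1 by rewrite ltr_wpDl// mulr_ge0.
have th0 : 0 < 1 + c by lra.
exists (Num.min r (Num.min r' ((1 + c) / (6 * D + 1)))).
  by rewrite !lt_min r0 r'0 divr_gt0.
move=> a b /andP[a0]; rewrite !lt_min => /and3P[/ltW ar _ aD].
move=> /andP[b0 /and3P[_ /ltW br bD]].
have [//|none] := pselect (exists t, f a t != g b t); exfalso.
have E t : g b t = f a t.
  by apply/esym/eqP/negPn/negP => h; apply: none; exists t.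
have := Hf a 0 ar; have := Hg b 0 br; rewrite E !mulr0 cos0 !mulr1 => g0 f0.
pose t1 : R := pi / (omega * s'%:R).
have := Hf a t1 ar; have := Hg b t1 br; rewrite E.
have -> : omega * s'%:R * t1 = pi.
  by rewrite /t1; move: (pi : R) => q; field; rewrite !gt_eqF.
have -> : omega * s%:R * t1 = x.
  by rewrite /t1 /x; move: (pi : R) => q; field; rewrite !gt_eqF.
rewrite cospi mulrN1 opprK -/c => g1 f1.
pose e := C * a ^+ 2 + C' * b ^+ 2.
have h1 : `|a - b| <= e.
  have -> : a - b = (f a 0 - w - b) - (f a 0 - w - a) by ring.
  by rewrite (le_trans (ler_normB _ _))// /e addrC lerD.
have h2 : `|a * c + b| <= e.
  have -> : a * c + b = (f a t1 - w + b) - (f a t1 - w - a * c) by ring.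
  by rewrite (le_trans (ler_normB _ _))// /e addrC lerD.
have h3 : `|a| * (1 + c) <= 2 * e.
  rewrite -[1 + c]gtr0_norm// -normrM.
  have -> : a * (1 + c) = (a - b) + (a * c + b) by ring.
  by rewrite (le_trans (ler_normD _ _))//; lra.
have h4 : `|b| <= `|a| + e.
  have -> : b = a - (a - b) by ring.
  by rewrite (le_trans (ler_normB _ _))// lerD2l.
have e0 : 0 <= e by rewrite (le_trans _ h1).
have S0 : 0 < `|a| + `|b| by rewrite addr_gt0.
have eD : e * (6 * D + 1) <= D * ((1 + c) * (`|a| + `|b|)).
  have ha : `|a| * (6 * D + 1) <= 1 + c by rewrite -ler_pdivlMr// ltW.
  have hb : `|b| * (6 * D + 1) <= 1 + c by rewrite -ler_pdivlMr// ltW.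
  have k1 : C * a ^+ 2 * (6 * D + 1) <= D * ((1 + c) * `|a|).
    rewrite -(real_normK (num_real a)).
    have -> : C * `|a| ^+ 2 * (6 * D + 1) = C * (`|a| * (6 * D + 1) * `|a|) by ring.
    apply: ler_pM => //; rewrite ?ler_wpM2r// ?mulr_ge0// ?(ltW D1)//.
    by rewrite /D lerDl.
  have k2 : C' * b ^+ 2 * (6 * D + 1) <= D * ((1 + c) * `|b|).
    rewrite -(real_normK (num_real b)).
    have -> : C' * `|b| ^+ 2 * (6 * D + 1) = C' * (`|b| * (6 * D + 1) * `|b|) by ring.
    apply: ler_pM => //; rewrite ?ler_wpM2r// ?mulr_ge0// ?(ltW D1)//.
    by rewrite /D lerDr.
  by rewrite /e [leLHS]mulrDl [(1 + c) * _]mulrDr [leRHS]mulrDr lerD.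
have h5 : (1 + c) * (`|a| + `|b|) <= 6 * e.
  have : (1 + c) * `|b| <= (1 + c) * (`|a| + e) by rewrite ler_wpM2l// ltW.
  have : (1 + c) * e <= 2 * e by rewrite ler_wpM2r//; lra.
  by move: (`|a|) (`|b|) h3 => A B; lra.
have P0 : 0 < (1 + c) * (`|a| + `|b|) by rewrite mulr_gt0.
have : (1 + c) * (`|a| + `|b|) * (6 * D + 1) <= 6 * (D * ((1 + c) * (`|a| + `|b|))).
  apply: (le_trans (ler_wpM2r (ltW D1) h5)).
  by rewrite -mulrA ler_wpM2l.
move: P0; move: ((1 + c) * _) => P P0; lra.
Qed.

End separation.

(** The expansion with [phi 0 = 1], at the origin of space, is what later separates the
    members of the families from each other. *)
Lemma polychromatic_family (R : realType) (Gamma : R3 R -> R) (omega m : R) (w0 : X1 R) :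
  (exists M : R, forall x, `|Gamma x| <= M) -> radial Gamma -> continuous Gamma ->
  0 < m -> m < omega ->
  distributional_solution m w0 (fun x => Gamma x * w0 x ^+ 3) ->
  (forall q0 : X1 R, distributional_solution m q0
     (fun x => 3 * Gamma x * w0 x ^+ 2 * q0 x) -> q0 = 0) ->
  forall s, (0 < s)%N -> exists (rho : R) (U : R -> R -> X1 R) (u : R -> ell1 (X1 R)),
  [/\ 0 < rho /\ (forall t, U 0 t = w0),
    forall a, `|a| < rho ->
      [/\ Ck setT 2 (U a), time_periodic (U a),
          KG_classical_solution m Gamma (fun t x => U a t x) &
          polychromatic omega (u a) (U a)],
    smooth [set a : R | `|a| < rho] u,
    forall k : nat, derive1 (fun a => u a k) 0 != 0 <-> k = s &
    exists2 C : R, 0 <= C & forall a t, `|a| <= rho / 2 ->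
      `|U a t 0 - w0 0 - a * cos (omega * s%:R * t)| <= C * a ^+ 2].
Proof.
move=> [MG GM] rG cG m0 mo w0_sol nondeg s s0.
have om0 : 0 < omega by exact: lt_trans mo.
have MG0 : 0 <= MG by exact: le_trans (GM 0).
have q0_ge0 := frequency_bound_ge0 omega m w0 GM.
have [C0 C00 [S HS]] := right_inverse rG cG GM m0 mo nondeg.
have [B1 [phi [phim phi0 phiE]]] := resonant_mode w0 rG cG GM m0 mo s0.
set q0 := omega ^+ 2 + m ^+ 2 + 3 * MG * `|w0| ^+ 2 in q0_ge0 HS phim.
have [[B0 w0m] w0E] := stationary_regularity m0 rG cG GM w0_sol.
have w0m' : radial_mode q0 B0 w0.
  apply: radial_mode_le w0m; rewrite ?sqr_ge0// /q0 addrAC lerDr.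
  by rewrite addr_ge0 ?sqr_ge0// !mulr_ge0// exprn_ge0.
have w0E' x : stationary_operator omega m 0 w0 x = Gamma x * w0 x ^+ 3.
  by rewrite /stationary_operator w0E; ring.
have [L [L0 L1 Lm [ka ka0 [B B_ge0 LB]] Leq]] := formal_solution rG cG GM C00
  (fun K e De => (HS K e De).1) (fun K e x De => (HS K e De).2 x) w0m' w0E' phim phiE.
have [c [cL cs cP]] := coefficient_series om0 ka0 Lm LB.
have rho0 : 0 < ka^-1 by rewrite invr_gt0.
have cX := summable_complete_ell1 (@summable_complete_X1 R).
have p0 t x : superpose omega (L 0%N) t x = w0 x.
  by rewrite L0 /superpose big_seq1 /freq /amplitude/= mulr0 mul0r cos0 mul1r.
have p1 t x : superpose omega (L 1%N) t x = cos (omega * s%:R * t) * phi x.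
  by rewrite L1 /superpose big_seq1.
exists ka^-1, (lindstedt omega L 0), (psum c); split.
- split => // t; apply/val_inj/funext => x /=.
  by rewrite (lindstedtE om0 ka0 Lm LB)// ?normr0// psum0 p0.
- move=> a ar; split.
  + exact: (lindstedt_Ck om0 ka0 Lm LB).
  + exists (2 * pi / omega); first by rewrite divr_gt0// mulr_gt0// pi_gt0.
    by move=> t; exact: lindstedt_periodic.
  + exact: (lindstedt_KG om0 q0_ge0 ka0 Lm LB Leq).
  + exact: cP.
- exact: psum_smooth.
- move=> k.
  have D : is_derive (0:R) (1:R) (psum c) (psum (pderiv c) 0).
    by apply: (psum_is_derive cX cs); rewrite normr0.
  have [_ Dk] := bounded_linear_derive (coordinate_bounded _ k) D.
  rewrite derive1E Dk psum0 /pderiv scale1r cL L1 /coef big_seq1 /freq /amplitude/=.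
  have [E _] := X1_ofE phim.
  have phiX : X1_of phi != 0.
    apply/eqP => h; have : X1_fun (X1_of phi) 0 = 0 by rewrite h.
    by rewrite E phi0 => /eqP; rewrite oner_eq0.
  split => [|->]; last first.
    rewrite eqxx scaler_eq0 (negbTE phiX) orbF; by case: ifP => _; rewrite ?oner_eq0.
  by have [->|_] := eqVneq s k; rewrite ?scale0r ?eqxx.
- have [C C_ge0 HC] := lindstedt_first_order om0 ka0 Lm LB.
  exists C => // a t ar; have := HC a t 0 ar.
  by rewrite p0 p1 phi0 mulr1.
Qed.

Theorem theorem1 (R : realType) (Gamma : R3 R -> R) (omega m : R) (w0 : X1 R)
    (Gamma_bounded : exists M : R, forall x, `|Gamma x| <= M)
    (Gamma_radial : radial Gamma)
    (Gamma_C1 : Ck setT 1 Gamma)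
    (m_gt0 : 0 < m) (m_lt_omega : m < omega)
    (w0_neq0 : w0 != 0)
    (w0_sol : distributional_solution m w0 (fun x => Gamma x * w0 x ^+ 3))
    (w0_nondegenerate : forall q0 : X1 R,
       distributional_solution m q0
         (fun x => 3 * Gamma x * w0 x ^+ 2 * q0 x) -> q0 = 0) :
  exists (J : nat -> set R) (U : nat -> R -> R -> X1 R)
         (u : nat -> R -> ell1 (X1 R)),
    (forall s : nat, (0 < s)%N ->
      [/\ [/\ open (J s), is_interval (J s) & J s 0],
          forall t, U s 0 t = w0,
          (* (i) *)
          forall a, J s a ->
            [/\ Ck setT 2 (U s a),
                time_periodic (U s a),
                KG_classical_solution m Gamma (fun t x => U s a t x) &
                polychromatic omega (u s a) (U s a)],
          (* (ii) *)
          [/\ smooth (J s) (u s),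
              forall k : nat,
                derive1 (fun a => u s a k) 0 != 0 <-> k = s &
              exists2 eps : R, 0 < eps & forall a, J s a ->
                0 < `|a| < eps -> ~ stationary (U s a)] &
          (* (iii) *)
          {ae lebesgue3, forall x, Gamma x != 0} ->
            forall a, J s a -> ~ stationary (U s a) ->
              infinite_set [set k : nat | u s a k != 0]]) /\
    (forall s s' : nat, (0 < s)%N -> (0 < s')%N -> s != s' ->
      exists2 eps : R, 0 < eps & forall a b, J s a -> J s' b ->
        0 < `|a| < eps -> 0 < `|b| < eps -> U s a <> U s' b).
Proof.
have om0 : 0 < omega by exact: lt_trans m_lt_omega.
have cG : continuous Gamma by exact: Ck_continuous Gamma_C1.
pose good s (F : R * (R -> R -> X1 R) * (R -> ell1 (X1 R))) := (0 < s)%N ->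
  let rho := F.1.1 in let U := F.1.2 in let u := F.2 in
  [/\ 0 < rho /\ (forall t, U 0 t = w0),
    forall a, `|a| < rho ->
      [/\ Ck setT 2 (U a), time_periodic (U a),
          KG_classical_solution m Gamma (fun t x => U a t x) &
          polychromatic omega (u a) (U a)],
    smooth [set a : R | `|a| < rho] u,
    forall k : nat, derive1 (fun a => u a k) 0 != 0 <-> k = s &
    exists2 C : R, 0 <= C & forall a t, `|a| <= rho / 2 ->
      `|U a t 0 - w0 0 - a * cos (omega * s%:R * t)| <= C * a ^+ 2].
have ex s : exists F, good s F.
  have [->|s0] := posnP s.
    by exists (0, (fun _ _ => w0), (fun _ => 0)).
  have [rho [U [u H]]] := polychromatic_family Gamma_bounded Gamma_radial cG
    m_gt0 m_lt_omega w0_sol w0_nondegenerate s0.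
  by exists (rho, U, u).
have [F HF] := choice ex.
have half (r : R) : 0 < r -> 0 < r / 2 by move=> r0; rewrite divr_gt0.
exists (fun s => [set a : R | `|a| < (F s).1.1]), (fun s => (F s).1.2), (fun s => (F s).2).
split=> [s s0|].
  have [[rho0 U0] sol smooth_u du [C C0 HC]] := HF s s0; split => //.
  - split; [exact: open_disc| |by rewrite /= normr0].
    move=> x y /=; rewrite !ltr_norml => /andP[x1 x2] /andP[y1 y2] z /andP[xz zy].
    by rewrite ltr_norml (lt_le_trans x1 xz) (le_lt_trans zy y2).
  - split => //.
    have [eps eps0 Heps] := nonstationary_first_order s0 om0 (half _ rho0) C0 HC.
    exists eps => // a _ /Heps[t [t' /eqP ne]] st; apply: ne.
    by rewrite (st t t').
  - move=> aeG a Ja nst; have [_ _ KG pol] := sol a Ja.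
    exact: infinitely_many_frequencies om0 aeG KG pol nst.
suff H s s' : (0 < s)%N -> (s < s')%N ->
    exists2 eps : R, 0 < eps & forall a b, 0 < `|a| < eps -> 0 < `|b| < eps ->
      (F s).1.2 a <> (F s').1.2 b.
  move=> s s' s0 s'0; rewrite neq_ltn => /orP[ss|ss].
    by have [eps eps0 He] := H s s' s0 ss; exists eps => // a b _ _; exact: He.
  have [eps eps0 He] := H s' s s'0 ss.
  by exists eps => // a b _ _ ha hb /esym; exact: He.
move=> s0 ss; have s'0 : (0 < s')%N by exact: leq_ltn_trans ss.
have [[rho0 _] _ _ _ [C C0 HC]] := HF s s0.
have [[rho'0 _] _ _ _ [C' C'0 HC']] := HF s' s'0.
have [eps eps0 He] := separated_first_order s0 ss om0 (half _ rho0) (half _ rho'0)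
  C0 C'0 HC HC'.
exists eps => // a b ha hb E; have [t /eqP] := He a b ha hb.
by apply; rewrite E.
Qed.
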